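(* Let $b\in U_3(L)$ be basic and $\tilde w\in\widetilde W$. Then $X_{\tilde w}(b)\neq\emptyset$ if and only if $\tilde w\notin\bigsqcup_{m\in\mathbb{N}_+}\mathbb{O}^{\min}_{2m,\delta}$, where $\mathbb{O}^{\min}_{2m,\delta}$ denotes the set of minimal length elements of $\mathbb{O}_{2m,\delta}$.
   Context: $\mathbf{k}$ is an algebraic closure of $\mathbb{F}_q$, $L=\mathbf{k}((\epsilon))$, $F=\mathbb{F}_q((\epsilon))$. $U_3$ stands for the quasi-split unitary group of semisimple rank 2 over $F$, split over $L$, taken in its adjoint form, so that its Iwahori–Weyl group is the group $\widetilde W$ below and the Frobenius $\sigma$ of $U_3(L)$ induces the automorphism $\delta$ below on $\widetilde W$. $I$ is a $\sigma$-stable Iwahori subgroup, and $X_{\tilde w}(b)=\{gI\in U_3(L)/I\mid g^{-1}b\sigma(g)\in I\tilde wI\}$. $b$ is basic if its Newton vector is central (hence $0$). $W=\langle s_1,s_2\rangle$ is the finite Weyl group of type $A_2$; $\alpha_1,\alpha_2$ are the simple roots, identified with the simple coroots ($\langle\alpha_i,\alpha_i\rangle=2$, $\langle\alpha_1,\alpha_2\rangle=-1$); $Q=\mathbb{Z}\alpha_1\oplus\mathbb{Z}\alpha_2$; $P$ is the coweight lattice; $\widetilde W=P\rtimes W$ with translations $t^\lambda$. $W_a=Q\rtimes W$ is the Coxeter group generated by $s_0=t^{\alpha_1+\alpha_2}s_1s_2s_1$, $s_1$, $s_2$; $\widetilde W=W_a\rtimes\langle\tau\rangle$ with $\tau^3=1$,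 $\tau s_0\tau^{-1}=s_1$, $\tau s_1\tau^{-1}=s_2$, $\tau s_2\tau^{-1}=s_0$; $\ell$ extends the length of $W_a$ by $\ell(w\tau^j)=\ell(w)$. $\delta$ is the automorphism of $\widetilde W$ fixing $s_0$ and interchanging $s_1$ and $s_2$ (so $\delta(\tau)=\tau^{-1}$). Elements $\tilde w,\tilde w'$ are $\delta$-conjugate if $\tilde w'=\tilde x\tilde w\delta(\tilde x)^{-1}$ for some $\tilde x\in\widetilde W$. For $X\subset W_a$ put $\widehat X=X\sqcup\{(\tau x\tau^{-1})\tau^2\mid x\in X\}\sqcup\{(\tau^2x\tau^{-2})\tau\mid x\in X\}$. For $m\in\mathbb{N}_+$ let $\epsilon(m)=1$ if $m$ is odd and $0$ if $m$ is even, and let $\mathbb{O}_{2m,\delta}=\widehat X_m$ (a $\delta$-conjugacy class), where $X_m$ consists of the elements, for all $k\in\mathbb{Z}$, $t^{(k-\lfloor m/2\rfloor)\alpha_1+(2k+\epsilon(m))\alpha_2}s_2s_1$, $t^{(k+\lfloor (m+1)/2\rfloor)\alpha_1+(2k+\epsilon(m))\alpha_2}s_2s_1$, $t^{(2k+\epsilon(m))\alpha_1+(k+\lfloor (m+1)/2\rfloor)\alpha_2}s_1s_2$, $t^{(2k+\epsilon(m))\alpha_1+(k-\lfloor m/2\rfloor)\alpha_2}s_1s_2$, $t^{k\alpha_1+(m-k)\alpha_2}$, $t^{(k-m)\alpha_1-k\alpha_2}$. *)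

(* Defs.v *)
From HB Require Import structures.
From mathcomp Require Import all_boot all_order all_algebra all_fingroup all_solvable.
From mathcomp Require Import all_field.
From mathcomp Require Import boolp classical_sets functions cardinality fsbigop.
From mathcomp Require Import zify generic_quotient.

Set Implicit Arguments.
Unset Strict Implicit.
Unset Printing Implicit Defensive.

Import Order.TTheory GRing.Theory Num.Theory.

Local Open Scope classical_set_scope.
Local Open Scope quotient_scope.
Local Open Scope ring_scope.

(* k((ε)): the coefficient of ε^n is lcoef n. *)
Record laurent (k : nzRingType) := Laurent {
  lcoef :> int -> k;
  lcoef_bounded : exists N : int, forall n : int, n < N -> lcoef n = 0
}.

HB.instance Definition _ (k : nzRingType) := gen_eqMixin (laurent k).
HB.instance Definition _ (k : nzRingType) := gen_choiceMixin (laurent k).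

Lemma laurentP (k : nzRingType) (f g : laurent k) :
  (forall n, lcoef f n = lcoef g n) -> f = g.
Proof.
case: f g => [f hf] [g hg] /= /funext fg; case: _ / fg hg => hg.
by rewrite (Prop_irrelevance hf hg).
Qed.

Section LaurentField.
Variable k : fieldType.
Implicit Types f g h : laurent k.

Lemma lzero_subproof : exists N : int, forall n : int, n < N -> (0 : k) = 0.
Proof. by exists 0. Qed.
Definition lzero : laurent k := Laurent lzero_subproof.

Lemma lmono_subproof (m : int) :
  exists N : int, forall n : int, n < N -> (n == m)%:R = 0 :> k.
Proof. by exists m => n /lt_eqF ->. Qed.
Definition lmono (m : int) : laurent k := Laurent (lmono_subproof m).

Lemma lopp_subproof f : exists N : int, forall n : int, n < N -> - f n = 0.
Proof. by have [N hN] := lcoef_bounded f; exists N => n /hN ->; rewrite oppr0. Qed.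
Definition lopp f : laurent k := Laurent (lopp_subproof f).

Lemma ladd_subproof f g :
  exists N : int, forall n : int, n < N -> f n + g n = 0.
Proof.
have [M hM] := lcoef_bounded f; have [N hN] := lcoef_bounded g.
exists (Num.min M N) => n; rewrite lt_min => /andP[/hM -> /hN ->].
by rewrite addr0.
Qed.
Definition ladd f g : laurent k := Laurent (ladd_subproof f g).

(* The sum has finite support: f and g vanish in low enough degrees. *)
Definition lconv f g (n : int) : k := \sum_(i \in [set: int]) f i * g (n - i).

Let ltrunc (M : int) (d : nat) (f : int -> k) : {poly k} :=
  \poly_(i < d) f (M + i%:Z).

Lemma lconv_low f g M N n : (forall i, i < M -> f i = 0) ->
  (forall i, i < N -> g i = 0) -> n < M + N -> lconv f g n = 0.
Proof.
move=> hM hN nMN; rewrite /lconv fsbig1 // => i _.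
case: (ltP i M) => [/hM ->|Mi]; first by rewrite mul0r.
by rewrite hN ?mulr0 //; lia.
Qed.

Lemma lconvE f g M N d j : (forall i, i < M -> f i = 0) ->
  (forall i, i < N -> g i = 0) -> (j < d)%N ->
  lconv f g (M + N + j%:Z) = (ltrunc M d f * ltrunc N d g)`_j.
Proof.
move=> hM hN jd; rewrite coefM.
pose r := [seq M + i%:Z | i <- iota 0 j.+1].
have ur : uniq r by rewrite map_inj_uniq ?iota_uniq // => x y; lia.
rewrite /lconv -(@fsbig_widen _ _ _ _ [set` r]) => [|//|i /= [_ ir]]; last first.
  case: (ltP i M) => [/hM ->|Mi]; first by rewrite mul0r.
  rewrite hN ?mulr0 //; suff: ~ (i <= M + j%:Z) by lia.
  move=> ij; apply: ir; apply/mapP; exists (absz (i - M)%R); last by lia.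
  by rewrite mem_iota; lia.
rewrite -fsbig_seq //= big_map -[RHS](big_mkord xpredT
  (fun i => (ltrunc M d f)`_i * (ltrunc N d g)`_(j - i))) /index_iota subn0.
rewrite big_seq [RHS]big_seq; apply: eq_bigr => i.
rewrite mem_iota add0n leq0n /= ltnS => ij; rewrite !coef_poly.
have -> : (i < d)%N by lia.
have -> : (j - i < d)%N by lia.
by congr (_ * g _); lia.
Qed.

Lemma lmul_subproof f g :
  exists N : int, forall n : int, n < N -> lconv f g n = 0.
Proof.
have [M hM] := lcoef_bounded f; have [N hN] := lcoef_bounded g.
by exists (M + N) => n; apply: lconv_low.
Qed.
Definition lmul f g : laurent k := Laurent (lmul_subproof f g).

Lemma laddA : associative ladd.
Proof. by move=> f g h; apply: laurentP => n /=; rewrite addrA. Qed.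
Lemma laddC : commutative ladd.
Proof. by move=> f g; apply: laurentP => n /=; rewrite addrC. Qed.
Lemma ladd0 : left_id lzero ladd.
Proof. by move=> f; apply: laurentP => n /=; rewrite add0r. Qed.
Lemma laddN : left_inverse lzero lopp ladd.
Proof. by move=> f; apply: laurentP => n /=; rewrite addNr. Qed.

HB.instance Definition _ :=
  GRing.isZmodule.Build (laurent k) laddA laddC ladd0 laddN.

Lemma lmulC : commutative lmul.
Proof.
move=> f g; apply: laurentP => n /=.
have [M hM] := lcoef_bounded f; have [N hN] := lcoef_bounded g.
case: (ltP n (M + N)) => [h|h].
  by rewrite (lconv_low hM hN) // (lconv_low hN hM) // addrC.
have -> : n = M + N + (absz (n - (M + N))%R)%:Z by lia.
by rewrite (lconvE hM hN (ltnSn _)) [M + N]addrC (lconvE hN hM (ltnSn _)) mulrC.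
Qed.

Lemma lmulA : associative lmul.
Proof.
move=> f g h; apply: laurentP => n /=.
have [M hM] := lcoef_bounded f; have [N hN] := lcoef_bounded g.
have [P hP] := lcoef_bounded h.
have hMN i : i < M + N -> lmul f g i = 0 by apply: lconv_low.
have hNP i : i < N + P -> lmul g h i = 0 by apply: lconv_low.
case: (ltP n (M + N + P)) => [H|H].
  by rewrite (lconv_low hM hNP) ?(lconv_low hMN hP) //; lia.
pose j := (absz (n - (M + N + P))%R).
have -> : n = M + N + P + j%:Z by rewrite /j; lia.
rewrite (lconvE hMN hP (ltnSn j)) -[M + N + P]addrA.
rewrite (lconvE hM hNP (ltnSn j)).
transitivity (ltrunc M j.+1 f * (ltrunc N j.+1 g * ltrunc P j.+1 h))`_j.
  rewrite !coefM; apply: eq_bigr => i _; congr (_ * _).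
  have ij : (j - i < j.+1)%N by lia.
  by rewrite coef_poly ij /= (lconvE hN hP ij).
rewrite mulrA !coefM; apply: eq_bigr => i _; congr (_ * _).
by rewrite coef_poly ltn_ord /= (lconvE hM hN (ltn_ord i)).
Qed.

Lemma lmul1 : left_id (lmono 0) lmul.
Proof.
move=> f; apply: laurentP => n /=.
have [M hM] := lcoef_bounded f.
have h0 i : i < 0 -> lmono 0 i = 0 by move=> /= /lt_eqF ->.
case: (ltP n M) => [h|h]; first by rewrite (lconv_low h0 hM) ?add0r // hM.
have -> : n = 0 + M + (absz (n - M)%R)%:Z by lia.
rewrite (lconvE h0 hM (ltnSn _)).
have -> : ltrunc 0 (absz (n - M)%R).+1 (lmono 0) = 1.
  apply/polyP => i; rewrite coef_poly coef1 add0r /=.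
  by case: ltnP => // ?; rewrite (_ : (i == 0)%N = false) //; lia.
by rewrite mul1r coef_poly ltnSn add0r.
Qed.

Lemma lmulDl : left_distributive lmul ladd.
Proof.
move=> f g h; apply: laurentP => n /=.
have [M1 hM1] := lcoef_bounded f; have [M2 hM2] := lcoef_bounded g.
have [N hN] := lcoef_bounded h.
pose M := Num.min M1 M2.
have hf i : i < M -> f i = 0 by rewrite lt_min => /andP[/hM1].
have hg i : i < M -> g i = 0 by rewrite lt_min => /andP[_ /hM2].
have hfg i : i < M -> ladd f g i = 0.
  by move=> iM /=; rewrite hf // hg // addr0.
case: (ltP n (M + N)) => [H|H].
  by rewrite (lconv_low hf hN) // (lconv_low hg hN) // (lconv_low hfg hN) ?addr0.
have -> : n = M + N + (absz (n - (M + N))%R)%:Z by lia.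
rewrite (lconvE hfg hN (ltnSn _)) (lconvE hf hN (ltnSn _)).
rewrite (lconvE hg hN (ltnSn _)) -coefD -mulrDl.
set d := (absz _).+1.
suff -> : ltrunc M d (ladd f g) = ltrunc M d f + ltrunc M d g by [].
by apply/polyP => i; rewrite coefD !coef_poly; case: ifP => //; rewrite addr0.
Qed.

Lemma lone_neq0 : lmono 0 != 0.
Proof.
apply/eqP => /(congr1 (fun f : laurent k => f 0)) /= /eqP.
by rewrite oner_eq0.
Qed.

HB.instance Definition _ := GRing.Zmodule_isComNzRing.Build (laurent k)
  lmulA lmulC lmul1 lmulDl lone_neq0.

Fixpoint linv_prefix (u : nat -> k) (n : nat) : seq k :=
  if n is m.+1 then let s := linv_prefix u m in
    rcons s (((m == 0)%N%:R - \sum_(i < m) s`_i * u (m - i)%N) / u 0%N)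
  else [::].

Lemma linv_series (u : nat -> k) : u 0%N != 0 ->
  exists v : nat -> k, forall n, \sum_(i < n.+1) v i * u (n - i)%N = (n == 0)%N%:R.
Proof.
move=> u0; exists (fun i => (linv_prefix u i.+1)`_i) => n.
have sz m : size (linv_prefix u m) = m by elim: m => //= m IH; rewrite size_rcons IH.
have E m i : (i < m)%N -> (linv_prefix u m)`_i = (linv_prefix u i.+1)`_i.
  elim: m => // m IH; rewrite ltnS leq_eqVlt => /orP[/eqP -> //|im].
  by rewrite -IH //= nth_rcons sz im.
rewrite big_ord_recr /= subnn nth_rcons sz ltnn eqxx divfK //.
set S := (X in _ + (_ - X)); set S' := (X in X + _).
suff -> : S' = S by rewrite addrC subrK.
by apply: eq_bigr => i _; rewrite -[rcons _ _]/(linv_prefix u i.+1) [in RHS]E.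
Qed.

Lemma laurent_has_inv f : f != 0 -> exists g, f * g = 1.
Proof.
move=> f0; have [N hN] := lcoef_bounded f.
have [i0 hi0] : exists i : nat, f (N + i%:Z) != 0.
  apply: contrapT => H; case/eqP: f0; apply: laurentP => n /=.
  case: (ltP n N) => [/hN //|Nn]; apply/eqP/negPn/negP => fn.
  by apply: H; exists (absz (n - N)%R); rewrite (_ : N + _ = n) //; lia.
case: (ex_minnP (ex_intro (fun i : nat => f (N + i%:Z) != 0) i0 hi0)) => m hm mmin.
pose M := N + m%:Z.
have hM i : i < M -> f i = 0.
  case: (ltP i N) => [/hN //|Ni iM]; apply/eqP/negPn/negP => fi.
  have := mmin (absz (i - N)%R); rewrite (_ : N + _ = i); last by lia.
  by move=> /(_ fi); rewrite /M in iM; lia.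
have [|v hv] := @linv_series (fun i => f (M + i%:Z)); first by rewrite addr0.
pose c (n : int) : k := if n < - M then 0 else v (absz (n + M)%R).
have hc : exists P : int, forall n : int, n < P -> c n = 0.
  by exists (- M) => n; rewrite /c => ->.
exists (Laurent hc); apply: laurentP => n.
have hc' i : i < - M -> Laurent hc i = 0 by rewrite /= /c => ->.
rewrite (_ : lcoef (f * _) n = lconv f (Laurent hc) n) //.
rewrite (_ : lcoef 1 n = (n == 0)%:R) //.
case: (ltP n 0) => [n0|n0].
  by rewrite (lconv_low hM hc') ?subrr // lt_eqF.
have -> : n = M + - M + (absz n)%:Z by lia.
rewrite (lconvE hM hc' (ltnSn _)) subrr add0r mulrC coefM.
transitivity (((absz n) == 0)%N%:R : k); last by [].
rewrite -hv; apply: eq_bigr => i _; rewrite !coef_poly.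
rewrite ltn_ord (_ : (absz n - i < _)%N); last by lia.
congr (_ * _); rewrite /= /c (_ : (_ < _) = false); last by lia.
by congr v; lia.
Qed.

Definition linv f : laurent k := xget 0 [set g | f * g = 1].

Lemma lmulV f : f != 0 -> linv f * f = 1.
Proof. by move=> /laurent_has_inv f0; rewrite mulrC; apply: (xgetPex 0 f0). Qed.

Lemma linv0 : linv 0 = 0.
Proof.
rewrite /linv; case: xgetP => // g _ /= /eqP.
by rewrite mul0r eq_sym oner_eq0.
Qed.

HB.instance Definition _ := GRing.ComNzRing_isField.Build (laurent k) lmulV linv0.

Definition eps : laurent k := lmono 1.

(* Membership in k[[ε]] and in εk[[ε]]. *)
Definition lintegral f : Prop := forall n : int, n < 0 -> f n = 0.
Definition lmaximal f : Prop := forall n : int, n <= 0 -> f n = 0.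

End LaurentField.

Section LaurentMap.
Variables (k k' : fieldType) (phi : {rmorphism k -> k'}).

Lemma laurent_map_subproof (f : laurent k) :
  exists N : int, forall n : int, n < N -> phi (f n) = 0.
Proof. by have [N hN] := lcoef_bounded f; exists N => n /hN ->; rewrite rmorph0. Qed.

Definition laurent_map (f : laurent k) : laurent k' :=
  Laurent (laurent_map_subproof f).

Lemma laurent_map_is_zmod_morphism : zmod_morphism laurent_map.
Proof. by move=> f g; apply: laurentP => n /=; rewrite rmorphB. Qed.

Lemma laurent_map_is_monoid_morphism : monoid_morphism laurent_map.
Proof.
split=> [|f g]; apply: laurentP => n; first by rewrite /= rmorph_nat.
have [M hM] := lcoef_bounded f; have [N hN] := lcoef_bounded g.
have hM' i : i < M -> laurent_map f i = 0 by move=> /hM /= ->; rewrite rmorph0.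
have hN' i : i < N -> laurent_map g i = 0 by move=> /hN /= ->; rewrite rmorph0.
rewrite /= -/(lconv (laurent_map f) (laurent_map g) n).
case: (ltP n (M + N)) => [H|H].
  by rewrite (lconv_low hM hN) // (lconv_low hM' hN') // rmorph0.
have -> : n = M + N + (absz (n - (M + N))%R)%:Z by lia.
rewrite (lconvE hM hN (ltnSn _)) (lconvE hM' hN' (ltnSn _)) !coefM rmorph_sum.
apply: eq_bigr => i _; rewrite rmorphM !coef_poly /=.
by do 2![case: ifP; rewrite ?rmorph0].
Qed.

HB.instance Definition _ := GRing.isZmodMorphism.Build _ _ laurent_map
  laurent_map_is_zmod_morphism.
HB.instance Definition _ := GRing.isMonoidMorphism.Build _ _ laurent_map
  laurent_map_is_monoid_morphism.

End LaurentMap.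

Section PGL.
Variables (n : nat) (K : fieldType).

Definition GL := {A : 'M[K]_n | A \in unitmx}.

Lemma GL_mul_subproof (A B : GL) : val A *m val B \in unitmx.
Proof. by rewrite unitmx_mul (valP A) (valP B). Qed.
Definition GLmul (A B : GL) : GL := Sub (val A *m val B) (GL_mul_subproof A B).

Lemma GL_inv_subproof (A : GL) : invmx (val A) \in unitmx.
Proof. by rewrite unitmx_inv (valP A). Qed.
Definition GLinv (A : GL) : GL := Sub (invmx (val A)) (GL_inv_subproof A).

Definition GLone : GL := Sub 1%:M (unitmx1 K n).

Definition proportional (A B : GL) : bool :=
  `[< exists2 c : K, c != 0 & val A = c *: val B >].

Lemma proportional_refl : reflexive proportional.
Proof.
by move=> A; apply/asboolP; exists 1; rewrite ?oner_neq0 ?scale1r.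
Qed.

Lemma proportional_sym : symmetric proportional.
Proof.
have H A B : proportional A B -> proportional B A.
  move=> /asboolP[c c0 e]; apply/asboolP; exists c^-1; rewrite ?invr_eq0 //.
  by rewrite e scalerA mulVf // scale1r.
by move=> A B; apply/idP/idP; apply: H.
Qed.

Lemma proportional_trans : transitive proportional.
Proof.
move=> B A C /asboolP[c c0 e] /asboolP[d d0 e'].
by apply/asboolP; exists (c * d); rewrite ?mulf_neq0 // e e' scalerA.
Qed.

Canonical proportional_equiv := EquivRel proportional
  proportional_refl proportional_sym proportional_trans.

Definition PGL := {eq_quot proportional}.

HB.instance Definition _ : EqQuotient _ proportional PGL := EqQuotient.on PGL.
HB.instance Definition _ := Choice.on PGL.

Definition PGLmul := lift_op2 PGL GLmul.
Lemma pi_PGLmul : {morph \pi_PGL : A B / GLmul A B >-> PGLmul A B}.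
Proof.
move=> A B; unlock PGLmul; apply/eqmodP/asboolP.
have /eqmodP/asboolP[c c0 ec] : A = repr (\pi_PGL A) %[mod PGL] by rewrite reprK.
have /eqmodP/asboolP[d d0 ed] : B = repr (\pi_PGL B) %[mod PGL] by rewrite reprK.
exists (c * d); first by rewrite mulf_neq0.
by rewrite /= {1}ec {1}ed -scalemxAl -scalemxAr scalerA.
Qed.
Canonical pi_PGLmul_morph := PiMorph2 pi_PGLmul.

Definition PGLinv := lift_op1 PGL GLinv.
Lemma pi_PGLinv : {morph \pi_PGL : A / GLinv A >-> PGLinv A}.
Proof.
move=> A; unlock PGLinv; apply/eqmodP/asboolP.
have /eqmodP/asboolP[c c0 ec] : A = repr (\pi_PGL A) %[mod PGL] by rewrite reprK.
exists c^-1; rewrite ?invr_eq0 //= {1}ec invmxZ //.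
by rewrite -ec (valP A).
Qed.
Canonical pi_PGLinv_morph := PiMorph1 pi_PGLinv.

Lemma PGLmulA : associative PGLmul.
Proof.
elim/quotW=> A; elim/quotW=> B; elim/quotW=> C; rewrite !piE.
by congr (\pi _); apply: val_inj; rewrite /= mulmxA.
Qed.

Lemma PGLmul1 : left_id (\pi_PGL GLone) PGLmul.
Proof.
elim/quotW=> A; rewrite !piE; congr (\pi _); apply: val_inj.
by rewrite /= mul1mx.
Qed.

Lemma PGL1mul : right_id (\pi_PGL GLone) PGLmul.
Proof.
elim/quotW=> A; rewrite !piE; congr (\pi _); apply: val_inj.
by rewrite /= mulmx1.
Qed.

Lemma PGLmulV : left_inverse (\pi_PGL GLone) PGLinv PGLmul.
Proof.
elim/quotW=> A; rewrite !piE; congr (\pi _); apply: val_inj.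
by rewrite /= mulVmx // (valP A).
Qed.

Lemma PGLVmul : right_inverse (\pi_PGL GLone) PGLinv PGLmul.
Proof.
elim/quotW=> A; rewrite !piE; congr (\pi _); apply: val_inj.
by rewrite /= mulmxV // (valP A).
Qed.

HB.instance Definition _ :=
  isGroup.Build PGL PGLmulA PGLmul1 PGL1mul PGLmulV PGLVmul.

End PGL.

Arguments GLone {n K}.

(* P: the coweight λ is recorded by the pair (<λ, α_1>, <λ, α_2>), its
   coordinates on the fundamental coweights.  As a cocharacter of the diagonal
   torus of PGL_3 it is the class of coweight_lift λ in Z^3 / Z(1,1,1). *)
Definition coweight := (int * int)%type.

Definition alpha1 : coweight := (2, -1).
Definition alpha2 : coweight := (-1, 2).
Definition omega1 : coweight := (1, 0).

Definition coweight_lift (l : coweight) (i : 'I_3) : int :=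
  nth 0 [:: l.1 + l.2; l.2; 0] i.

Definition coweight_of (x : 'I_3 -> int) : coweight := (x 0 - x 1, x 1 - x 2).

(* The product of permutations in MathComp satisfies (s * t) i = t (s i), so
   this is a left action and perm_mx w *m diag x *m perm_mx w^-1 is diag (w x). *)
Definition coweight_act (w : 'S_3) (l : coweight) : coweight :=
  coweight_of (fun i => coweight_lift l (w i)).

Record iwahori_weyl := IwahoriWeyl { trans : coweight; lin : 'S_3 }.

HB.instance Definition _ := gen_eqMixin iwahori_weyl.
HB.instance Definition _ := gen_choiceMixin iwahori_weyl.

Lemma ord3P (P : 'I_3 -> Prop) : P 0 -> P 1 -> P 2 -> forall i, P i.
Proof.
move=> h0 h1 h2 [[|[|[|//]]] hi].
- by have -> : Ordinal hi = 0 by apply: val_inj.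
- by have -> : Ordinal hi = 1 by apply: val_inj.
by have -> : Ordinal hi = 2 by apply: val_inj.
Qed.

Lemma coweight_ofK l : coweight_of (coweight_lift l) = l.
Proof. by case: l => a b; rewrite /coweight_of /coweight_lift /= subr0 addrK. Qed.

Lemma coweight_lift_of x i : coweight_lift (coweight_of x) i = x i - x 2.
Proof.
by move: i; apply: ord3P; rewrite /coweight_lift /coweight_of /= ?subrr ?subrKA.
Qed.

Lemma coweight_act1 l : coweight_act 1 l = l.
Proof.
rewrite /coweight_act -[RHS]coweight_ofK; congr coweight_of.
by apply/funext => i; rewrite perm1.
Qed.

Lemma coweight_actM s t l :
  coweight_act (s * t)%g l = coweight_act s (coweight_act t l).
Proof.
rewrite /coweight_act.
under [in RHS]eq_fun do rewrite coweight_lift_of.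
rewrite /coweight_of !permM.
by congr (_, _); rewrite opprB addrA subrK.
Qed.

Lemma coweight_liftD l m i :
  coweight_lift (l + m) i = coweight_lift l i + coweight_lift m i.
Proof.
by move: i; apply: ord3P; rewrite /coweight_lift //= addrACA.
Qed.

Lemma coweight_actD w l m :
  coweight_act w (l + m) = coweight_act w l + coweight_act w m.
Proof.
rewrite /coweight_act /coweight_of !coweight_liftD.
by congr (_, _); rewrite opprD addrACA.
Qed.

Lemma coweight_act0 w : coweight_act w 0 = 0.
Proof. by apply: (addrI (coweight_act w 0)); rewrite -coweight_actD !addr0. Qed.

Definition iwmul (x y : iwahori_weyl) : iwahori_weyl :=
  IwahoriWeyl (trans x + coweight_act (lin x) (trans y)) (lin x * lin y)%g.
Definition iwone : iwahori_weyl := IwahoriWeyl 0 1.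
Definition iwinv (x : iwahori_weyl) : iwahori_weyl :=
  IwahoriWeyl (- coweight_act (lin x)^-1 (trans x)) (lin x)^-1.

Lemma iwmulA : associative iwmul.
Proof.
move=> [l s] [m t] [n u]; rewrite /iwmul /=.
by rewrite coweight_actD coweight_actM addrA mulgA.
Qed.
Lemma iwmul1 : left_id iwone iwmul.
Proof. by case=> l s; rewrite /iwmul /= coweight_act1 add0r mul1g. Qed.
Lemma iw1mul : right_id iwone iwmul.
Proof. by case=> l s; rewrite /iwmul /= coweight_act0 addr0 mulg1. Qed.
Lemma iwmulV : left_inverse iwone iwinv iwmul.
Proof. by case=> l s; rewrite /iwmul /= addNr mulVg. Qed.
Lemma iwVmul : right_inverse iwone iwinv iwmul.
Proof.
case=> l s; rewrite /iwmul /= mulgV.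
have -> : - coweight_act s^-1 l = coweight_act s^-1 (- l).
  apply: (addrI (coweight_act s^-1 l)).
  by rewrite -coweight_actD !subrr coweight_act0.
by rewrite -coweight_actM mulgV coweight_act1 subrr.
Qed.

HB.instance Definition _ :=
  isGroup.Build iwahori_weyl iwmulA iwmul1 iw1mul iwmulV iwVmul.

Definition translation (l : coweight) : iwahori_weyl := IwahoriWeyl l 1.
Definition finite_weyl (w : 'S_3) : iwahori_weyl := IwahoriWeyl 0 w.

Definition s1 : iwahori_weyl := finite_weyl (tperm 0 1).
Definition s2 : iwahori_weyl := finite_weyl (tperm 1 2).
Definition s0 : iwahori_weyl :=
  (translation (alpha1 + alpha2) * s1 * s2 * s1)%g.

Definition tau : iwahori_weyl := (translation omega1 * s1 * s2)%g.

Definition simple_reflection (i : 'I_3) : iwahori_weyl :=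
  nth 1%g [:: s0; s1; s2] i.

(* δ(t^λ) = t^(δ λ) where δ exchanges α_1 and α_2; on S_3 it is conjugation by
   s1 s2 s1. *)
Definition delta (x : iwahori_weyl) : iwahori_weyl :=
  IwahoriWeyl ((trans x).2, (trans x).1)
    (lin (s1 * s2 * s1)%g * lin x * lin (s1 * s2 * s1)%g)%g.

Lemma iwP (x y : iwahori_weyl) :
  trans x = trans y -> (forall i, lin x i = lin y i) -> x = y.
Proof. by case: x y => [l s] [m t] /= -> /permP ->. Qed.

Lemma tperm01E :
  (tperm 0 1 (0 : 'I_3) = 1) * (tperm 0 1 (1 : 'I_3) = 0) * (tperm 0 1 (2 : 'I_3) = 2).
Proof. by rewrite tpermL tpermR tpermD. Qed.

Lemma tperm12E :
  (tperm 1 2 (0 : 'I_3) = 0) * (tperm 1 2 (1 : 'I_3) = 2) * (tperm 1 2 (2 : 'I_3) = 1).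
Proof. by rewrite tpermL tpermR tpermD. Qed.

Definition permIW := (permM, perm1, tperm01E, tperm12E).

Ltac iw_compute :=
  apply: iwP; rewrite /=;
  [ rewrite /coweight_act /coweight_of /coweight_lift ?permIW /=
  | apply: ord3P; rewrite ?permIW ].

Lemma coweightMz (l : coweight) (n : int) : l *~ n = (l.1 * n, l.2 * n).
Proof.
rewrite [LHS]surjective_pairing (raddfMz fst) (raddfMz snd).
by rewrite -[l.1 *~ n]mulrzr -[l.2 *~ n]mulrzr !intz.
Qed.

Lemma s1_translation l : (s1 * translation l = translation (l - alpha1 *~ l.1) * s1)%g.
Proof.
rewrite coweightMz; case: l => a b; iw_compute => //.
by congr (_, _) => /=; lia.
Qed.

Lemma s2_translation l : (s2 * translation l = translation (l - alpha2 *~ l.2) * s2)%g.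
Proof.
rewrite coweightMz; case: l => a b; iw_compute => //.
by congr (_, _) => /=; lia.
Qed.

Lemma translationD l m : translation (l + m) = (translation l * translation m)%g.
Proof. by apply: iwP => [|i] /=; rewrite ?coweight_act1 ?mulg1. Qed.

Lemma finite_weylM v w : finite_weyl (v * w) = (finite_weyl v * finite_weyl w)%g.
Proof. by apply: iwP => [|i] /=; rewrite ?coweight_act0 ?addr0. Qed.

Lemma iwahori_weylE x : x = (translation (trans x) * finite_weyl (lin x))%g.
Proof. by apply: iwP => [|i] /=; rewrite ?coweight_act0 ?addr0 ?mul1g. Qed.

Lemma s1K : (s1 * s1 = 1)%g. Proof. by iw_compute. Qed.
Lemma s2K : (s2 * s2 = 1)%g. Proof. by iw_compute. Qed.

Lemma tau_s0 : (tau * s0 * tau^-1 = s1)%g.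
Proof. by apply/(canLR (mulgK _)); iw_compute. Qed.
Lemma tau_s1 : (tau * s1 * tau^-1 = s2)%g.
Proof. by apply/(canLR (mulgK _)); iw_compute. Qed.
Lemma tau_s2 : (tau * s2 * tau^-1 = s0)%g.
Proof. by apply/(canLR (mulgK _)); iw_compute. Qed.
Lemma tau3 : (tau ^+ 3 = 1)%g.
Proof.
have tau2 : (tau * tau = IwahoriWeyl (0, 1)%R (tperm 1%R 2%R * tperm 0%R 1%R))%g.
  by iw_compute.
by rewrite !expgS expg0 mulg1 tau2; iw_compute.
Qed.

Lemma delta_s0 : delta s0 = s0. Proof. by iw_compute. Qed.
Lemma delta_s1 : delta s1 = s2. Proof. by iw_compute. Qed.
Lemma delta_s2 : delta s2 = s1. Proof. by iw_compute. Qed.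
Lemma delta_tau : delta tau = (tau^-1)%g.
Proof. by apply: (mulgI tau); rewrite mulgV; iw_compute. Qed.

Lemma lin_w0E i : lin (s1 * s2 * s1)%g i = rev_ord i.
Proof. by move: i; apply: ord3P; rewrite /= ?permIW; apply: val_inj. Qed.

Lemma lin_w0K : (lin (s1 * s2 * s1) * lin (s1 * s2 * s1) = 1)%g.
Proof. by apply/permP => i; rewrite permM !lin_w0E rev_ordK perm1. Qed.

Lemma coweight_lift_swap l i :
  coweight_lift (l.2, l.1) i = l.1 + l.2 - coweight_lift l (rev_ord i).
Proof. by move: i; apply: ord3P; rewrite /coweight_lift /=; lia. Qed.

Lemma deltaM x y : delta (x * y)%g = (delta x * delta y)%g.
Proof.
case: x y => [l v] [m w]; rewrite /delta.
move: (lin (s1 * s2 * s1)%g) lin_w0E => w0 w0E.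
congr IwahoriWeyl; last first.
  by apply/permP => i; rewrite /= !permM !w0E rev_ordK.
rewrite /= /coweight_act /coweight_of !coweight_lift_swap !permM !w0E.
rewrite !rev_ordK.
have -> : rev_ord 0 = 2 :> 'I_3 by apply: val_inj.
have -> : rev_ord 1 = 1 :> 'I_3 by apply: val_inj.
have -> : rev_ord 2 = 0 :> 'I_3 by apply: val_inj.
rewrite [RHS]surjective_pairing /=.
by congr (_, _); lia.
Qed.

(* x = s_(i_1) ... s_(i_n) tau^j for some simple reflections s_(i_1), ... *)
Definition has_expression (x : iwahori_weyl) (n : nat) : Prop :=
  exists (r : seq 'I_3) (j : nat), size r = n /\
    x = ((\prod_(i <- r) simple_reflection i) * tau ^+ j)%g.

Section ExpressionExists.
Let E x := exists n, has_expression x n.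

Let E1 : E 1%g.
Proof. by exists 0%N, [::], 0%N; rewrite big_nil expg0 mulg1. Qed.

Let Es i x : E x -> E (simple_reflection i * x)%g.
Proof.
move=> [n [r [j [sr ->]]]]; exists n.+1, (i :: r), j.
by rewrite /= sr big_cons mulgA.
Qed.

Let tau_s i : (tau * simple_reflection i = simple_reflection (i + 1)%R * tau)%g.
Proof.
move: i; apply: ord3P; rewrite /simple_reflection /=.
- by rewrite -tau_s0 mulgVK.
- by rewrite -tau_s1 mulgVK.
by rewrite -tau_s2 mulgVK.
Qed.

Let Etau x : E x -> E (tau * x)%g.
Proof.
move=> [n [r [j [sr ->]]]]; exists n, [seq i + 1 | i <- r], j.+1.
split; first by rewrite size_map.
rewrite big_map expgS mulgA [RHS]mulgA; congr (_ * _)%g.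
elim: r {sr} => [|i r IH]; first by rewrite !big_nil mulg1 mul1g.
by rewrite !big_cons mulgA tau_s -mulgA IH mulgA.
Qed.

Let Es0 x : E x -> E (s0 * x)%g. Proof. exact: (Es 0). Qed.
Let Es1 x : E x -> E (s1 * x)%g. Proof. exact: (Es 1). Qed.
Let Es2 x : E x -> E (s2 * x)%g. Proof. exact: (Es 2). Qed.

Let EM a b : (forall x, E x -> E (a * x)%g) -> (forall x, E x -> E (b * x)%g) ->
  forall x, E x -> E (a * b * x)%g.
Proof. by move=> Ea Eb x Ex; rewrite -mulgA; apply/Ea/Eb. Qed.

Let Eomega1 x : E x -> E (translation omega1 * x)%g.
Proof.
have -> : translation omega1 = (tau * s2 * s1)%g.
  by rewrite /tau -!mulgA (mulgA s2) s2K mul1g s1K mulg1.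
by apply: EM Es1 x; apply: EM Etau Es2.
Qed.

Let EomegaN1 x : E x -> E (translation (- omega1) * x)%g.
Proof.
have -> : translation (- omega1) = (s1 * s2 * (tau * tau))%g.
  apply: (mulIg tau); rewrite -mulgA.
  have -> : (tau * tau * tau = 1)%g by have := tau3; rewrite !expgS expg0 mulg1 mulgA.
  rewrite mulg1 /tau 2!mulgA -translationD addNr.
  by rewrite (mul1g s1).
by apply: EM x; [apply: EM Es1 Es2|apply: EM Etau Etau].
Qed.

Let Etrans (m : coweight) : (forall x, E x -> E (translation m * x)%g) ->
  (forall x, E x -> E (translation (- m) * x)%g) ->
  forall (n : int) x, E x -> E (translation (m *~ n) * x)%g.
Proof.
move=> Em ENm [n|n] x Ex; rewrite ?NegzE ?mulrNz -?mulNrz -pmulrn.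
  elim: n => [|n IH]; first by rewrite mulr0n mul1g.
  by rewrite mulrS translationD -mulgA; apply: Em.
elim: n.+1 => [|p IH]; first by rewrite mulr0n mul1g.
by rewrite mulrS translationD -mulgA; apply: ENm.
Qed.

Let Etranslation l x : E x -> E (translation l * x)%g.
Proof.
move=> Ex.
pose eta : coweight := omega1 - alpha1.
have eE (m : coweight) : m.1 = 1 ->
    translation (m - alpha1) = (s1 * translation m * s1)%g.
  by move=> m1; rewrite s1_translation m1 -mulgA s1K mulg1.
have eN (m : coweight) : m.1 = -1 ->
    translation (m + alpha1) = (s1 * translation m * s1)%g.
  by move=> m1; rewrite s1_translation m1 -mulgA s1K mulg1 mulrNz opprK.
have -> : l = omega1 *~ (l.1 + l.2) + eta *~ l.2.
  rewrite !coweightMz; case: l => a b; rewrite [RHS]surjective_pairing /=.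
  by congr (_, _); lia.
rewrite translationD -mulgA; apply: Etrans => //.
apply: Etrans => // y Ey.
  by rewrite eE //; apply: EM Es1 y Ey; apply: EM Es1 Eomega1.
have -> : - eta = - omega1 + alpha1 by rewrite /eta opprB addrC.
by rewrite eN //; apply: EM Es1 y Ey; apply: EM Es1 EomegaN1.
Qed.

Let Etperm i j x : E x -> E (finite_weyl (tperm i j) * x)%g.
Proof.
have T : finite_weyl (tperm 0 2) = (s1 * s2 * s1)%g.
  apply: iwP => [|i'] /=; first by rewrite !coweight_act0 !addr0.
  by move: i'; apply: ord3P; rewrite ?permIW ?tpermL ?tpermR ?tpermD.
have T0 k : finite_weyl (tperm k k) = 1%g by rewrite tperm1.
move=> Ex; move: i; apply: ord3P; move: j; apply: ord3P; rewrite ?T0 ?mul1g //.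
- exact: Es1.
- by rewrite T; apply: EM Es1 x Ex; apply: EM Es1 Es2.
- by rewrite tpermC; apply: Es1.
- exact: Es2.
- by rewrite tpermC T; apply: EM Es1 x Ex; apply: EM Es1 Es2.
- by rewrite tpermC; apply: Es2.
Qed.

Lemma has_expression_exists x : exists n, `[< has_expression x n >].
Proof.
suff [n xn] : E x by exists n; apply/asboolP.
rewrite (iwahori_weylE x); apply: Etranslation; rewrite -[finite_weyl _]mulg1.
have [ts -> _] := prod_tpermP (lin x).
elim: ts => [|t ts IH]; first by rewrite big_nil mul1g.
by rewrite big_cons finite_weylM -mulgA; apply: Etperm.
Qed.

End ExpressionExists.

(* Writing x = w tau^j with w in W_a = <s0, s1, s2>, this is the least length of
   a word for w, since j is determined modulo 3 by x. *)
Definition ell (x : iwahori_weyl) : nat := ex_minn (has_expression_exists x).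

Definition min_length (C : set iwahori_weyl) : set iwahori_weyl :=
  [set x | C x /\ forall y, C y -> (ell x <= ell y)%N].

Definition hat (X : set iwahori_weyl) : set iwahori_weyl :=
  X `|` [set (tau * x * tau^-1 * tau ^+ 2)%g | x in X]
    `|` [set (tau ^+ 2 * x * tau ^- 2 * tau)%g | x in X].

Definition Xset (m : nat) : set iwahori_weyl :=
  let e : int := odd m in
  let lo : int := m./2 in
  let up : int := m.+1./2 in
  let t (a b : int) := translation (alpha1 *~ a + alpha2 *~ b) in
  [set x | exists k : int,
       x = (t (k - lo) (2 * k + e) * s2 * s1)%g
    \/ x = (t (k + up) (2 * k + e) * s2 * s1)%g
    \/ x = (t (2 * k + e) (k + up) * s1 * s2)%g
    \/ x = (t (2 * k + e) (k - lo) * s1 * s2)%g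
    \/ x = t k (m%:Z - k)
    \/ x = t (k - m%:Z) (- k)].

(* The class O_{2m,δ}. *)
Definition Odelta (m : nat) : set iwahori_weyl := hat (Xset m).

Definition antidiag (K : fieldType) : 'M[K]_3 :=
  \matrix_(i, j) (j == rev_ord i)%:R.

Lemma antidiagK (K : fieldType) : antidiag K *m antidiag K = 1%:M.
Proof.
apply/matrixP => i j; rewrite !mxE (bigD1 (rev_ord i)) //= !mxE eqxx mul1r.
rewrite rev_ordK big1 ?addr0 1?eq_sym // => l /negbTE nl.
by rewrite !mxE nl mul0r.
Qed.

Lemma antidiag_unit (K : fieldType) : antidiag K \in unitmx.
Proof. by have [] := mulmx1_unit (antidiagK K). Qed.

Lemma antidiag_conjE (K : fieldType) (M : 'M[K]_3) i j :
  (antidiag K *m M *m antidiag K) i j = M (rev_ord i) (rev_ord j).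
Proof.
rewrite !mxE (bigD1 (rev_ord j)) //= !mxE rev_ordK eqxx mulr1.
rewrite [X in _ + X]big1 ?addr0 => [|l lj]; last first.
  rewrite !mxE (_ : (j == _) = false) ?mulr0 //.
  by apply/negbTE; apply: contra lj => /eqP ->; rewrite rev_ordK.
rewrite (bigD1 (rev_ord i)) //= !mxE eqxx mul1r.
by rewrite big1 ?addr0 // => l /negbTE li; rewrite !mxE li mul0r.
Qed.

Lemma invmx_uniq (K : fieldType) n (A B : 'M[K]_n) :
  A *m B = 1%:M -> invmx A = B.
Proof.
by move=> AB; have [Au _] := mulmx1_unit AB; rewrite -[RHS](mulKmx Au) AB mulmx1.
Qed.

(* Over L the adjoint group of U_3 is PGL_3, with Frobenius
   A |-> J * theta(A)^-T * J, where theta is the Frobenius of L and the Gram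
   matrix J of the hermitian form is antidiag. *)
Section UnitaryFrobenius.
Variables (K : fieldType) (theta : {rmorphism K -> K}).

Lemma unitary_GL_subproof (A : GL 3 K) :
  antidiag K *m (map_mx theta (invmx (val A)))^T *m antidiag K \in unitmx.
Proof.
by rewrite !unitmx_mul antidiag_unit unitmx_tr map_unitmx unitmx_inv (valP A).
Qed.

Definition unitary_GL (A : GL 3 K) : GL 3 K := 
  Sub (antidiag K *m (map_mx theta (invmx (val A)))^T *m antidiag K)
    (unitary_GL_subproof A).

Definition unitary := lift_op1 (PGL 3 K) unitary_GL.

Lemma pi_unitary : {morph \pi_(PGL 3 K) : A / unitary_GL A >-> unitary A}.
Proof.
move=> A; unlock unitary; apply/eqmodP/asboolP.
have /eqmodP/asboolP[c c0 ec] : A = repr (\pi_(PGL 3 K) A) %[mod PGL 3 K].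
  by rewrite reprK.
exists (theta c^-1); first by rewrite fmorph_eq0 invr_eq0.
rewrite /= {1}ec invmxZ; last by rewrite -ec (valP A).
by rewrite map_mxZ linearZ /= -scalemxAr -scalemxAl.
Qed.
Canonical pi_unitary_morph := PiMorph1 pi_unitary.

Lemma unitaryM (x y : PGL 3 K) : unitary (x * y)%g = (unitary x * unitary y)%g.
Proof.
elim/quotW: x => A; elim/quotW: y => B.
rewrite -[(_ * _)%g]/(PGLmul (\pi_(PGL 3 K) A) (\pi_(PGL 3 K) B)) -pi_PGLmul -!pi_unitary.
rewrite -[RHS]/(PGLmul _ _) -pi_PGLmul; congr (\pi _); apply: val_inj => /=.
rewrite (@invmx_uniq _ _ _ (invmx (val B) *m invmx (val A))); last first.
  by rewrite mulmxA mulmxK ?(valP B) // mulmxV // (valP A).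
rewrite map_mxM trmx_mul !mulmxA; congr (_ *m _ *m _).
by rewrite -[RHS]mulmxA antidiagK mulmx1.
Qed.

End UnitaryFrobenius.

Definition frobenius (Fq : finFieldType) (k : fieldType)
  (iota : {rmorphism Fq -> k}) (x : k) : k := x ^+ #|Fq|.

Section Frobenius.
Variables (Fq : finFieldType) (k : fieldType) (iota : {rmorphism Fq -> k}).

Lemma frobenius_pchar_subproof : [pchar k].-nat #|Fq|.
Proof.
have [p pr_p pFq] := finPcharP Fq.
rewrite (eq_pnat _ (pcharf_eq (rmorph_pchar iota pFq))) -cardsT.
exact/abelem_pgroup/fin_ring_pchar_abelem.
Qed.

Lemma frobenius_is_zmod_morphism : zmod_morphism (frobenius iota).
Proof.
move=> x y; apply: (addIr (frobenius iota y)).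
by rewrite subrK -[LHS]exprDn_pchar ?subrK // frobenius_pchar_subproof.
Qed.

Lemma frobenius_is_monoid_morphism : monoid_morphism (frobenius iota).
Proof. by split=> [|x y]; rewrite /frobenius ?expr1n ?exprMn. Qed.

HB.instance Definition _ := GRing.isZmodMorphism.Build _ _ (frobenius iota)
  frobenius_is_zmod_morphism.
HB.instance Definition _ := GRing.isMonoidMorphism.Build _ _ (frobenius iota)
  frobenius_is_monoid_morphism.

End Frobenius.

Definition U3 (k : fieldType) := PGL 3 (laurent k).
HB.instance Definition _ (k : fieldType) := Group.on (U3 k).

Section ADLV.
Variables (Fq : finFieldType) (k : fieldType) (iota : {rmorphism Fq -> k}).

Definition sigma : U3 k -> U3 k := unitary (laurent_map (frobenius iota)).

Lemma iw_GL_subproof (x : iwahori_weyl) :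
  diag_mx (\row_i (eps k) ^ coweight_lift (trans x) i) *m perm_mx (lin x)
    \in unitmx.
Proof.
rewrite unitmx_mul unitmx_perm andbT unitmxE det_diag unitfE.
apply/prodf_neq0 => i _; rewrite mxE expfz_neq0 //.
apply/eqP => /(congr1 (fun f : laurent k => f 1)) /= /eqP.
by rewrite oner_eq0.
Qed.

(* t^λ w is lifted to ε^λ times the permutation matrix of w. *)
Definition iw_GL (x : iwahori_weyl) : GL 3 (laurent k) :=
  Sub (diag_mx (\row_i (eps k) ^ coweight_lift (trans x) i) *m perm_mx (lin x))
    (iw_GL_subproof x).

Definition iw_lift (x : iwahori_weyl) : U3 k :=
  \pi_(PGL 3 (laurent k)) (iw_GL x).

Lemma sigma_iw_lift x : sigma (iw_lift x) = iw_lift (delta x).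
Proof.
rewrite /sigma /iw_lift -pi_unitary; apply/eqmodP/asboolP.
have e0 : eps k != 0.
  apply/eqP => /(congr1 (fun f : laurent k => f 1)) /= /eqP.
  by rewrite oner_eq0.
exists (eps k ^ (- ((trans x).1 + (trans x).2))); first exact: expfz_neq0.
have td : trans (delta x) = ((trans x).2, (trans x).1) by [].
have ld i : lin (delta x) i = rev_ord (lin x (rev_ord i)).
  by rewrite [LHS]permM lin_w0E permM lin_w0E.
move: (delta x) td ld => y td ld; rewrite /=.
rewrite (@invmx_uniq _ _ _ (perm_mx (lin x)^-1%g *m
  diag_mx (\row_i eps k ^ (- coweight_lift (trans x) i)))); last first.
  rewrite mulmxA -(mulmxA (diag_mx _)) -perm_mxM mulgV perm_mx1 mulmx1.
  rewrite mulmx_diag -diag_const_mx; congr diag_mx; apply/rowP => i.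
  by rewrite !mxE -expfzDr // subrr expr0z.
rewrite map_mxM trmx_mul map_perm_mx tr_perm_mx invgK map_diag_mx tr_diag_mx.
apply/matrixP => i j; rewrite antidiag_conjE mul_diag_mx [RHS]mxE mul_diag_mx.
rewrite !mxE ld td mulrA coweight_lift_swap -expfzDr // fmorphXz.
set z := (X in X ^ _ * _ = _); have -> : z = eps k.
  by apply: laurentP => n /=; rewrite rmorph_nat.
by rewrite addrA addNr add0r (can2_eq (@rev_ordK 3) (@rev_ordK 3)).
Qed.

(* Matrices over k[[ε]], with inverse over k[[ε]], that are lower triangular
   modulo ε.  With t^λ lifted to ε^λ, it is for this Iwahori subgroup (rather
   than the upper triangular one) that I s_0 I ∪ I is a group. *)
Definition iwahori_GL : set (GL 3 (laurent k)) :=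
  [set A | let M : 'M[laurent k]_3 := val A in
    [/\ forall i j, lintegral (M i j), forall i j, lintegral (invmx M i j)
      & forall i j : 'I_3, (i < j)%N -> lmaximal (M i j)]].

Definition iwahori : set (U3 k) := [set \pi_(PGL 3 (laurent k)) A | A in iwahori_GL].

Definition iwahori_coset (g : U3 k) : set (U3 k) := [set (g * i)%g | i in iwahori].

Definition double_coset (w : iwahori_weyl) : set (U3 k) :=
  [set x | exists i j, [/\ iwahori i, iwahori j & x = (i * iw_lift w * j)%g]].

Definition ADLV (w : iwahori_weyl) (b : U3 k) : set (set (U3 k)) :=
  [set iwahori_coset g | g in [set g | double_coset w (g^-1 * b * sigma g)%g]].

(* b σ(b) ... σ^(n-1)(b), so that (bσ)^n = sigma_norm n b σ^n *)
Definition sigma_norm (n : nat) (b : U3 k) : U3 k :=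
  (\prod_(i < n) iter i sigma b)%g.

(* Kottwitz's definition: (bσ)^n is conjugate to ε^(nν) σ^n, for some n > 0 such
   that nν is a cocharacter defined over the fixed field of σ^n; ν is normalised
   to be dominant.  Like a coweight, ν is given by (<ν, α_1>, <ν, α_2>), so it is
   central when both components vanish. *)
Definition newton_vector (b : U3 k) (nu : rat * rat) : Prop :=
  [/\ 0 <= nu.1, 0 <= nu.2 &
  exists n (l : coweight) (g : U3 k),
    [/\ (0 < n)%N, l.1%:~R = n%:R * nu.1, l.2%:~R = n%:R * nu.2,
       iter n sigma (iw_lift (translation l)) = iw_lift (translation l)
     & (g^-1 * sigma_norm n b * iter n sigma g)%g = iw_lift (translation l)]].

Definition basic (b : U3 k) : Prop :=
  exists2 nu, newton_vector b nu & nu.1 = 0 /\ nu.2 = 0.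

End ADLV.

(* Main.v *)
(* A basic b is sigma-conjugate to 1.  Since its Newton vector vanishes, after a
   sigma-conjugation the norm of b over some even power of sigma is trivial in
   PGL_3; Lang's theorem for units of L makes it trivial in GL_3, and Hilbert 90
   for sigma^2 = Frobenius_{q^2} then gives a representative B with
   B sigma(B) = 1, i.e. a hermitian form over F_{q^2}((ε)) / F_q((ε)).  Norms of
   units being surjective, two of three orthogonal values have valuations of the
   same parity, so the form is isotropic, hence a multiple of the standard one.

   It remains to see which double cosets I w I contain some g^-1 sigma(g).
   Exchange relations between double cosets let one pass from w to s w δ(s) when
   the length is preserved, and from w or w δ(s) to s w δ(s) when that is longer
   by two.  In W_a an element of odd length can be shortened until it is one of
   s_0, s_1, s_2, s_1 s_2 s_1, for which explicit g exist.  An element w of even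
   length is 1, or is minimal in some O_{2m,δ}, or is longer by two than some
   s w δ(s); in the last case s w has odd length, so w is reached from it.
   Conversely, if w is minimal in O_{2m,δ} then w δ(w) is conjugate to a
   translation t^mu with l(t^(n mu)) = 2 n l(w).  If I w I contained
   g^-1 sigma(g), then I t^(n mu) I would contain a conjugate of
   g^-1 sigma^(2n)(g), whose displacement is bounded independently of n. *)

Require Import Defs.
From HB Require Import structures.
From mathcomp Require Import all_boot all_order all_algebra all_fingroup all_field.
From mathcomp Require Import boolp classical_sets functions cardinality fsbigop.
From mathcomp Require Import zify generic_quotient.

Set Implicit Arguments.
Unset Strict Implicit.
Unset Printing Implicit Defensive.

Import Order.TTheory GRing.Theory Num.Theory.

Local Open Scope classical_set_scope.
Local Open Scope quotient_scope.
Local Open Scope ring_scope.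

(** * Lengths in the Iwahori-Weyl group *)


(** As [delta] acts on coweights with determinant -1, the parity of the linear part of x decides the
    shape of xδ. If it is odd, xδ is a rotation of the plane, of order 2 or 6; it fixes a point,
    which is why shortening ends in finitely many elements. If it is even, xδ is a reflection or
    glide reflection, and its translation part c is what the classes record: the six families in
    [Xset m] together say that x lies in W_a and |c| = m, and 2|c| bounds the length from below. On
    the group side the recurring obstacle is the scalar that PGL_3 forgets. Membership in the
    Iwahori subgroup and boundedness are tested on products in which the scalar cancels or is
    visibly integral; for the cocycle it must first be shown to be a unit, by comparing
    determinants. Most of the field theory reduces to one fact about k: y^n + a y = c is solvable
    for n > 1. Equations in Laurent series are solved one coefficient at a time, and nothing divides
    by 2, so characteristic 2 needs no separate treatment. *)

Variant perm3_spec : 'I_3 -> 'I_3 -> 'I_3 -> Prop :=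
| Perm3_012 : perm3_spec 0 1 2
| Perm3_021 : perm3_spec 0 2 1
| Perm3_102 : perm3_spec 1 0 2
| Perm3_120 : perm3_spec 1 2 0
| Perm3_201 : perm3_spec 2 0 1
| Perm3_210 : perm3_spec 2 1 0.

Lemma perm3P (v : 'S_3) : perm3_spec (v 0) (v 1) (v 2).
Proof.
have : [&& v 0 != v 1, v 0 != v 2 & v 1 != v 2] by rewrite !(inj_eq perm_inj).
move: (v 0) (v 1) (v 2).
by do 3![apply: ord3P => //]; constructor.
Qed.

(* The Iwahori-Matsumoto formula: one summand for each parallel class of walls. *)
Definition len (x : iwahori_weyl) : nat :=
  let a := (trans x).1 in let b := (trans x).2 in let v := lin x in
  (`|(a - (v 1%R < v 0%R)%N%:Z)%R| + `|(b - (v 2%R < v 1%R)%N%:Z)%R|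
   + `|(a + b - (v 2%R < v 0%R)%N%:Z)%R|)%N.

Lemma trans_s1M x : trans (s1 * x)%g = (- (trans x).1, (trans x).1 + (trans x).2).
Proof.
by rewrite /= /coweight_act /coweight_of /coweight_lift !permIW /= add0r;
  congr (_, _); lia.
Qed.

Lemma trans_s2M x : trans (s2 * x)%g = ((trans x).1 + (trans x).2, - (trans x).2).
Proof.
by rewrite /= /coweight_act /coweight_of /coweight_lift !permIW /= add0r;
  congr (_, _); lia.
Qed.

Lemma s0E : s0 = IwahoriWeyl (1, 1) (tperm 0 2).
Proof.
apply: iwP; first by rewrite /= /coweight_act /coweight_of /coweight_lift !permIW.
by apply: ord3P; rewrite /= ?permIW ?tpermL ?tpermR ?tpermD.
Qed.

Lemma tperm02E :
  (tperm 0 2 (0 : 'I_3) = 2) * (tperm 0 2 (1 : 'I_3) = 1) * (tperm 0 2 (2 : 'I_3) = 0).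
Proof. by rewrite tpermL tpermR tpermD. Qed.

Definition permE3 := (permIW, tperm02E).

Lemma trans_s0M x : trans (s0 * x)%g = (1 - (trans x).2, 1 - (trans x).1).
Proof.
rewrite s0E /= /coweight_act /coweight_of /coweight_lift !permE3 /=.
by congr (_, _) => /=; lia.
Qed.

Lemma tauE : tau = IwahoriWeyl (1, 0) (tperm 0 1 * tperm 1 2).
Proof.
apply: iwP; first by rewrite /= /coweight_act /coweight_of /coweight_lift !permIW.
by apply: ord3P; rewrite /= ?permIW.
Qed.

Lemma trans_tauM x : trans (tau * x)%g = (1 - (trans x).1 - (trans x).2, (trans x).1).
Proof.
rewrite tauE /= /coweight_act /coweight_of /coweight_lift !permE3 /=.
by congr (_, _) => /=; lia.
Qed.

Lemma lin_s0M x i : lin (s0 * x)%g i = lin x (tperm 0 2 i).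
Proof. by rewrite s0E /= permM. Qed.
Lemma lin_s1M x i : lin (s1 * x)%g i = lin x (tperm 0 1 i).
Proof. by rewrite /= permM. Qed.
Lemma lin_s2M x i : lin (s2 * x)%g i = lin x (tperm 1 2 i).
Proof. by rewrite /= permM. Qed.
Lemma lin_tauM x i : lin (tau * x)%g i = lin x (tperm 1 2 (tperm 0 1 i)).
Proof. by rewrite tauE /= !permM. Qed.

Lemma trans_Ms1 x : trans (x * s1)%g = trans x.
Proof. by rewrite /= coweight_act0 addr0. Qed.
Lemma trans_Ms2 x : trans (x * s2)%g = trans x.
Proof. by rewrite /= coweight_act0 addr0. Qed.
Lemma trans_Ms0 x : trans (x * s0)%g =
  ((trans x).1 + (lin x 1 : nat)%:Z - (lin x 0 : nat)%:Z,
   (trans x).2 + (lin x 2 : nat)%:Z - (lin x 1 : nat)%:Z).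
Proof.
rewrite s0E /= /coweight_act /coweight_of.
case: x => [[a b] v] /=; case: (perm3P v); rewrite /coweight_lift /=;
by congr (_, _) => /=; lia.
Qed.
Lemma lin_Ms0 x i : lin (x * s0)%g i = tperm 0 2 (lin x i).
Proof. by rewrite s0E /= permM. Qed.
Lemma lin_Ms1 x i : lin (x * s1)%g i = tperm 0 1 (lin x i).
Proof. by rewrite /= permM. Qed.
Lemma lin_Ms2 x i : lin (x * s2)%g i = tperm 1 2 (lin x i).
Proof. by rewrite /= permM. Qed.
Lemma trans_Mtau x : trans (x * tau)%g =
  ((trans x).1 + (lin x 0 == 0)%:Z - (lin x 1 == 0)%:Z,
   (trans x).2 + (lin x 1 == 0)%:Z - (lin x 2 == 0)%:Z).
Proof.
rewrite tauE /= /coweight_act /coweight_of.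
case: x => [[a b] v] /=; case: (perm3P v); rewrite /coweight_lift /=;
by congr (_, _) => /=; lia.
Qed.
Lemma lin_Mtau x i : lin (x * tau)%g i = tperm 1 2 (tperm 0 1 (lin x i)).
Proof. by rewrite tauE /= !permM. Qed.

Definition iwE := (trans_s0M, trans_s1M, trans_s2M, trans_tauM, trans_Ms0,
  trans_Ms1, trans_Ms2, trans_Mtau, lin_s0M, lin_s1M, lin_s2M, lin_tauM,
  lin_Ms0, lin_Ms1, lin_Ms2, lin_Mtau, permE3).

Ltac iw_cases x :=
  let v := fresh "v" in case: x => [[? ?] v] /=; case: (perm3P v); rewrite ?permE3 /=.

Lemma len_s1M_gt x : (len x < len (s1 * x)%g)%N =
  (0 <= (trans x).1 - (lin x 1%R < lin x 0%R)%N%:Z).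
Proof.
rewrite /len !iwE.
iw_cases x; lia.
Qed.

Lemma len_s1M x : len (s1 * x)%g = (len x).+1 \/ len x = (len (s1 * x)%g).+1.
Proof. rewrite /len !iwE. iw_cases x; lia. Qed.

Lemma len_s2M x : len (s2 * x)%g = (len x).+1 \/ len x = (len (s2 * x)%g).+1.
Proof. rewrite /len !iwE. iw_cases x; lia. Qed.
Lemma len_s0M x : len (s0 * x)%g = (len x).+1 \/ len x = (len (s0 * x)%g).+1.
Proof. rewrite /len !iwE. iw_cases x; lia. Qed.
Lemma len_tauM x : len (tau * x)%g = len x.
Proof. rewrite /len !iwE. iw_cases x; lia. Qed.
Lemma len_Mtau x : len (x * tau)%g = len x.
Proof. rewrite /len !iwE. iw_cases x; lia. Qed.

Lemma len_tauX j : len (tau ^+ j)%g = 0%N.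
Proof.
elim: j => [|j IH]; last by rewrite expgS len_tauM.
by rewrite expg0 /len /= !perm1.
Qed.

Lemma len_MtauX x j : len (x * tau ^+ j)%g = len x.
Proof.
by elim: j => [|j IH]; rewrite ?expg0 ?mulg1 // expgSr mulgA len_Mtau.
Qed.

Lemma len_simpleM i x : len (simple_reflection i * x)%g = (len x).+1 \/
  len x = (len (simple_reflection i * x)%g).+1.
Proof.
move: i; apply: ord3P; rewrite /simple_reflection /=.
- exact: len_s0M.
- exact: len_s1M.
exact: len_s2M.
Qed.

Lemma s0K : (s0 * s0 = 1)%g.
Proof.
apply: iwP => [|i]; first by rewrite trans_s0M s0E.
by rewrite lin_s0M s0E /= tpermK perm1.
Qed.

Lemma simpleK i : (simple_reflection i * simple_reflection i = 1)%g.
Proof.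
by move: i; apply: ord3P; rewrite /simple_reflection /= ?s0K ?s1K ?s2K.
Qed.

Lemma simpleV i : ((simple_reflection i)^-1 = simple_reflection i)%g.
Proof. by apply: (mulgI (simple_reflection i)); rewrite mulgV simpleK. Qed.

Lemma simple0 : simple_reflection 0 = s0. Proof. by []. Qed.
Lemma simple1 : simple_reflection 1 = s1. Proof. by []. Qed.
Lemma simple2 : simple_reflection 2 = s2. Proof. by []. Qed.

Lemma len_eq0 x : len x = 0%N -> exists j, x = (tau ^+ j)%g.
Proof.
rewrite /len; case: x => [[a b] v] /=.
move e0: (v 0) => i0; move e1: (v 1) => i1; move e2: (v 2) => i2.
move: (perm3P v); rewrite e0 e1 e2 => p.
(* If all three summands vanish, the descent indicators of the two adjacent pairs add up to that of
   the outer pair; only the three cyclic permutations satisfy this. *)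
case: p e0 e1 e2 => /= e0 e1 e2 h; try (exfalso; lia).
- have [-> ->] : a = 0 /\ b = 0 by lia.
  by exists 0%N; rewrite expg0; apply: iwP; [|apply: ord3P]; rewrite //= perm1.
- have [-> ->] : a = 0 /\ b = 1 by lia.
  exists 2%N; rewrite expgS expg1; apply: iwP; first by rewrite trans_tauM tauE.
  by apply: ord3P; rewrite lin_tauM tauE !permE3.
have [-> ->] : a = 1 /\ b = 0 by lia.
exists 1%N; rewrite expg1; apply: iwP; first by rewrite tauE.
by apply: ord3P; rewrite tauE !permE3.
Qed.

Lemma len_gt0 x : (0 < len x)%N ->
  exists i, len x = (len (simple_reflection i * x)%g).+1.
Proof.
move=> x0; suff [h|[h|h]] : len x = (len (s0 * x)%g).+1 \/
   len x = (len (s1 * x)%g).+1 \/ len x = (len (s2 * x)%g).+1.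
- by exists 0.
- by exists 1.
- by exists 2.
by move: x0; rewrite /len !iwE; iw_cases x; lia.
Qed.

Lemma has_expression_len x : has_expression x (len x).
Proof.
move: {2}(len x) (erefl (len x)) => n; elim: n x => [|n IH] x xn.
  have [j ->] := len_eq0 xn; exists [::], j.
  by rewrite big_nil mul1g len_tauX.
have [|i xi] := @len_gt0 x; first by rewrite xn.
rewrite xi in xn; have [r [j [sr e]]] := IH _ (succn_inj xn).
exists (i :: r), j; split; first by rewrite /= sr xi.
by rewrite big_cons -mulgA -e mulgA simpleK mul1g.
Qed.

Lemma len_expression x n : has_expression x n -> (len x <= n)%N.
Proof.
move=> [r [j [<- ->]]]; rewrite len_MtauX.
elim: r => [|i r IH]; first by rewrite big_nil /len /= !perm1.
rewrite big_cons -[size _]/(size r).+1; set y := (\prod_(_ <- _) _)%g in IH *.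
by have := len_simpleM i y; lia.
Qed.

Lemma ellE x : ell x = len x.
Proof.
rewrite /ell; case: ex_minnP => n /asboolP/len_expression h min.
apply/eqP; rewrite eqn_leq h andbT; apply: min.
exact/asboolP/has_expression_len.
Qed.

Lemma delta_simple i : delta (simple_reflection i) = simple_reflection (- i).
Proof.
move: i; apply: ord3P; rewrite /simple_reflection /=.
- exact: delta_s0.
- exact: delta_s1.
exact: delta_s2.
Qed.

Lemma delta_lin x i : lin (delta x) i = rev_ord (lin x (rev_ord i)).
Proof. by rewrite [LHS]permM lin_w0E permM lin_w0E. Qed.

Lemma rev_ord3E : (rev_ord 0 = 2 :> 'I_3) * (rev_ord 1 = 1 :> 'I_3) *
  (rev_ord 2 = 0 :> 'I_3).
Proof. by split; [split|]; apply: val_inj. Qed.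

Lemma deltaK x : delta (delta x) = x.
Proof.
apply: iwP => [|i]; first by case: x => [[a b] v].
by rewrite !delta_lin !rev_ordK.
Qed.

Lemma len_delta x : len (delta x) = len x.
Proof.
rewrite /len !delta_lin /= !rev_ord3E.
by iw_cases x; lia.
Qed.

Lemma len_tauXM m z : len (tau ^+ m * z)%g = len z.
Proof. by elim: m => [|m IH]; rewrite ?expg0 ?mul1g // expgS -mulgA len_tauM. Qed.

Lemma tauXV m : (tau ^- m = tau ^+ (m + m))%g.
Proof.
apply: (mulgI (tau ^+ m)%g); rewrite mulgV -expgD.
by rewrite (_ : (_ + _ = 3 * m)%N) ?expgM ?tau3 ?expg1n //; lia.
Qed.

Lemma len_inv_le y : (len (y^-1)%g <= len y)%N.
Proof.
have [r [j [<- e]]] := has_expression_len y.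
rewrite {}e invMg tauXV len_tauXM {y}.
elim/last_ind: r => [|r i IH]; first by rewrite big_nil invg1 /len /= !perm1.
rewrite -cats1 big_cat big_seq1 invMg simpleV size_cat addn1.
case: (len_simpleM i (\prod_(i <- r) simple_reflection i)^-1%g) => [->|e].
  exact: IH.
by apply: leqW; apply: leq_trans IH; rewrite e leqnSn.
Qed.

Lemma len_inv x : len (x^-1)%g = len x.
Proof.
apply/eqP; rewrite eqn_leq len_inv_le /=.
by have := len_inv_le (x^-1)%g; rewrite invgK.
Qed.

Lemma len_Msimple i x : len (x * simple_reflection i)%g = (len x).+1 \/
  len x = (len (x * simple_reflection i)%g).+1.
Proof.
have := len_simpleM i (x^-1)%g.
by rewrite -[(_ * x^-1)%g]invgK invMg invgK simpleV !len_inv.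
Qed.

(** * Shortening by twisted conjugation *)

(** Twisted conjugation s_i x δ(s_i)^-1: indices live in Z/3, where [delta] negates the index of a
    simple reflection. *)
Definition shift (i : 'I_3) (x : iwahori_weyl) : iwahori_weyl :=
  (simple_reflection i * x * simple_reflection (- i))%g.

Lemma opp1_I3 : - 1 = 2 :> 'I_3. Proof. exact: val_inj. Qed.
Lemma opp2_I3 : - 2 = 1 :> 'I_3. Proof. exact: val_inj. Qed.

Lemma shift0 x : shift 0 x = (s0 * x * s0)%g.
Proof. by rewrite /shift oppr0. Qed.
Lemma shift1 x : shift 1 x = (s1 * x * s2)%g.
Proof. by rewrite /shift opp1_I3. Qed.
Lemma shift2 x : shift 2 x = (s2 * x * s1)%g.
Proof. by rewrite /shift opp2_I3. Qed.
Definition shiftE := (shift0, shift1, shift2).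

Lemma shiftK i x : shift i (shift i x) = x.
Proof. by rewrite /shift !mulgA simpleK mul1g -mulgA simpleK mulg1. Qed.

Lemma delta_shift i x : delta (shift i x) = shift (- i) (delta x).
Proof. by rewrite /shift !deltaM !delta_simple. Qed.

(** The root lattice has index 3 in the coweight lattice; since the simple roots are (2, -1) and
    (-1, 2), this congruence cuts it out. *)
Definition in_Wa (x : iwahori_weyl) : bool :=
  (3%Z %| (trans x).1 - (trans x).2)%Z.

Lemma in_Wa_simpleM i x : in_Wa (simple_reflection i * x)%g = in_Wa x.
Proof.
move: i; apply: ord3P; rewrite /in_Wa (simple0, simple1, simple2) !iwE /=;
  by iw_cases x; lia.
Qed.

Lemma in_Wa_Msimple i x : in_Wa (x * simple_reflection i)%g = in_Wa x.
Proof.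
move: i; apply: ord3P; rewrite /in_Wa (simple0, simple1, simple2) !iwE //=.
by iw_cases x; lia.
Qed.

Lemma in_Wa_shift i x : in_Wa (shift i x) = in_Wa x.
Proof. by rewrite in_Wa_Msimple in_Wa_simpleM. Qed.

Definition reducible (x : iwahori_weyl) : Prop :=
  exists i, len x = (len (shift i x)).+2.

(** Here xδ is the point reflection centred at half the translation part, and [shift i] reflects
    that centre in the wall of s_i. The two exceptions are the centre 0 and half the highest
    root. *)
Lemma reducible_w0 x : in_Wa x -> lin x 0 = 2 -> lin x 1 = 1 -> lin x 2 = 0 ->
  [\/ x = s0, x = (s1 * s2 * s1)%g | reducible x].
Proof.
rewrite /in_Wa => xa x0 x1 x2.
have [e|[e|[e|[e|e]]]] : trans x = (0, 0) \/ trans x = (1, 1) \/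
    len x = (len (shift 0 x)).+2 \/ len x = (len (shift 1 x)).+2 \/
    len x = (len (shift 2 x)).+2.
- rewrite !shiftE /len !iwE /= ?iwE /= !x0 !x1 !x2 !permE3 /=.
  case: (trans x) xa => [a b] /= xa.
  have [|] : (a = 0 /\ b = 0) \/ ~ (a = 0 /\ b = 0) by lia.
    by case=> -> ->; left.
  have [|] : (a = 1 /\ b = 1) \/ ~ (a = 1 /\ b = 1) by lia.
    by case=> -> ->; right; left.
  by move=> h1 h2; right; right; lia.
- apply: Or32; apply: iwP; first by rewrite e !iwE.
  by apply: ord3P; rewrite ?(x0, x1, x2) /= !permE3.
- apply: Or31; apply: iwP; first by rewrite e s0E.
  by apply: ord3P; rewrite ?(x0, x1, x2) s0E /= !permE3.
- by apply: Or33; exists 0.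
- by apply: Or33; exists 1.
by apply: Or33; exists 2.
Qed.

(* One length-preserving cyclic shift may be needed before the length drops. *)
Definition shift_reducible (x : iwahori_weyl) : Prop :=
  exists i j, [/\ len (shift i x) = len x,
    len x = (len (simple_reflection i * x)%g).+1 \/
    len x = (len (x * simple_reflection (- i))%g).+1 &
    len (shift i x) = (len (shift j (shift i x))).+2].

Ltac len_compute e0 e1 e2 :=
  rewrite ?(oppr0, opp1_I3, opp2_I3) ?(simple0, simple1, simple2) ?shiftE
    /len ?iwE /= ?iwE /= ?e0 ?e1 ?e2 ?permE3 /=.

Ltac len_lia e0 e1 e2 x := len_compute e0 e1 e2;
  let a := fresh in let b := fresh in case: (trans x) => a b /=; lia.

(** Here xδ is a rotation of order 6. The case split follows the signs of the pairings of the
    translation part with the three positive roots, which tell which wall to use; in some sectors no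
    first step shortens and a length-preserving one is taken. *)
Lemma reducible_s1 x : in_Wa x -> lin x 0 = 1 -> lin x 1 = 0 -> lin x 2 = 2 ->
  [\/ x = s1, reducible x | shift_reducible x].
Proof.
rewrite /in_Wa => xa x0 x1 x2.
have [e|e] := eqVneq (trans x) (0, 0).
  apply: Or31; apply: iwP; first by rewrite e.
  by apply: ord3P; rewrite ?(x0, x1, x2) /= !permE3.
have ab : ~ ((trans x).1 = 0 /\ (trans x).2 = 0).
  by case: (trans x) e => a b /= /eqP e [a0 b0]; apply: e; rewrite a0 b0.
have red i : len x = (len (shift i x)).+2 ->
    [\/ x = s1, reducible x | shift_reducible x].
  by move=> xi; apply: Or32; exists i.
have sred i j : len (shift i x) = len x ->
    len x = (len (simple_reflection i * x)%g).+1 \/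
    len x = (len (x * simple_reflection (- i))%g).+1 ->
    len (shift i x) = (len (shift j (shift i x))).+2 ->
    [\/ x = s1, reducible x | shift_reducible x].
  by move=> *; apply: Or33; exists i, j.
move: xa ab red sred.
have [a0|a0] := leP (trans x).1 0; have [b0|b0] := ltP (trans x).2 0.
- move=> _ _ red _; apply: (red 2); move: a0 b0 {red}.
  by len_lia x0 x1 x2 x.
- have [b1|b1] := eqVneq (trans x).2 0.
    move=> xa ab _ sred; apply: (sred 2 1); move: a0 b1 xa ab {sred b0};
    by len_lia x0 x1 x2 x.
  have [ab1|ab1] := ltP 0 ((trans x).1 + (trans x).2).
    move=> _ _ red _; apply: (red 1); move: a0 b0 ab1 {b1 red};
    by len_lia x0 x1 x2 x.
  by move=> xa _ _ sred; apply: (sred 1 2); move: a0 b0 b1 ab1 xa {sred};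
    len_lia x0 x1 x2 x.
- have [ab1|ab1] := leP ((trans x).1 + (trans x).2) 0; last first.
    move=> xa _ red _; apply: (red 0); move: a0 b0 ab1 xa {red};
    by len_lia x0 x1 x2 x.
  have [a1|a1] := eqVneq (trans x).1 1.
    by move=> xa _ _ sred; apply: (sred 2 0); move: b0 a1 ab1 xa {sred a0};
    len_lia x0 x1 x2 x.
  by move=> xa _ _ sred; apply: (sred 0 2); move: a0 b0 a1 ab1 xa {sred};
    len_lia x0 x1 x2 x.
have [a1|a1] := eqVneq (trans x).1 1.
  by move=> xa _ _ sred; apply: (sred 1 0); move: b0 a1 xa {sred a0};
    len_lia x0 x1 x2 x.
by move=> xa _ _ sred; apply: (sred 0 1); move: a0 b0 a1 xa {sred};
    len_lia x0 x1 x2 x.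
Qed.

Lemma len_shift_delta i x : len (shift i (delta x)) = len (shift (- i) x).
Proof. by rewrite -[RHS]len_delta delta_shift opprK. Qed.

Lemma reducible_delta x : reducible (delta x) -> reducible x.
Proof. by move=> [i]; rewrite len_delta len_shift_delta; exists (- i). Qed.

Lemma shift_reducible_delta x : shift_reducible (delta x) -> shift_reducible x.
Proof.
move=> [i [j]]; have -> : shift i (delta x) = delta (shift (- i) x).
  by rewrite delta_shift opprK.
rewrite len_shift_delta !len_delta => -[e1 e2 e3].
exists (- i), (- j); split=> //.
rewrite -(len_delta (_ * x)%g) -(len_delta (x * _)%g).
by rewrite !deltaM !delta_simple !opprK.
Qed.

(* For these x, xδ acts on the apartment as a glide reflection, and c measures
   its translation part. *)
Definition even_values (x : iwahori_weyl) : int -> Prop := fun c =>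
  [\/ [/\ lin x 0 = 0, lin x 1 = 1, lin x 2 = 2 & c = (trans x).1 + (trans x).2],
      [/\ lin x 0 = 1, lin x 1 = 2, lin x 2 = 0 & c = (trans x).1] |
      [/\ lin x 0 = 2, lin x 1 = 0, lin x 2 = 1 & c = (trans x).2]].

Lemma trans_root (i j : int) : alpha1 *~ i + alpha2 *~ j = (2 * i - j, 2 * j - i).
Proof.
by rewrite !coweightMz /alpha1 /alpha2 [LHS]surjective_pairing /=; congr (_, _); lia.
Qed.

(** Each family has a fixed linear part and a fixed sign of c, while k moves the translation part
    without changing c. The roundings are arranged so that [2 * up - e] and [2 * lo + e] both equal
    m. *)
Lemma XsetP m x : Xset m x <-> in_Wa x /\
  exists2 c, even_values x c & `|c|%N = m.
Proof.
split.
  move=> [k]; rewrite !trans_root /in_Wa.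
  have mE : (m = odd m + m./2.*2)%N by rewrite odd_double_half.
  have mU : (m.+1./2 = odd m + m./2)%N by rewrite -uphalfE uphalf_half.
  move: (odd m) (m./2) (m.+1./2) mE mU => e lo up mE mU.
  move=> [->|[->|[->|[->|[->|->]]]]];
    rewrite ?iwE /=; (split; first lia); rewrite /even_values ?iwE ?permE3 /=.
  - exists (2 * (k - lo%:Z) - (2 * k + e%:Z)); last lia.
    by apply: Or32; rewrite ?permE3 /=; split=> //; lia.
  - exists (2 * (k + up%:Z) - (2 * k + e%:Z)); last lia.
    by apply: Or32; rewrite ?permE3 /=; split=> //; lia.
  - exists (2 * (k + up%:Z) - (2 * k + e%:Z)); last lia.
    by apply: Or33; rewrite ?permE3 /=; split=> //; lia.
  - exists (2 * (k - lo%:Z) - (2 * k + e%:Z)); last lia.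
    by apply: Or33; rewrite ?permE3 /=; split=> //; lia.
  - by exists m%:Z; last lia; apply: Or31; rewrite ?perm1; split=> //; lia.
  by exists (- m%:Z); last lia; apply: Or31; rewrite ?perm1; split=> //; lia.
move=> [xa [c xc cm]]; move: xa; rewrite /in_Wa => /dvdzP [d dE].
have mE : (m = odd m + m./2.*2)%N by rewrite odd_double_half.
have mU : (m.+1./2 = odd m + m./2)%N by rewrite -uphalfE uphalf_half.
pose b := (trans x).2.
(* With a = b + 3d, the system 2i - j = a, 2j - i = b has the solution i = b + 2d, j = b + d. *)
have xE : x = (translation (alpha1 *~ (b + 2 * d) + alpha2 *~ (b + d)) *
    finite_weyl (lin x))%g.
  rewrite trans_root [LHS]iwahori_weylE; congr (translation _ * _)%g.
  by rewrite [LHS]surjective_pairing; congr (_, _); rewrite /b; lia.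
have s21 : lin x 0 = 1 -> lin x 1 = 2 -> lin x 2 = 0 ->
    finite_weyl (lin x) = (s2 * s1)%g.
  move=> x0 x1 x2; apply: iwP; first by rewrite !iwE.
  by apply: ord3P; rewrite ?iwE /= ?permE3.
have s12 : lin x 0 = 2 -> lin x 1 = 0 -> lin x 2 = 1 ->
    finite_weyl (lin x) = (s1 * s2)%g.
  move=> x0 x1 x2; apply: iwP; first by rewrite !iwE.
  by apply: ord3P; rewrite ?iwE /= ?permE3.
have s00 : lin x 0 = 0 -> lin x 1 = 1 -> lin x 2 = 2 ->
    finite_weyl (lin x) = 1%g.
  move=> x0 x1 x2; apply: iwP; first by [].
  by apply: ord3P; rewrite ?perm1.
move: mE mU; rewrite /Xset; move: (odd m) (m./2) (m.+1./2) => e lo up mE mU.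
rewrite {}xE; case: xc => [] [x0 x1 x2 cE].
- rewrite (s00 x0 x1 x2) mulg1; have [c0|c0] := leP 0 c.
    exists (b + 2 * d); do 4!right; left; congr (translation (_ *~ _ + _ *~ _)); lia.
  exists (- (b + d)); do 5!right; congr (translation (_ *~ _ + _ *~ _)); lia.
- rewrite (s21 x0 x1 x2) mulgA; have [c0|c0] := leP 0 c.
    exists (b + 2 * d - up%:Z); right; left; congr (translation (_ *~ _ + _ *~ _) * _ * _)%g; lia.
  exists (b + 2 * d + lo%:Z); left; congr (translation (_ *~ _ + _ *~ _) * _ * _)%g; lia.
rewrite (s12 x0 x1 x2) mulgA; have [c0|c0] := leP 0 c.
  exists (b + d - up%:Z); right; right; left; congr (translation (_ *~ _ + _ *~ _) * _ * _)%g; lia.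
exists (b + d + lo%:Z); do 3!right; left; congr (translation (_ *~ _ + _ *~ _) * _ * _)%g; lia.
Qed.

Lemma even_valuesP x :
  (exists c, even_values x c) \/
  [\/ [/\ lin x 0 = 0, lin x 1 = 2 & lin x 2 = 1],
      [/\ lin x 0 = 1, lin x 1 = 0 & lin x 2 = 2] |
      [/\ lin x 0 = 2, lin x 1 = 1 & lin x 2 = 0]].
Proof.
rewrite /even_values; case: (perm3P (lin x)).
- by left; exists ((trans x).1 + (trans x).2); apply: Or31.
- by right; apply: Or31.
- by right; apply: Or32.
- by left; exists (trans x).1; apply: Or32.
- by left; exists (trans x).2; apply: Or33.
by right; apply: Or33.
Qed.

(** Linear part s2 is carried to s1 by [delta], which preserves lengths, so two computations
    suffice. *)
Lemma odd_reducible x :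
  [\/ [/\ lin x 0 = 0, lin x 1 = 2 & lin x 2 = 1],
      [/\ lin x 0 = 1, lin x 1 = 0 & lin x 2 = 2] |
      [/\ lin x 0 = 2, lin x 1 = 1 & lin x 2 = 0]] ->
  in_Wa x ->
  [\/ x = s0 \/ x = s1, x = s2 \/ x = (s1 * s2 * s1)%g, reducible x | shift_reducible x].
Proof.
move=> h xa; case: h => [] [x0 x1 x2].
- have da : in_Wa (delta x) by move: xa; rewrite /in_Wa /=; lia.
  have [|||e|e|e] := reducible_s1 da; rewrite ?delta_lin ?rev_ord3E ?(x0, x1, x2).
  + by rewrite rev_ord3E.
  + by rewrite rev_ord3E.
  + by rewrite rev_ord3E.
  + by apply: Or42; left; rewrite -(deltaK x) e delta_s1.
  + by apply: Or43; apply: reducible_delta.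
  by apply: Or44; apply: shift_reducible_delta.
- have [e|e|e] := reducible_s1 xa x0 x1 x2.
  + by apply: Or41; right.
  + exact: Or43.
  exact: Or44.
have [e|e|e] := reducible_w0 xa x0 x1 x2.
- by apply: Or41; left.
- by apply: Or42; right.
exact: Or43.
Qed.

(** A translation (a, b) has length |a| + |b| + |a + b|, which is 2|a + b| unless a and b have
    opposite signs; then twisting by s1 or s2 shortens it. The two rotations behave in the same way.
    Together with the lower bound 2|c| this identifies the minimal elements. *)
Lemma even_reducible x c : in_Wa x -> even_values x c ->
  reducible x \/ len x = (2 * `|c|)%N.
Proof.
have red i : len x = (len (shift i x)).+2 -> reducible x by exists i.
rewrite /in_Wa => xa; case=> [] [x0 x1 x2 ->]; move: red xa.
- have [a0|a0] := ltP (trans x).1 0; have [b0|b0] := ltP (trans x).2 0.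
  + by move=> _ _; right; move: a0 b0; len_lia x0 x1 x2 x.
  + have [b1|b1] := eqVneq (trans x).2 0.
      by move=> _ _; right; move: a0 b1; len_lia x0 x1 x2 x.
    by move=> red _; left; apply: (red 1); move: a0 b0 b1 {red}; len_lia x0 x1 x2 x.
  + have [b1|b1] := eqVneq (trans x).1 0.
      by move=> _ _; right; move: b0 b1; len_lia x0 x1 x2 x.
    by move=> red _; left; apply: (red 2); move: a0 b0 b1 {red}; len_lia x0 x1 x2 x.
  by move=> _ _; right; move: a0 b0; len_lia x0 x1 x2 x.
- have [a0|a0] := leP (trans x).1 0.
    have [b0|b0] := leP (trans x).2 0.
      by move=> red xa; left; apply: (red 2); move: xa b0 a0 {red}; len_lia x0 x1 x2 x.
    have [ab|ab] := leP ((trans x).1 + (trans x).2) 1.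
      by move=> _ _; right; move: ab b0 a0; len_lia x0 x1 x2 x.
    by move=> red xa; left; apply: (red 0); move: xa b0 a0 ab {red}; len_lia x0 x1 x2 x.
  have [ab|ab] := leP ((trans x).1 + (trans x).2) 0.
    by move=> red xa; left; apply: (red 2); move: xa a0 ab {red}; len_lia x0 x1 x2 x.
  have [b0|b0] := leP (trans x).2 1.
    by move=> _ _; right; move: ab b0 a0; len_lia x0 x1 x2 x.
  by move=> red xa; left; apply: (red 0); move: xa b0 a0 ab {red}; len_lia x0 x1 x2 x.
have [a0|a0] := leP (trans x).2 0.
  have [b0|b0] := leP (trans x).1 0.
    by move=> red xa; left; apply: (red 1); move: xa b0 a0 {red}; len_lia x0 x1 x2 x.
  have [ab|ab] := leP ((trans x).1 + (trans x).2) 1.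
    by move=> _ _; right; move: ab b0 a0; len_lia x0 x1 x2 x.
  by move=> red xa; left; apply: (red 0); move: xa b0 a0 ab {red}; len_lia x0 x1 x2 x.
have [ab|ab] := leP ((trans x).1 + (trans x).2) 0.
  by move=> red xa; left; apply: (red 1); move: xa a0 ab {red}; len_lia x0 x1 x2 x.
have [b0|b0] := leP (trans x).1 1.
  by move=> _ _; right; move: ab b0 a0; len_lia x0 x1 x2 x.
by move=> red xa; left; apply: (red 0); move: xa b0 a0 ab {red}; len_lia x0 x1 x2 x.
Qed.

Lemma even_len_ge x c : even_values x c -> (2 * `|c| <= len x)%N.
Proof. by case=> [] [x0 x1 x2 ->]; len_lia x0 x1 x2 x. Qed.

(** Because [delta tau] is the inverse of [tau], twisted conjugation by a power of [tau] multiplies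
    by that power on both sides; the three pieces of [hat] are the powers 0, 1 and 2. *)
Lemma Odelta_tau m x : Odelta m x <->
  exists2 j, exists2 y, Xset m y & x = (tau ^+ j * y * tau ^+ j)%g & (j < 3)%N.
Proof.
have t1 : (tau^-1 * tau ^+ 2 = tau ^+ 1)%g by rewrite expgS mulKg.
have t2 : (tau ^- 2 * tau = tau ^+ 2)%g.
  by apply: (mulgI (tau ^+ 2)%g); rewrite mulVKg -expgD (expgS _ 3) tau3 mulg1.
split=> [[[xm|[y ym <-]]|[y ym <-]]|[[|[|[|//]]] [y ym ->] _]].
- by exists 0%N => //; exists x => //; rewrite expg0 mul1g mulg1.
- by exists 1%N => //; exists y => //; rewrite -mulgA t1 expg1.
- by exists 2%N => //; exists y => //; rewrite -mulgA t2.
- by left; left; rewrite expg0 mul1g mulg1.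
- by left; right; exists y => //; rewrite -mulgA t1 expg1.
by right; exists y => //; rewrite -mulgA t2.
Qed.

Lemma Xset_min_exists m : (0 < m)%N -> exists2 x, Xset m x & len x = (2 * m)%N.
Proof.
move=> m0; have [b [b1 b2 bm]] : exists b : int, [/\ -1 <= b, b <= 1 & (3%Z %| m%:Z - b)%Z].
  have [|[|]] : ((3%Z %| m%:Z - 0) \/ (3%Z %| m%:Z - 1) \/ (3%Z %| m%:Z - -1))%Z by lia.
  - by exists 0.
  - by exists 1.
  by exists (-1).
(* Taking b congruent to m modulo 3 puts the element in W_a, and b <= 1 <= m + b makes the three
   summands of the length m, 1 - b and m + b - 1. *)
exists (IwahoriWeyl (m%:Z, b) (lin (s2 * s1)%g)).
  apply/XsetP; split=> //; exists m%:Z => //; apply: Or32.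
  by rewrite ?permE3.
by rewrite /len /= ?permE3 /=; lia.
Qed.

Lemma min_length_OdeltaP m x : (0 < m)%N -> min_length (Odelta m) x <->
  exists j y, [/\ Xset m y, len y = (2 * m)%N & x = (tau ^+ j * y * tau ^+ j)%g].
Proof.
move=> m0; have lt j y : len (tau ^+ j * y * tau ^+ j)%g = len y.
  by rewrite len_MtauX len_tauXM.
have ge y : Odelta m y -> (2 * m <= len y)%N.
  move=> /Odelta_tau[j [z /XsetP[_ [c zc <-]] ->] _].
  by rewrite lt even_len_ge.
split=> [[xm xmin]|[j [y [ym yl ->]]]].
  have [z zm zl] := Xset_min_exists m0.
  have [j [y ym xE] _] := (Odelta_tau _ _).1 xm.
  exists j, y; split=> //; apply/eqP; rewrite -(lt j y) -xE eqn_leq ge // andbT.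
  rewrite -zl -!ellE; apply: xmin; apply/Odelta_tau; exists 0%N => //.
  by exists z; rewrite // expg0 mul1g mulg1.
split=> [|z zm]; last by rewrite !ellE lt yl ge.
apply/Odelta_tau; exists (j %% 3)%N; last by rewrite ltn_mod.
exists y => //; have -> : (tau ^+ j = tau ^+ (j %% 3))%g; last by [].
by rewrite {1}(divn_eq j 3) expgD mulnC expgM tau3 expg1n mul1g.
Qed.

Lemma even_values_len x c : even_values x c -> ~~ odd (len x).
Proof. by case=> [] [x0 x1 x2 _]; len_lia x0 x1 x2 x. Qed.

(** Multiplying by [tau] on both sides shifts the class in the quotient of order 3 by 2, which
    generates it. *)
Lemma in_Wa_tau x : exists j, in_Wa (tau ^+ j * x * tau ^+ j)%g.
Proof.
have [h|[h|h]] : in_Wa x \/ in_Wa (tau * x * tau)%g \/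
    in_Wa (tau * (tau * x * tau) * tau)%g.
- by rewrite /in_Wa !iwE /= ?iwE /=; iw_cases x; lia.
- by exists 0%N; rewrite expg0 mul1g mulg1.
- by exists 1%N; rewrite expg1.
by exists 2%N; rewrite !expgS expg0 mulg1 -!mulgA in h *; rewrite !mulgA in h *.
Qed.

Lemma tau3X j : (tau ^+ (2 * j) * tau ^+ j = 1)%g.
Proof. by rewrite -expgD (_ : (_ + _ = 3 * j)%N) ?expgM ?tau3 ?expg1n //; lia. Qed.

Lemma tau3Xr j : (tau ^+ j * tau ^+ (2 * j) = 1)%g.
Proof. by rewrite -expgD (_ : (_ + _ = 3 * j)%N) ?expgM ?tau3 ?expg1n //; lia. Qed.

Lemma tauXK j x : (tau ^+ (2 * j) * (tau ^+ j * x * tau ^+ j) * tau ^+ (2 * j) = x)%g.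
Proof. by rewrite !mulgA tau3X mul1g -mulgA tau3Xr mulg1. Qed.

(** * Length induction for a property stable under the exchange moves *)

Section Reduction.
Variable P : iwahori_weyl -> Prop.
Hypothesis P1 : P 1%g.
Hypothesis Ps0 : P s0.
Hypothesis Ps1 : P s1.
Hypothesis Pw0 : P (s1 * s2 * s1)%g.
Hypothesis P_delta : forall x, P x -> P (delta x).
Hypothesis P_tau : forall x, P x -> P (tau * x * tau)%g.
Hypothesis P_shift : forall i x, len (shift i x) = len x ->
  len x = (len (simple_reflection i * x)%g).+1 \/
  len x = (len (x * simple_reflection (- i))%g).+1 -> P x -> P (shift i x).
Hypothesis P_up : forall i x, len (shift i x) = (len x).+2 ->
  P x -> P (shift i x).
Hypothesis P_down : forall i x, len (shift i x) = (len x).+2 ->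
  P (x * simple_reflection (- i))%g -> P (shift i x).

Let P_tauX j x : P x -> P (tau ^+ j * x * tau ^+ j)%g.
Proof.
move=> Px; elim: j => [|j IH]; first by rewrite expg0 mul1g mulg1.
have -> : (tau ^+ j.+1 * x * tau ^+ j.+1 = tau * (tau ^+ j * x * tau ^+ j) * tau)%g.
  by rewrite {1}expgS expgSr !mulgA.
exact: P_tau.
Qed.

Let P_odd x : in_Wa x -> odd (len x) -> P x.
Proof.
move: {2}(len x) (leqnn (len x)) => n; elim/ltn_ind: n x => n IH x xn xa xo.
have red y : in_Wa y -> (len y <= n)%N -> odd (len y) -> reducible y -> P y.
  move=> ya yn yo [i yi]; rewrite -(shiftK i y); apply: P_up.
    by rewrite shiftK -yi.
  apply: (IH (len (shift i y))) => //; first by lia.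
  - by rewrite in_Wa_shift.
  by move: yo; rewrite yi /= negbK.
have [[c /even_values_len]|] := even_valuesP x; first by rewrite xo.
move=> /odd_reducible/(_ xa)[[->|->]|[->|->]|r|[i [j [e1 e2 e3]]]] //.
- by rewrite -delta_s1; apply: P_delta.
- exact: red.
(* The move starts from the shifted element and leads back to x, so the descent condition is needed
   there; left and right descents trade places under the shift. *)
rewrite -(shiftK i x); apply: P_shift; rewrite ?shiftK ?e1 //.
  rewrite /shift !mulgA simpleK mul1g -2!mulgA simpleK mulg1.
  by case: e2; [right|left].
by apply: red; rewrite ?in_Wa_shift ?e1 //; exists j; rewrite -e3.
Qed.

Let P_or_min_Wa x : in_Wa x ->
  P x \/ exists m, [/\ (0 < m)%N, Xset m x & len x = (2 * m)%N].
Proof.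
move=> xa; have [xo|xe] := boolP (odd (len x)); first by left; apply: P_odd.
have [[c xc]|] := even_valuesP x; last first.
  by case=> [] [x0 x1 x2]; move: xe xa; rewrite /in_Wa; len_lia x0 x1 x2 x.
have [[i xi]|xl] := even_reducible xa xc.
  left; rewrite -(shiftK i x); apply: P_down; first by rewrite shiftK -xi.
  rewrite -mulgA simpleK mulg1; apply: P_odd; first by rewrite in_Wa_simpleM.
  have := len_simpleM i x; have := len_Msimple (- i) (simple_reflection i * x)%g.
  rewrite -/(shift i x); set p := len (shift i x) in xi *.
  by move: (len x) (len (_ * x)%g) xi xe => q r; lia.
have [c0|c0] := eqVneq c 0; last first.
  right; exists `|c|%N; split=> //; first by lia.
  by apply/XsetP; split=> //; exists c.
left; have [|j ->] := @len_eq0 x; first by rewrite xl c0.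
(* As 4j and j agree modulo 3, every power of [tau] is a twisted conjugate of 1. *)
have -> : (tau ^+ j = tau ^+ (2 * j) * 1 * tau ^+ (2 * j))%g.
  by rewrite mulg1 -{1}(mul1g (tau ^+ j)%g) -(tau3X j) -mulgA -expgD addnn mul2n.
exact: P_tauX.
Qed.

Lemma reduction x : P x \/ exists2 m, (0 < m)%N & min_length (Odelta m) x.
Proof.
have [j xj] := in_Wa_tau x; have [Px|[m [m0 xm xl]]] := P_or_min_Wa xj.
  by left; rewrite -(tauXK j x); apply: P_tauX.
right; exists m => //; apply/min_length_OdeltaP => //.
by exists (2 * j)%N, (tau ^+ j * x * tau ^+ j)%g; split; rewrite ?tauXK.
Qed.

End Reduction.

(** * Valuations of Laurent series *)

Section Valuation.
Variable k : fieldType.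
Implicit Types f g : laurent k.

(** A lower bound on the valuation, stated as a relation so that the zero series needs no
    convention. *)
Definition vge (n : int) f : Prop := forall m : int, m < n -> f m = 0.

Lemma vge_le m n f : m <= n -> vge n f -> vge m f.
Proof. by move=> mn fn i im; apply: fn; lia. Qed.

Lemma vge0 n : vge n 0. Proof. by []. Qed.

Lemma vgeD n f g : vge n f -> vge n g -> vge n (f + g).
Proof. by move=> fn gn m mn; rewrite /= fn // gn // addr0. Qed.

Lemma vgeN n f : vge n f -> vge n (- f).
Proof. by move=> fn m mn; rewrite /= fn // oppr0. Qed.

Lemma vgeB n f g : vge n f -> vge n g -> vge n (f - g).
Proof. by move=> fn gn; apply/vgeD/vgeN. Qed.

Lemma vge_sum n (I : Type) (r : seq I) (P : pred I) (F : I -> laurent k) :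
  (forall i, P i -> vge n (F i)) -> vge n (\sum_(i <- r | P i) F i).
Proof. by move=> h; apply: big_ind => //; exact: vgeD. Qed.

Lemma vgeM m n f g : vge m f -> vge n g -> vge (m + n) (f * g).
Proof. by move=> fm gn i; apply: lconv_low. Qed.

Lemma lcoefM_lead m n f g : vge m f -> vge n g -> (f * g : laurent k) (m + n) = f m * g n.
Proof.
move=> fm gn; rewrite -[m + n]addr0 (_ : lcoef (f * g) _ = lconv f g (m + n + 0%:Z)) //.
by rewrite (lconvE fm gn (ltnSn 0)) coefM big_ord1 !coef_poly /= !addr0.
Qed.

Lemma lcoefM_single m f g : (forall i, i != m -> f i = 0) ->
  forall n, (f * g : laurent k) n = f m * g (n - m).
Proof.
move=> fm n; rewrite (_ : lcoef (f * g) n = lconv f g n) // /lconv.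
rewrite -(@fsbig_widen _ _ _ _ [set m]) //; first by rewrite fsbig_set1.
by move=> i [_ /eqP im]; rewrite /= fm ?mul0r.
Qed.

Lemma lcoef_monoM m f n : (lmono k m * f : laurent k) n = f (n - m).
Proof.
rewrite (@lcoefM_single m) /= ?eqxx ?mul1r // => i /negbTE im.
by rewrite im.
Qed.

Lemma lmonoM m n : lmono k m * lmono k n = lmono k (m + n).
Proof.
apply: laurentP => i; rewrite lcoef_monoM /=; congr (_%:R).
by rewrite subr_eq (addrC m).
Qed.

Lemma lmono_neq0 m : lmono k m != 0.
Proof.
apply/eqP => /(congr1 (fun f : laurent k => f m)) /= /eqP.
by rewrite eqxx oner_eq0.
Qed.

Lemma eps_neq0 : eps k != 0. Proof. exact: lmono_neq0. Qed.

Lemma eps_exp z : eps k ^ z = lmono k z.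
Proof.
have n_exp (n : nat) : eps k ^+ n = lmono k n%:Z.
  by elim: n => // n IH; rewrite exprS IH lmonoM; congr lmono; lia.
case: z => n; first exact: n_exp.
apply: (mulfI (lmono_neq0 n.+1)); rewrite -{1}n_exp lmonoM.
by rewrite NegzE -exprnN mulfV ?addrN // expf_neq0 // eps_neq0.
Qed.

Lemma vge_eps z : vge z (eps k ^ z).
Proof. by rewrite eps_exp => m /= mz; rewrite lt_eqF. Qed.

Lemma vge_epsM z n f : vge (n - z) f <-> vge n (eps k ^ z * f).
Proof.
rewrite eps_exp; split=> h m mn; first by rewrite lcoef_monoM h //; lia.
by have := h (m + z); rewrite lcoef_monoM addrK; apply; lia.
Qed.

Lemma lconst_subproof (c : k) : exists N : int, forall n : int, n < N -> c *+ (n == 0) = 0.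
Proof. by exists 0 => n n0; rewrite lt_eqF. Qed.
Definition lconst (c : k) : laurent k := Laurent (lconst_subproof c).

Lemma lcoef_constM c f n : (lconst c * f : laurent k) n = c * f n.
Proof.
rewrite (@lcoefM_single 0) /= ?subr0 // => i /negbTE i0.
by rewrite i0.
Qed.

Lemma lconst_is_zmod_morphism : zmod_morphism lconst.
Proof. by move=> x y; apply: laurentP => n; rewrite /= mulrnBl. Qed.
Lemma lconst_is_monoid_morphism : monoid_morphism lconst.
Proof.
split=> [|x y]; apply: laurentP => n //.
by rewrite lcoef_constM /= mulrnAr.
Qed.
HB.instance Definition _ := GRing.isZmodMorphism.Build _ _ lconst
  lconst_is_zmod_morphism.
HB.instance Definition _ := GRing.isMonoidMorphism.Build _ _ lconst
  lconst_is_monoid_morphism.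

Lemma vge_const c : vge 0 (lconst c).
Proof. by move=> m m0 /=; rewrite lt_eqF. Qed.

Lemma vgeS n f : vge n f -> f n = 0 -> vge (n + 1) f.
Proof.
move=> fn f0 m mn; have [->//|mn'] := eqVneq m n.
by apply: fn; lia.
Qed.

Lemma vge_exact f : f != 0 -> exists n, vge n f /\ f n != 0.
Proof.
move=> f0; have [N hN] := lcoef_bounded f.
have [i0 hi0] : exists i : nat, f (N + i%:Z) != 0.
  apply: contrapT => H; case/eqP: f0; apply: laurentP => n /=.
  case: (ltP n N) => [/hN //|Nn]; apply/eqP/negPn/negP => fn.
  by apply: H; exists (absz (n - N)%R); rewrite (_ : N + _ = n) //; lia.
case: (ex_minnP (ex_intro (fun i : nat => f (N + i%:Z) != 0) i0 hi0)) => m hm mmin.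
exists (N + m%:Z); split=> // i iM.
case: (ltP i N) => [/hN //|Ni]; apply/eqP/negPn/negP => fi.
have := mmin (absz (i - N)%R); rewrite (_ : N + _ = i); last by lia.
by move=> /(_ fi); lia.
Qed.

End Valuation.

(** * The Iwahori subgroup and its double cosets *)

Section ProjectiveClasses.
Variables (n : nat) (K : fieldType).
Implicit Types (M N : 'M[K]_n) (g : PGL n K).

(* Junk value 1 on singular matrices. *)
Definition pgl M : PGL n K := \pi_(PGL n K) (insubd GLone M).

Lemma val_pgl M : M \in unitmx -> val (insubd (@GLone n K) M) = M.
Proof. by move=> Mu; rewrite insubdK. Qed.

Lemma pgl_val (A : GL n K) : pgl (val A) = \pi_(PGL n K) A.
Proof. by congr (\pi _); apply: val_inj; rewrite val_pgl // (valP A). Qed.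

Lemma pgl_surj g : exists2 M, M \in unitmx & g = pgl M.
Proof.
by elim/quotW: g => A; exists (val A); [exact: (valP A)|rewrite pgl_val].
Qed.

Lemma pglM M N : M \in unitmx -> N \in unitmx -> pgl (M *m N) = (pgl M * pgl N)%g.
Proof.
move=> Mu Nu; rewrite -[RHS]/(PGLmul _ _) /pgl -pi_PGLmul; congr (\pi _).
by apply: val_inj; rewrite /= !val_pgl // unitmx_mul Mu.
Qed.

Lemma pgl1 : pgl 1%:M = 1%g.
Proof.
rewrite -[RHS]/(\pi_(PGL n K) GLone); congr (\pi _).
by apply: val_inj; rewrite /= val_pgl // unitmx1.
Qed.

Lemma pglV M : M \in unitmx -> pgl (invmx M) = ((pgl M)^-1)%g.
Proof.
move=> Mu; apply: (mulgI (pgl M)).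
by rewrite -pglM ?unitmx_inv // mulmxV // pgl1 mulgV.
Qed.

Lemma pgl_eq M N : M \in unitmx -> N \in unitmx ->
  pgl M = pgl N <-> exists2 c, c != 0 & M = c *: N.
Proof.
move=> Mu Nu; split=> [/eqmodP/asboolP|] [c c0].
  by rewrite !val_pgl //; exists c.
by move=> e; apply/eqmodP/asboolP; exists c; rewrite // !val_pgl.
Qed.

Lemma pglZ c M : c != 0 -> pgl (c *: M) = pgl M.
Proof.
move=> c0; have [Mu|Mu] := boolP (M \in unitmx).
  by apply/pgl_eq; rewrite ?unitmxZ ?unitfE //; exists c.
congr (\pi _); rewrite /insubd !insubF //; first exact/negbTE.
by apply/negbTE; rewrite unitmxZ ?unitfE.
Qed.

Lemma pglM1 M N : M *m N = 1%:M -> (pgl M * pgl N = 1)%g.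
Proof. by move=> MN; have [Mu Nu] := mulmx1_unit MN; rewrite -pglM // MN pgl1. Qed.

End ProjectiveClasses.

Lemma unitary_pgl (K : fieldType) (theta : {rmorphism K -> K}) (M : 'M[K]_3) :
  M \in unitmx -> unitary theta (pgl M) =
  pgl (antidiag K *m (map_mx theta (invmx M))^T *m antidiag K).
Proof.
move=> Mu; rewrite /pgl -pi_unitary; congr (\pi _); apply: val_inj.
rewrite /= !val_pgl // !unitmx_mul antidiag_unit unitmx_tr map_unitmx.
by rewrite unitmx_inv Mu.
Qed.

Section Iwahori.
Variable k : fieldType.
Local Notation L := (laurent k).
Implicit Types (M N : 'M[L]_3) (g h : U3 k) (x y : iwahori_weyl).

(** The boolean [i < j], read as 0 or 1, merges integrality with vanishing modulo ε above the
    diagonal. *)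
Definition iwmx M : Prop := forall i j : 'I_3, vge (i < j)%N (M i j).

Lemma iwmx1 : iwmx 1%:M.
Proof.
move=> i j; rewrite mxE; have [->|_] := eqVneq i j; last exact: vge0.
by rewrite ltnn; apply: vge_const.
Qed.

Lemma iwmxM M N : iwmx M -> iwmx N -> iwmx (M *m N).
Proof.
move=> hM hN i j; rewrite mxE; apply: vge_sum => l _.
by apply: vge_le (vgeM (hM i l) (hN l j)); lia.
Qed.

Lemma lcoef0M (f g : L) : vge 0 f -> vge 0 g -> (f * g) 0 = f 0 * g 0.
Proof. by move=> f0 g0; rewrite -[X in lcoef _ X]addr0 lcoefM_lead. Qed.

Lemma lcoef_sum (I : Type) (r : seq I) (P : pred I) (F : I -> L) n :
  lcoef (\sum_(i <- r | P i) F i) n = \sum_(i <- r | P i) F i n.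
Proof. by apply: (big_morph (fun f : L => f n)). Qed.

Lemma residue_mul M N i j : (forall i j, vge 0 (M i j)) ->
  (forall i j, vge 0 (N i j)) -> (M *m N) i j 0 = \sum_l M i l 0 * N l j 0.
Proof. by move=> hM hN; rewrite mxE lcoef_sum; apply: eq_bigr => l _; apply: lcoef0M. Qed.

Lemma sum3 (V : zmodType) (F : 'I_3 -> V) : \sum_i F i = F 0 + F 1 + F 2.
Proof.
rewrite !big_ord_recl big_ord0 addr0 addrA.
by congr (F _ + F _ + F _); apply: val_inj.
Qed.

(** Modulo ε the matrix M is lower triangular with nonzero diagonal residues, and comparing the
    entries of M N = 1 kills the residues of N above the diagonal one after the other. *)
Lemma iwmx_inv M N : M *m N = 1%:M -> iwmx M -> (forall i j, vge 0 (N i j)) -> iwmx N.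
Proof.
move=> MN hM hN; have hM0 i j : vge 0 (M i j) by apply: vge_le (hM i j); lia.
have M01 : M 0 1 0 = 0 by apply: (hM 0 1).
have M02 : M 0 2 0 = 0 by apply: (hM 0 2).
have M12 : M 1 2 0 = 0 by apply: (hM 1 2).
have R i j : \sum_l M i l 0 * N l j 0 = (i == j)%:R.
  rewrite -(residue_mul i j hM0 hN) MN mxE.
  by case: (i == j); rewrite /= ?mulr1n ?mulr0n.
have R00 : M 0 0 0 * N 0 0 0 = 1.
  by have := R 0 0; rewrite sum3 M01 M02 !mul0r !addr0.
have M00 : M 0 0 0 != 0 by apply/eqP => e; move/eqP: R00; rewrite e mul0r eq_sym oner_eq0.
have N01 : N 0 1 0 = 0.
  have := R 0 1; rewrite sum3 M01 M02 !mul0r !addr0 /= => /eqP.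
  by rewrite mulf_eq0 (negbTE M00) => /eqP.
have N02 : N 0 2 0 = 0.
  have := R 0 2; rewrite sum3 M01 M02 !mul0r !addr0 /= => /eqP.
  by rewrite mulf_eq0 (negbTE M00) => /eqP.
have R11 : M 1 1 0 * N 1 1 0 = 1.
  by have := R 1 1; rewrite sum3 N01 M12 mul0r mulr0 addr0 add0r.
have M11 : M 1 1 0 != 0 by apply/eqP => e; move/eqP: R11; rewrite e mul0r eq_sym oner_eq0.
have N12 : N 1 2 0 = 0.
  have := R 1 2; rewrite sum3 N02 M12 mul0r mulr0 addr0 add0r /= => /eqP.
  by rewrite mulf_eq0 (negbTE M11) => /eqP.
move=> i j; have := vgeS (hN i j); rewrite add0r => S.
by move: i j S; do 2![apply: ord3P] => S; first [exact: (hN _ _)|exact: S].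
Qed.

Lemma iwahoriP g : iwahori g <->
  exists M N, [/\ M *m N = 1%:M, iwmx M, iwmx N & g = pgl M].
Proof.
split=> [[A [h1 h2 h3] <-]|[M [N [MN hM hN ->]]]].
  have hA : iwmx (val A).
    move=> i j; have [ij|ij] := boolP (i < j)%N; last by move=> m m0; apply: h1.
    by move=> m m0; apply: h3 => //; lia.
  exists (val A), (invmx (val A)); split; rewrite ?mulmxV ?(valP A) ?pgl_val //.
  apply: (iwmx_inv _ hA h2); by rewrite mulmxV // (valP A).
have [Mu Nu] := mulmx1_unit MN.
exists (insubd GLone M) => //; split; rewrite val_pgl //.
- by move=> i j m m0; apply: hM; lia.
- by move=> i j m m0; rewrite (invmx_uniq MN); apply: hN; lia.
by move=> i j ij m m0; apply: hM; rewrite ij; lia.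
Qed.

Lemma iwahori_pgl M N : M *m N = 1%:M -> iwmx M -> iwmx N -> iwahori (pgl M).
Proof. by move=> MN hM hN; apply/iwahoriP; exists M, N. Qed.

Lemma iwahori1 : iwahori (1%g : U3 k).
Proof. by rewrite -pgl1; apply: iwahori_pgl iwmx1 iwmx1; rewrite mulmx1. Qed.

Lemma iwahoriM g h : iwahori g -> iwahori h -> iwahori (g * h)%g.
Proof.
move=> /iwahoriP[M [M' [e hM hM' ->]]] /iwahoriP[N [N' [f hN hN' ->]]].
have [[Mu Mu'] [Nu Nu']] := (mulmx1_unit e, mulmx1_unit f).
rewrite -pglM //; apply: (@iwahori_pgl _ (N' *m M')); try exact: iwmxM.
by rewrite mulmxA -(mulmxA M) f mulmx1.
Qed.

Lemma iwahoriV g : iwahori g -> iwahori (g^-1)%g.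
Proof.
move=> /iwahoriP[M [M' [e hM hM' ->]]].
rewrite -[_^-1%g]mul1g -(pglM1 (mulmx1C e)) -mulgA mulgV mulg1.
by apply: iwahori_pgl hM' hM; rewrite mulmx1C.
Qed.

End Iwahori.

(** * Lifts of Iwahori-Weyl elements and the exchange relation for s1 *)

Section BruhatCells.
Variable k : fieldType.
Local Notation L := (laurent k).
Local Notation iw := (@iw_lift k).
Implicit Types (M N : 'M[L]_3) (g h : U3 k) (x y : iwahori_weyl).

Definition eps_wt x i : L := eps k ^ coweight_lift (trans x) i.

Lemma eps_wt_neq0 x i : eps_wt x i != 0.
Proof. by rewrite expfz_neq0 // eps_neq0. Qed.

Definition iwM x : 'M[L]_3 := diag_mx (\row_i eps_wt x i) *m perm_mx (lin x).

Lemma iwM_unit x : iwM x \in unitmx.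
Proof. exact: iw_GL_subproof. Qed.

Lemma iw_pgl x : iw x = pgl (iwM x).
Proof. by rewrite /iw_lift -pgl_val. Qed.

Lemma iwM_mul x M i j : (iwM x *m M) i j = eps_wt x i * M (lin x i) j.
Proof.
by rewrite -mulmxA mul_diag_mx mxE mxE -row_permE mxE.
Qed.

Lemma iwME x i j : iwM x i j = eps_wt x i * (lin x i == j)%:R.
Proof. by rewrite -[iwM x]mulmx1 iwM_mul mxE. Qed.

Lemma iw_liftM x y : iw (x * y)%g = (iw x * iw y)%g.
Proof.
transitivity (pgl (iwM x *m iwM y)); last first.
  by rewrite (iw_pgl x) (iw_pgl y); apply: pglM; apply: iwM_unit.
(* [coweight_lift] normalises its last coordinate to 0, so products of lifts are lifts only up to a
   power of ε. The last row reveals which one. *)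
rewrite iw_pgl; transitivity (pgl (eps_wt y (lin x 2) *: iwM (x * y)%g)).
  exact/esym/pglZ/eps_wt_neq0.
congr pgl; apply/matrixP => i j; rewrite iwM_mul mxE !iwME /= permM !mulrA.
congr (_ * _); rewrite /eps_wt -(expfzDr _ _ (eps_neq0 k)) -(expfzDr _ _ (eps_neq0 k)).
congr (_ ^ _).
by rewrite coweight_liftD /coweight_act coweight_lift_of addrCA [X in _ + X]addrC subrK.
Qed.

Lemma iw_lift1 : iw 1%g = 1%g.
Proof.
rewrite iw_pgl -pgl1; congr pgl; apply/matrixP => i j.
rewrite iwME mxE perm1 /eps_wt (_ : coweight_lift _ _ = 0) ?expr0z ?mul1r //.
by move: i; apply: ord3P.
Qed.

Lemma iw_liftV x : iw (x^-1)%g = ((iw x)^-1)%g.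
Proof. by apply: (mulgI (iw x)); rewrite -iw_liftM !mulgV iw_lift1. Qed.

(** Conjugation by [iwM x], written entrywise so that valuations can be read off. *)
Definition conjM x M : 'M[L]_3 :=
  \matrix_(i, j) (eps k ^ (coweight_lift (trans x) i - coweight_lift (trans x) j)
                  * M (lin x i) (lin x j)).

Lemma conjMM x M N : conjM x M *m conjM x N = conjM x (M *m N).
Proof.
apply/matrixP => i j; rewrite !mxE [in RHS](reindex_inj (@perm_inj _ (lin x))) mulr_sumr.
apply: eq_bigr => l _; rewrite !mxE mulrACA -expfzDr ?eps_neq0 //.
by rewrite addrA subrK.
Qed.

Lemma conjM1 x : conjM x 1%:M = 1%:M.
Proof.
apply/matrixP => i j; rewrite !mxE (inj_eq perm_inj).
have [->|_] := eqVneq i j; last by rewrite mulr0.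
by rewrite subrr expr0z mulr1.
Qed.

Lemma conjM_iwM x M : conjM x M *m iwM x = iwM x *m M.
Proof.
apply/matrixP => i j; rewrite iwM_mul mxE (bigD1 ((lin x)^-1%g j)) //=.
rewrite big1 ?addr0 => [|l lj]; last first.
  rewrite iwME (_ : (_ == j) = false) ?mulr0 //.
  by apply/negbTE; apply: contra lj => /eqP <-; rewrite permK.
rewrite iwME mxE permKV eqxx mulr1 mulrAC /eps_wt -expfzDr ?eps_neq0 //.
by rewrite subrK.
Qed.

Lemma iw_conj x M N : M *m N = 1%:M ->
  (iw x * pgl M * (iw x)^-1)%g = pgl (conjM x M).
Proof.
move=> MN; have [Mu _] := mulmx1_unit MN.
have [Cu _] : conjM x M \in unitmx /\ conjM x N \in unitmx.
  by apply: mulmx1_unit; rewrite conjMM MN conjM1.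
apply: (mulIg (iw x)); rewrite mulgVK (iw_pgl x).
by rewrite -(pglM (iwM_unit x) Mu) -(pglM Cu (iwM_unit x)) conjM_iwM.
Qed.

Lemma vge_conjM n x M i j :
  vge n (conjM x M i j) <->
  vge (n - (coweight_lift (trans x) i - coweight_lift (trans x) j)) (M (lin x i) (lin x j)).
Proof. by rewrite mxE; split => /vge_epsM. Qed.

(** Elements of length 0 stabilise the base alcove, hence normalise the Iwahori subgroup. *)
Lemma iwmx_conj x M : len x = 0%N -> iwmx M -> iwmx (conjM x M).
Proof.
move=> x0 hM i j; apply/vge_conjM; apply: vge_le (hM _ _).
move: x0; rewrite /len; case: x => [[a b] v] /=.
move: i j; do 2![apply: ord3P]; rewrite /coweight_lift /=;
  by case: (perm3P v) => /=; lia.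
Qed.

Lemma iwahori_conj x g : len x = 0%N -> iwahori g -> iwahori (iw x * g * (iw x)^-1)%g.
Proof.
move=> x0 /iwahoriP[M [N [MN hM hN ->]]]; rewrite (iw_conj x MN).
apply: (@iwahori_pgl _ _ (conjM x N)); try exact: iwmx_conj.
by rewrite conjMM MN conjM1.
Qed.

Definition elmx (i j : 'I_3) (f : L) : 'M[L]_3 := 1%:M + f *: delta_mx i j.

Lemma elmxE i j f a b : elmx i j f a b = (a == b)%:R + f * ((a == i) && (b == j))%:R.
Proof. by rewrite !mxE. Qed.

Lemma elmxM i j (f g : L) : i != j -> elmx i j f *m elmx i j g = elmx i j (f + g).
Proof.
move=> ij; rewrite /elmx mulmxDl mul1mx mulmxDr mulmx1 -scalemxAr -scalemxAl.
by rewrite mul_delta_mx_cond eq_sym (negbTE ij) mulr0n !scaler0 addr0 scalerDl -addrA [g *: _ + _]addrC.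
Qed.

Lemma elmx0 i j : elmx i j 0 = 1%:M.
Proof. by rewrite /elmx scale0r addr0. Qed.

Lemma elmxK i j f : i != j -> elmx i j f *m elmx i j (- f) = 1%:M.
Proof. by move=> ij; rewrite elmxM // subrr elmx0. Qed.

Lemma iwmx_elmx (i j : 'I_3) f : vge (i < j)%N f -> iwmx (elmx i j f).
Proof.
move=> hf a b; rewrite elmxE; apply: vgeD.
  by have := @iwmx1 k a b; rewrite mxE.
have [/andP[/eqP -> /eqP ->]|_] := boolP (_ && _); first by rewrite mulr1.
by rewrite mulr0; apply: vge0.
Qed.

Lemma iwahori_elmx (i j : 'I_3) f : i != j -> vge (i < j)%N f -> iwahori (pgl (elmx i j f)).
Proof.
move=> ij hf; apply: (iwahori_pgl (elmxK f ij)); apply: iwmx_elmx => //.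
exact: vgeN.
Qed.

Lemma conjM_elmx x i j f : i != j -> conjM x (elmx (lin x i) (lin x j) f) =
  elmx i j (eps k ^ (coweight_lift (trans x) i - coweight_lift (trans x) j) * f).
Proof.
move=> ij; apply/matrixP => a b; rewrite elmxE mxE elmxE !(inj_eq perm_inj).
rewrite mulrDr; congr (_ + _).
  have [->|_] := eqVneq a b; last by rewrite mulr0.
  by rewrite subrr expr0z mulr1.
by have [/andP[/eqP -> /eqP ->]|_] := boolP (_ && _); rewrite mulrA ?mulr0.
Qed.

(** The root subgroup of the simple root of s1; positive roots sit below the diagonal because the
    Iwahori subgroup is lower triangular modulo ε. *)
Definition u1 (c : k) : U3 k := pgl (elmx 1 0 (lconst c)).

Lemma iwahori_u1 c : iwahori (u1 c).
Proof. by apply: iwahori_elmx => //; apply: vge_const. Qed.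

(** Only the residue of the entry (1, 0) keeps an Iwahori element from staying in I after
    conjugation by s1. Subtracting c times column 1 from column 0, with c the quotient of the
    residues of [M 1 0] and [M 1 1], removes it. *)
Lemma iwahori_decomp g : iwahori g -> exists h c,
  [/\ g = (h * u1 c)%g, iwahori h & iwahori (iw s1 * h * (iw s1)^-1)%g].
Proof.
move=> /iwahoriP[M [N [MN hM hN ->]]].
have hM0 i j : vge 0 (M i j) by apply: vge_le (hM i j); lia.
have hN0 i j : vge 0 (N i j) by apply: vge_le (hN i j); lia.
have R i j : \sum_l M i l 0 * N l j 0 = (i == j)%:R.
  rewrite -(residue_mul i j hM0 hN0) MN mxE.
  by case: (i == j); rewrite /= ?mulr1n ?mulr0n.
have M12 : M 1 2 0 = 0 by apply: (hM 1 2).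
have N01 : N 0 1 0 = 0 by apply: (hN 0 1).
have R10 := R 1 0; rewrite sum3 M12 mul0r addr0 /= in R10.
have R11 := R 1 1; rewrite sum3 M12 N01 mul0r mulr0 addr0 add0r /= in R11.
have M11 : M 1 1 0 != 0 by apply/eqP => e; move/eqP: R11; rewrite e mul0r eq_sym oner_eq0.
pose c := M 1 0 0 / M 1 1 0.
have c01 : (1 : 'I_3) != 0 by [].
pose H := M *m elmx 1 0 (- lconst c); pose H' := elmx 1 0 (lconst c) *m N.
have HH' : H *m H' = 1%:M.
  by rewrite /H /H' mulmxA -(mulmxA M) elmxM // addNr elmx0 mulmx1.
have hE f : vge 0 f -> iwmx (elmx 1 0 f) by move=> f0; apply: iwmx_elmx.
have cH : iwmx H by apply: iwmxM => //; apply/hE/vgeN/vge_const.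
have cH' : iwmx H' by apply: iwmxM => //; apply/hE/vge_const.
have H10 : vge 1 (H 1 0).
  have -> : H 1 0 = M 1 0 - lconst c * M 1 1.
    rewrite mxE sum3 !elmxE /= !(mulr0, mulr1, addr0, add0r).
    by rewrite mulrN mulrC.
  rewrite -[1]add0r; apply: vgeS.
    apply: vgeB => //; rewrite -[0]addr0; apply: vgeM => //; exact: vge_const.
  have -> (p q : L) : (p - q) 0 = p 0 - q 0 by [].
  by rewrite lcoef_constM divfK // subrr.
have H'10 : vge 1 (H' 1 0).
  have -> : H' 1 0 = N 1 0 + lconst c * N 0 0.
    rewrite mxE sum3 !elmxE /= !(mulr0, mulr1, addr0, add0r, mul0r, mul1r).
    by rewrite addrC.
  rewrite -[1]add0r; apply: vgeS.
    apply: vgeD => //; rewrite -[0]addr0; apply: vgeM => //; exact: vge_const.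
  have -> (p q : L) : (p + q) 0 = p 0 + q 0 by [].
  rewrite lcoef_constM /c; apply: (mulfI M11).
  by rewrite mulrDr mulrA (mulrC _ (_ / _)) divfK // addrC R10 mulr0.
have S1 G : iwmx G -> vge 1 (G 1 0) -> iwmx (conjM s1 G).
  have l0 i : coweight_lift (trans s1) i = 0 by move: i; apply: ord3P.
  move=> hG G10 i j; apply/vge_conjM; rewrite !l0 !subr0.
  have [[-> ->]|ij] : (i = 0 /\ j = 1) \/ ~ (i = 0 /\ j = 1) by exact: EM.
    by rewrite /= !permE3.
  apply: vge_le (hG _ _); move: i j ij.
  by do 2![apply: ord3P]; rewrite /= ?permE3 //= => -[].
have [[Hu H'u] [Eu _]] := (mulmx1_unit HH', mulmx1_unit (elmxK (lconst c) c01)).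
exists (pgl H), c; split.
- by rewrite -pglM // -mulmxA elmxM // addNr elmx0 mulmx1.
- exact: iwahori_pgl HH' cH cH'.
rewrite (iw_conj _ HH'); apply: (@iwahori_pgl _ _ (conjM s1 H')); try exact: S1.
by rewrite conjMM HH' conjM1.
Qed.

(** Moving the root element past x multiplies its entry by a power of ε; the length condition says
    exactly that the exponent is large enough for the new position. *)
Lemma u1_iw c x : (len x < len (s1 * x)%g)%N ->
  exists2 h, iwahori h & (u1 c * iw x = iw x * h)%g.
Proof.
rewrite len_s1M_gt => x1; have c01 : (1 : 'I_3) != 0 by [].
pose f := lconst c * eps k ^ (trans x).1.
have vij : lin x 1 != lin x 0 by rewrite (inj_eq perm_inj).
exists (pgl (elmx (lin x 1) (lin x 0) f)).
  apply: iwahori_elmx => //; rewrite /f mulrC; apply/vge_epsM.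
  by apply: vge_le (vge_const _); lia.
apply: (mulIg (iw x)^-1%g); rewrite mulgK (iw_conj _ (elmxK f vij)).
rewrite (conjM_elmx _ _ c01) /f mulrCA -(expfzDr _ _ (eps_neq0 k)).
have -> : coweight_lift (trans x) 1 - coweight_lift (trans x) 0 + (trans x).1 = 0.
  by rewrite /coweight_lift /=; lia.
by rewrite expr0z mulr1.
Qed.

Lemma cell_s1 x g : (len x < len (s1 * x)%g)%N -> iwahori g ->
  exists h h', [/\ iwahori h, iwahori h' & (iw s1 * g * iw x = h * iw (s1 * x)%g * h')%g].
Proof.
move=> x1 /iwahori_decomp[h [c [-> hh sh]]]; have [h' ih' e] := u1_iw c x1.
exists (iw s1 * h * (iw s1)^-1)%g, h'; split=> //.
by rewrite -!mulgA e iw_liftM !mulgA mulgVK.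
Qed.

End BruhatCells.

Section SimpleCells.
Variable k : fieldType.
Local Notation L := (laurent k).
Local Notation iw := (@iw_lift k).
Local Notation cell := (@double_coset k).
Implicit Types (M N : 'M[L]_3) (g h : U3 k) (x y : iwahori_weyl).

Lemma cell_iw w : cell w (iw w).
Proof.
by exists 1%g, 1%g; split; [exact: iwahori1|exact: iwahori1|rewrite mul1g mulg1].
Qed.

Lemma cellMl w g h : iwahori g -> cell w h -> cell w (g * h)%g.
Proof.
move=> ig [a [b [ia ib ->]]]; exists (g * a)%g, b; split; rewrite ?mulgA //.
exact: iwahoriM.
Qed.

Lemma cellMr w g h : iwahori g -> cell w h -> cell w (h * g)%g.
Proof.
move=> ig [a [b [ia ib ->]]]; exists a, (b * g)%g; split; rewrite ?mulgA //.
exact: iwahoriM.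
Qed.

Lemma cellV w g : cell w g -> cell (w^-1)%g (g^-1)%g.
Proof.
move=> [a [b [ia ib ->]]]; exists (b^-1)%g, (a^-1)%g; split; try exact: iwahoriV.
by rewrite !invMg iw_liftV mulgA.
Qed.

(** This lets every rank one computation be done for s1 alone, since powers of [tau] normalise I. *)
Lemma simple_tau i : exists j, simple_reflection i = (tau ^+ j * s1 * tau ^- j)%g.
Proof.
move: i; apply: ord3P; rewrite /simple_reflection /=.
- exists 2%N; transitivity (tau * (tau * s1 * tau^-1) * tau^-1)%g.
    by rewrite tau_s1 tau_s2.
  by move: tau s1 => t s; rewrite expgS expg1 invMg !mulgA.
- by exists 0%N; rewrite expg0 mul1g invg1 mulg1.
by exists 1%N; rewrite expg1 tau_s1.
Qed.

Lemma iw_tau_conj j g : iwahori g -> iwahori (iw (tau ^+ j)%g * g * (iw (tau ^+ j)%g)^-1)%g.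
Proof. by move=> ig; apply: iwahori_conj; rewrite ?len_tauX. Qed.

Lemma iw_tauV_conj j g : iwahori g -> iwahori ((iw (tau ^+ j)%g)^-1 * g * iw (tau ^+ j)%g)%g.
Proof.
move=> ig; rewrite -iw_liftV tauXV -[X in (_ * _ * X)%g]invgK -iw_liftV tauXV.
exact: iw_tau_conj.
Qed.

Lemma cell_simple i x g : (len x < len (simple_reflection i * x)%g)%N -> iwahori g ->
  cell (simple_reflection i * x)%g (iw (simple_reflection i) * g * iw x)%g.
Proof.
have [j ->] := simple_tau i; set t := (tau ^+ j)%g => xl ig.
have tl y : len (t^-1 * y)%g = len y by rewrite tauXV len_tauXM.
have xl' : (len (t^-1 * x)%g < len (s1 * (t^-1 * x))%g)%N.
  have -> : (s1 * (t^-1 * x) = t^-1 * (t * s1 * t^-1 * x))%g.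
    by rewrite !mulgA mulVg mul1g.
  by rewrite !tl.
have [a [b [ia ib e]]] := cell_s1 xl' (iw_tauV_conj j ig).
exists (iw t * a * (iw t)^-1)%g, b; split=> //; first exact: iw_tau_conj.
move: e; rewrite !iw_liftM !iw_liftV -/t => e.
transitivity (iw t * (iw s1 * ((iw t)^-1 * g * iw t) * ((iw t)^-1 * iw x)))%g.
  by rewrite !mulgA mulgK.
by rewrite e !mulgA mulgVK.
Qed.

Lemma cell_sM i x g h : (len x < len (simple_reflection i * x)%g)%N -> iwahori g ->
  cell x h -> cell (simple_reflection i * x)%g (iw (simple_reflection i) * g * h)%g.
Proof.
move=> xl ig [a [b [ia ib ->]]]; rewrite !mulgA; apply: cellMr => //.
by rewrite -(mulgA _ g); apply: cell_simple => //; apply: iwahoriM.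
Qed.

Lemma cell_Ms i x g h : (len x < len (x * simple_reflection i)%g)%N -> iwahori g ->
  cell x h -> cell (x * simple_reflection i)%g (h * g * iw (simple_reflection i))%g.
Proof.
move=> xl ig /cellV hx.
have xl' : (len (x^-1)%g < len (simple_reflection i * x^-1)%g)%N.
  by rewrite -(len_inv (_ * _)%g) invMg simpleV invgK len_inv.
have := cellV (cell_sM xl' (iwahoriV ig) hx).
by rewrite !invMg -iw_liftV !invgK simpleV mulgA.
Qed.

(** The root subgroups of the three simple affine roots; the affine one sits above the diagonal and
    therefore carries a factor ε. *)
Definition root_elt (i : 'I_3) (c : k) : U3 k :=
  nth 1%g [:: pgl (elmx 0 2 (eps k * lconst c)); pgl (elmx 1 0 (lconst c));
              pgl (elmx 2 1 (lconst c))] i.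

(** In PGL_3 the integral matrix M agrees with the elementary one only up to a scalar c. A diagonal
    entry of the inverse shows that c is integral, and f is c times an entry of M. *)
Lemma iwahori_elmx_vge (i j l : 'I_3) (f : L) : l != i -> i != j ->
  iwahori (pgl (elmx i j f)) -> vge (i < j)%N f.
Proof.
move=> li ij /iwahoriP[M [N [MN hM hN]]].
have [[Mu _] [Eu _]] := (mulmx1_unit MN, mulmx1_unit (elmxK f ij)).
case/(pgl_eq Eu Mu) => c c0 e.
have cM a b : elmx i j f a b = c * M a b by rewrite e mxE.
have cN a b : N a b = c * elmx i j (- f) a b.
  suff -> : N = c *: elmx i j (- f) by rewrite mxE.
  rewrite -[RHS]mul1mx -(mulmx1C MN) -mulmxA -scalemxAr scalemxAl -e elmxK //.
  by rewrite mulmx1.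
have cE : c = N l l.
  by rewrite cN elmxE eqxx (negbTE li) mulr0 addr0 mulr1.
have -> : f = c * M i j.
  by rewrite -cM elmxE (negbTE ij) !eqxx mulr1 add0r.
rewrite -[_%:Z]add0r cE; apply: vgeM; last exact: hM.
by apply: vge_le (hN l l); lia.
Qed.

End SimpleCells.

Lemma conj_mulg (G : groupType) (a h u : G) :
  (a * (h * u) * a^-1 = (a * h * a^-1) * (a * u * a^-1))%g.
Proof. by rewrite !mulgA mulgVK. Qed.

Lemma conj_conjg (G : groupType) (t s g : G) :
  (t * s * t^-1 * g * (t * s * t^-1)^-1 = t * (s * (t^-1 * g * t) * s^-1) * t^-1)%g.
Proof. by rewrite !invMg !invgK !mulgA. Qed.

Lemma conj_mul3g (G : groupType) (t a s b : G) :
  (t * (a * s * b) * t^-1 = t * a * t^-1 * (t * s * t^-1) * (t * b * t^-1))%g.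
Proof. by rewrite !mulgA !mulgVK. Qed.

Section RankOne.
Variable k : fieldType.
Local Notation L := (laurent k).
Local Notation iw := (@iw_lift k).
Local Notation cell := (@double_coset k).
Implicit Types (g h : U3 k) (x y : iwahori_weyl).

Lemma iw_simpleV i : ((iw (simple_reflection i))^-1 = iw (simple_reflection i))%g.
Proof. by rewrite -iw_liftV simpleV. Qed.

Lemma iw_s1_lift i : coweight_lift (trans s1) i = 0.
Proof. by move: i; apply: ord3P. Qed.

Lemma s1_u1 (c : k) : (iw s1 * u1 c * (iw s1)^-1)%g = pgl (elmx 0 1 (lconst c)).
Proof.
have ij : (0 : 'I_3) != 1 by []; have ji : (1 : 'I_3) != 0 by [].
rewrite /u1 (iw_conj _ (elmxK (lconst c) ji)); congr pgl.
have -> : elmx 1 0 (lconst c) = elmx (lin s1 0) (lin s1 1) (lconst c).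
  by rewrite /= !permE3.
by rewrite conjM_elmx // !iw_s1_lift subr0 expr0z mul1r.
Qed.

Definition rank1_diag (f d : L) : 'M[L]_3 :=
  \matrix_(i, j) (nth 0 [:: f; - d; 1] i * (i == j)%:R).

Lemma rank1_diagK f d : f * d = 1 -> rank1_diag f d *m rank1_diag d f = 1%:M.
Proof.
move=> fd; have df : d * f = 1 by rewrite mulrC.
apply/matrixP => i j; rewrite !mxE sum3 !mxE.
by move: i j; do 2![apply: ord3P]; rewrite /= !(mulr0, mulr1, mul0r, addr0, add0r) ?mulrNN.
Qed.

(** The big-cell factorisation of an upper unipotent matrix in GL_2, placed in the upper left
    block. *)
Lemma elmx01_factor f d : f * d = 1 ->
  elmx 0 1 f = elmx 1 0 d *m rank1_diag f d *m iwM k s1 *m elmx 1 0 d.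
Proof.
move=> fd; have df : d * f = 1 by rewrite mulrC.
have eps_wt1 i : eps_wt k s1 i = 1 by rewrite /eps_wt iw_s1_lift.
have e1 : elmx 1 0 d *m rank1_diag f d =
    \matrix_(i, j) (if (i == 1) && (j == 0) then 1 else rank1_diag f d i j).
  apply/matrixP => i j; rewrite !mxE sum3 !elmxE !mxE.
  by move: i j; do 2![apply: ord3P]; rewrite /= !(mulr0, mulr1, mul0r, mul1r, addr0, add0r).
have e2 : iwM k s1 *m elmx 1 0 d = \matrix_(i, j) elmx 1 0 d (lin s1 i) j.
  by apply/matrixP => i j; rewrite iwM_mul [RHS]mxE eps_wt1 mul1r.
rewrite -[RHS]mulmxA e1 e2; apply/matrixP => i j; rewrite elmxE [RHS]mxE sum3 !mxE.
by move: i j; do 2![apply: ord3P]; rewrite /= ?permE3 /=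
  !(mulr0, mulr1, mul0r, mul1r, addr0, add0r) ?mulNr ?fd ?df ?subrr.
Qed.

Lemma cell_elmx01 (c : k) : c != 0 -> cell s1 (pgl (elmx 0 1 (lconst c))).
Proof.
move=> c0; pose d := lconst c^-1; pose f := lconst c.
have fd : f * d = 1 by rewrite -rmorphM mulfV // rmorph1.
have df : d * f = 1 by rewrite mulrC.
have hD (p q : k) : iwmx (rank1_diag (lconst p) (lconst q)).
  move=> i j; rewrite mxE; have [->|_] := eqVneq i j; last by rewrite mulr0.
  rewrite mulr1 ltnn; move: j; apply: ord3P => /=; first exact: vge_const.
    exact/vgeN/vge_const.
  by have := @vge_const k 1; rewrite rmorph1.
have ji : (1 : 'I_3) != 0 by [].
have DD := rank1_diagK fd.
have [[eu _] [Du _]] := (mulmx1_unit (elmxK d ji), mulmx1_unit DD).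
exists (u1 c^-1 * pgl (rank1_diag f d))%g, (u1 c^-1); split.
- apply: iwahoriM; first exact: iwahori_u1.
  by apply: (iwahori_pgl DD); apply: hD.
- exact: iwahori_u1.
have su := iwM_unit k s1.
rewrite (elmx01_factor fd) (iw_pgl k s1) /u1 -/d -(pglM eu Du).
have u2 : elmx 1 0 d *m rank1_diag f d \in unitmx by rewrite unitmx_mul eu Du.
rewrite -(pglM u2 su).
have u3 : elmx 1 0 d *m rank1_diag f d *m iwM k s1 \in unitmx.
  by rewrite unitmx_mul u2 su.
by rewrite -(pglM u3 eu).
Qed.

(** After splitting off the part that s_i keeps in I, one constant c remains: it gives I when c = 0
    and the big cell otherwise. *)
Lemma simple_cellP i g : iwahori g ->
  iwahori (iw (simple_reflection i) * g * iw (simple_reflection i))%g \/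
  cell (simple_reflection i) (iw (simple_reflection i) * g * iw (simple_reflection i))%g.
Proof.
rewrite -{2 4}iw_simpleV; have [j ->] := simple_tau i; set t := (tau ^+ j)%g => ig.
have [h [c [e ih sh]]] := iwahori_decomp (iw_tauV_conj j ig).
rewrite -/t in e.
have E : (iw (t * s1 * t^-1) * g * (iw (t * s1 * t^-1))^-1 =
  iw t * (iw s1 * ((iw t)^-1 * g * iw t) * (iw s1)^-1) * (iw t)^-1)%g.
  by rewrite !iw_liftM !iw_liftV conj_conjg.
rewrite E e {E}.
have -> : (iw s1 * (h * u1 c) * (iw s1)^-1 =
  (iw s1 * h * (iw s1)^-1) * pgl (elmx 0 1 (lconst c))%R)%g.
  by rewrite -(s1_u1 c) conj_mulg.
have [->|c0] := eqVneq c 0.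
  left; rewrite rmorph0 elmx0 pgl1 mulg1; exact: iw_tau_conj.
right; have [a [b [ia ib ->]]] := cellMl sh (cell_elmx01 c0).
exists (iw t * a * (iw t)^-1)%g, (iw t * b * (iw t)^-1)%g; split; try exact: iw_tau_conj.
by rewrite !iw_liftM !iw_liftV conj_mul3g.
Qed.

Lemma root_elt_iwahori i c : iwahori (root_elt i c : U3 k).
Proof.
move: i; apply: ord3P; rewrite /root_elt /=; apply: iwahori_elmx => //; try exact: vge_const.
by apply/(@vge_epsM _ 1); exact: vge_const.
Qed.

Lemma root_elt_conj i (c : k) : c != 0 ->
  ~ iwahori (iw (simple_reflection i) * root_elt i c * iw (simple_reflection i))%g.
Proof.
move=> c0; rewrite -{2}iw_simpleV.
have nc (n : int) : 0 < n -> ~ vge n (lconst c).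
  by move=> n0 /(_ 0 n0) /= /eqP; rewrite (negbTE c0).
move: i; apply: ord3P; rewrite /root_elt /simple_reflection /=.
- have ij : (0 : 'I_3) != 2 by []; have ji : (2 : 'I_3) != 0 by [].
  rewrite (iw_conj _ (elmxK (eps k * lconst c) ij)).
  have -> : elmx 0 2 (eps k * lconst c) = elmx (lin s0 2) (lin s0 0) (eps k * lconst c).
    by rewrite s0E /= !permE3.
  rewrite conjM_elmx // s0E.
  by move=> /(@iwahori_elmx_vge _ 2 0 1 _ isT ji) /vge_epsM /(@vge_epsM _ 1); apply: nc.
- have ij : (1 : 'I_3) != 0 by []; have ji : (0 : 'I_3) != 1 by [].
  rewrite (iw_conj _ (elmxK (lconst c) ij)).
  have -> : elmx 1 0 (lconst c) = elmx (lin s1 0) (lin s1 1) (lconst c).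
    by rewrite /= !permE3.
  rewrite conjM_elmx // => /(@iwahori_elmx_vge _ 0 1 2 _ isT ji) /= /vge_epsM.
  by apply: nc; rewrite /coweight_lift /=.
have ij : (2 : 'I_3) != 1 by []; have ji : (1 : 'I_3) != 2 by [].
rewrite (iw_conj _ (elmxK (lconst c) ij)).
have -> : elmx 2 1 (lconst c) = elmx (lin s2 1) (lin s2 2) (lconst c).
  by rewrite /= !permE3.
rewrite conjM_elmx // => /(@iwahori_elmx_vge _ 1 2 0 _ isT ji) /= /vge_epsM.
by apply: nc; rewrite /coweight_lift /=.
Qed.

End RankOne.

(** * Double cosets meeting the sigma-conjugacy class of 1 *)

Lemma twisted_conj_mulg (G : groupType) (f : G -> G) (fM : forall a b, f (a * b)%g = (f a * f b)%g)
  (g y : G) : (y * (g^-1 * f g) * (f y)^-1 = (g * y^-1)^-1 * f (g * y^-1))%g.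
Proof.
have f1 : f 1%g = 1%g by apply: (mulgI (f 1%g)); rewrite -fM !mulg1.
have fV a : f (a^-1)%g = ((f a)^-1)%g by apply: (mulgI (f a)); rewrite -fM !mulgV.
by rewrite fM fV invMg invgK !mulgA.
Qed.

Lemma conj_quotg (G : groupType) (a j p : G) : (a^-1 = a ->
  (a * (j * p^-1) * a)^-1 * (a * j * a) = a * p * a)%g.
Proof. by move=> aV; rewrite !invMg invgK !mulgA !mulgVK aV. Qed.

Section Frobenius.
Variables (Fq : finFieldType) (k : fieldType) (iota : {rmorphism Fq -> k}).
Local Notation L := (laurent k).
Local Notation theta := (laurent_map (frobenius iota)).
Local Notation sigma := (sigma iota).
Local Notation iw := (@iw_lift k).
Local Notation cell := (@double_coset k).
Local Notation q := #|Fq|.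
Implicit Types (M N : 'M[L]_3) (g h : U3 k) (x y : iwahori_weyl).

Lemma sigmaM g h : sigma (g * h)%g = (sigma g * sigma h)%g.
Proof. exact: unitaryM. Qed.

Lemma sigma1 : sigma 1%g = 1%g.
Proof. by apply: (mulgI (sigma 1%g)); rewrite -sigmaM !mulg1. Qed.

Lemma sigmaV g : sigma (g^-1)%g = ((sigma g)^-1)%g.
Proof. by apply: (mulgI (sigma g)); rewrite -sigmaM !mulgV sigma1. Qed.

Lemma sigma_pgl M N : M *m N = 1%:M ->
  sigma (pgl M) = pgl (\matrix_(i, j) theta (N (rev_ord j) (rev_ord i))).
Proof.
move=> MN; have [Mu _] := mulmx1_unit MN.
rewrite /sigma (unitary_pgl _ Mu) (invmx_uniq MN); congr pgl.
by apply/matrixP => i j; rewrite antidiag_conjE !mxE.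
Qed.

Lemma sigma_mx_mul M N : M *m N = 1%:M ->
  (\matrix_(i, j) theta (N (rev_ord j) (rev_ord i))) *m
  (\matrix_(i, j) theta (M (rev_ord j) (rev_ord i))) = 1%:M.
Proof.
move=> MN; have NM := mulmx1C MN; apply/matrixP => i j; rewrite !mxE.
have := congr1 (fun A : 'M_3 => theta (A (rev_ord j) (rev_ord i))) MN.
rewrite !mxE rmorph_sum rmorph_nat (inj_eq rev_ord_inj) eq_sym => <-.
rewrite (reindex_inj rev_ord_inj); apply: eq_bigr => l _.
by rewrite !mxE rev_ordK rmorphM mulrC.
Qed.

Lemma vge_theta n (f : L) : vge n f -> vge n (theta f).
Proof. by move=> fn m mn; rewrite /= fn // rmorph0. Qed.

Lemma iwmx_sigma M : iwmx M -> iwmx (\matrix_(i, j) theta (M (rev_ord j) (rev_ord i))).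
Proof.
move=> hM i j; rewrite mxE; apply: vge_theta; apply: vge_le (hM _ _).
by rewrite /=; have := ltn_ord i; have := ltn_ord j; lia.
Qed.

Lemma sigma_iwahori g : iwahori g -> iwahori (sigma g).
Proof.
move=> /iwahoriP[M [N [MN hM hN ->]]]; rewrite (sigma_pgl MN).
by apply: (iwahori_pgl (sigma_mx_mul MN)); apply: iwmx_sigma.
Qed.

Lemma theta_const c : theta (lconst c) = lconst (c ^+ q).
Proof.
apply: laurentP => n /=; rewrite rmorphMn /=; congr (_ *+ _).
Qed.

Lemma theta_eps : theta (eps k) = eps k.
Proof. by apply: laurentP => n /=; rewrite rmorph_nat. Qed.

Lemma sigma_elmx i j (f : L) : i != j ->
  sigma (pgl (elmx i j f)) = pgl (elmx (rev_ord j) (rev_ord i) (- theta f)).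
Proof.
move=> ij; rewrite (sigma_pgl (elmxK f ij)); congr pgl; apply/matrixP => a b.
rewrite mxE !elmxE rmorphD rmorphM rmorphN !rmorph_nat (inj_eq rev_ord_inj).
rewrite !(can2_eq (@rev_ordK 3) (@rev_ordK 3)) (eq_sym b).
by congr (_ + _ * _); congr (_%:R); rewrite andbC.
Qed.

Lemma sigma_root_elt i c : sigma (root_elt i c) = root_elt (- i) (- c ^+ q).
Proof.
move: i; apply: ord3P; rewrite ?(oppr0, opp1_I3, opp2_I3) /root_elt /=.
- rewrite (sigma_elmx _ (isT : (0 : 'I_3) != 2)) !rev_ord3E.
  have -> : theta (eps k * lconst c) = eps k * lconst (c ^+ q).
    by rewrite -theta_const -{2}theta_eps -rmorphM.
  by rewrite -mulrN -rmorphN.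
- by rewrite (sigma_elmx _ (isT : (1 : 'I_3) != 0)) !rev_ord3E theta_const -rmorphN.
by rewrite (sigma_elmx _ (isT : (2 : 'I_3) != 1)) !rev_ord3E theta_const -rmorphN.
Qed.

Definition trivial_class h : Prop := exists g, h = (g^-1 * sigma g)%g.

Lemma trivial_class1 : trivial_class 1%g.
Proof. by exists 1%g; rewrite sigma1 invg1 mulg1. Qed.

Lemma trivial_class_conj (y h : U3 k) : trivial_class h ->
  trivial_class (y * h * (sigma y)^-1)%g.
Proof.
move=> [g ->]; exists (g * y^-1)%g.
exact: (twisted_conj_mulg sigmaM).
Qed.

(** Twisted conjugation by the inverse of g carries the left factor to the right end, at the price
    of one sigma. The exchange moves below rest on this and on conjugation by lifts. *)
Lemma trivial_class_swap g h : trivial_class (g * h)%g -> trivial_class (h * sigma g)%g.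
Proof.
move=> /(trivial_class_conj g^-1%g); rewrite mulKg sigmaV invgK.
exact.
Qed.

Lemma trivial_class_sigma h : trivial_class h -> trivial_class (sigma h).
Proof. by move=> [g ->]; exists (sigma g); rewrite sigmaM sigmaV. Qed.

Lemma sigma_iw w : sigma (iw w) = iw (delta w).
Proof. exact: sigma_iw_lift. Qed.

Lemma cell_sigma w h : cell w h -> cell (delta w) (sigma h).
Proof.
move=> [a [b [ia ib ->]]]; exists (sigma a), (sigma b).
by split; rewrite ?sigmaM ?sigma_iw //; apply: sigma_iwahori.
Qed.

Definition nonempty_cell w : Prop := exists2 h, cell w h & trivial_class h.

Lemma nonempty_cellP w : nonempty_cell w -> exists2 j, iwahori j & trivial_class (iw w * j)%g.
Proof.
move=> [h [a [b [ia ib ->]]]]; rewrite -mulgA => /trivial_class_swap hc.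
exists (b * sigma a)%g; first by apply: iwahoriM => //; apply: sigma_iwahori.
by rewrite mulgA.
Qed.

Lemma nonempty_cell1 : nonempty_cell 1%g.
Proof. by exists (iw 1%g); [exact: cell_iw|rewrite iw_lift1; exact: trivial_class1]. Qed.

Lemma nonempty_cell_delta w : nonempty_cell w -> nonempty_cell (delta w).
Proof.
move=> [h hw hc]; exists (sigma h); first exact: cell_sigma.
exact: trivial_class_sigma.
Qed.

Lemma nonempty_cell_tau w : nonempty_cell w -> nonempty_cell (tau * w * tau)%g.
Proof.
move=> /nonempty_cellP[j ij] /(trivial_class_conj (iw tau)).
rewrite sigma_iw delta_tau iw_liftV invgK => hc; eexists; last exact: hc.
exists 1%g, ((iw tau)^-1 * j * iw tau)%g; split; first exact: iwahori1.
  by have := iw_tauV_conj 1 ij; rewrite expg1.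
rewrite mul1g (iw_liftM k (tau * w)%g tau) (iw_liftM k tau w).
by move: (iw tau) (iw w) => t v; rewrite !mulgA mulgK.
Qed.

Let s i := simple_reflection i.

Lemma sigma_simpleV i : ((sigma (iw (s i)))^-1 = iw (s (- i)))%g.
Proof. by rewrite sigma_iw delta_simple iw_simpleV. Qed.

(** The descent provides a reduced factorisation of x, whose outer reflection is rotated to the
    other side. Since the length returns to that of x, the rotated product again lies in a single
    double coset. *)
Lemma nonempty_cell_shift i x : len (shift i x) = len x ->
  len x = (len (s i * x)%g).+1 \/ len x = (len (x * s (- i))%g).+1 ->
  nonempty_cell x -> nonempty_cell (shift i x).
Proof.
move=> xs [xl|xl] /nonempty_cellP[j ij hc].
  have xE : x = (s i * (s i * x))%g by rewrite mulgA simpleK mul1g.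
  move: hc; rewrite {1}xE iw_liftM -mulgA => /trivial_class_swap.
  rewrite sigma_iw delta_simple => hc; eexists; last exact: hc.
  by apply: cell_Ms => //; [rewrite -/(shift i x) xs xl|exact: cell_iw].
(* Here the reflection is split off on the right, so the long factor is the one rotated and receives
   sigma; the result lies in the cell of [delta (shift i x)]. *)
suff : nonempty_cell (delta (shift i x)) by move=> /nonempty_cell_delta; rewrite deltaK.
have xE : x = (x * s (- i) * s (- i))%g by rewrite -mulgA simpleK mulg1.
move: hc; rewrite {1}xE iw_liftM -mulgA => /trivial_class_swap.
rewrite sigma_iw => hc; eexists; last exact: hc.
have dE : delta (shift i x) = (s (- i) * delta (x * s (- i)))%g.
  by rewrite /shift -(mulgA (s i)) (deltaM (s i)) delta_simple.
rewrite dE; apply: cell_sM => //; last exact: cell_iw.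
by rewrite -dE !len_delta xs xl.
Qed.

Lemma shift_up i x : len (shift i x) = (len x).+2 ->
  [/\ len (s i * x)%g = (len x).+1, len (x * s (- i))%g = (len x).+1 &
      len (s i * (x * s (- i)))%g = (len x).+2].
Proof.
move=> xl; have e : (s i * (x * s (- i)))%g = shift i x by rewrite /shift mulgA.
have := len_simpleM i x; have := len_Msimple (- i) (s i * x)%g.
have := len_Msimple (- i) x; have := len_simpleM i (x * s (- i))%g.
rewrite -/(s i) -/(s (- i)) e -[(s i * x * _)%g]/(shift i x) xl.
move: (len x) (len (s i * x)%g) (len (x * s (- i))%g) => m n p.
by move=> *; split; lia.
Qed.

Lemma nonempty_cell_up i x : len (shift i x) = (len x).+2 ->
  nonempty_cell x -> nonempty_cell (shift i x).
Proof.
move=> xl [h hx /(trivial_class_conj (iw (s i)))]; rewrite sigma_simpleV => hc.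
have [l1 l2 l3] := shift_up xl; eexists; last exact: hc.
have i1 := @iwahori1 k; rewrite -[(iw (s i) * h)%g]mulg1.
apply: cell_Ms => //; first by rewrite -/(shift i x) xl l1.
by rewrite -[iw (s i)]mulg1; apply: cell_sM; rewrite ?l1.
Qed.

(* If j lies in the smaller group I \cap sIs, twisting by a root element of I
   moves it out, which leaves only the big cell of the rank one parahoric. *)
Lemma twisted_move i j : iwahori j -> exists2 p, iwahori p &
  cell (s i) (iw (s i) * (j * (sigma p)^-1) * iw (s i))%g.
Proof.
move=> ij; have [h0|h0] := simple_cellP i ij; last first.
  by exists 1%g; rewrite ?sigma1 ?invg1 ?mulg1 //; exact: iwahori1.
pose p : U3 k := root_elt (- i) 1; exists p; first exact: root_elt_iwahori.
have sp : iwahori (sigma p) by apply/sigma_iwahori/root_elt_iwahori.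
have ijp : iwahori (j * (sigma p)^-1)%g by apply: iwahoriM => //; apply: iwahoriV.
have [h1|//] := simple_cellP i ijp.
have := iwahoriM (iwahoriV h1) h0.
have -> : ((iw (s i) * (j * (sigma p)^-1) * iw (s i))^-1 * (iw (s i) * j * iw (s i)) =
    iw (s i) * sigma p * iw (s i))%g.
  exact/conj_quotg/iw_simpleV.
rewrite /p sigma_root_elt opprK => /root_elt_conj[].
by rewrite oppr_eq0 expf_neq0 ?oner_eq0.
Qed.

(** Conjugating an element x s' j by s_i produces s' j s', with s' = δ(s_i), which may fall back
    into I. A preliminary twist by p in I puts this factor in the cell of s', and then the lengths
    of s_i, x and s' add up. *)
Lemma nonempty_cell_down i x : len (shift i x) = (len x).+2 ->
  nonempty_cell (x * s (- i))%g -> nonempty_cell (shift i x).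
Proof.
move=> xl /nonempty_cellP[j ij hc]; have [l1 l2 l3] := shift_up xl.
have [p ip hp] := twisted_move (- i) ij.
move: hc => /(trivial_class_conj p)/(trivial_class_conj (iw (s i))).
rewrite sigma_simpleV iw_liftM => hc; eexists; last exact: hc.
have -> : (iw (s i) * (p * (iw x * iw (s (- i)) * j) * (sigma p)^-1) * iw (s (- i)) =
   iw (s i) * p * (iw x * (iw (s (- i)) * (j * (sigma p)^-1) * iw (s (- i)))))%g.
  by rewrite !mulgA.
rewrite /shift -mulgA; apply: cell_sM; rewrite ?l3 ?l2 //.
case: hp => a [b [ia ib ->]]; rewrite !mulgA; apply: cellMr => //.
by apply: cell_Ms => //; [rewrite l2|exact: cell_iw].
Qed.

End Frobenius.

Lemma additive_root (k : closedFieldType) (n : nat) (a c : k) : (1 < n)%N ->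
  exists y, y ^+ n + a * y = c.
Proof.
move=> n1; pose p : {poly k} := 'X^n + a *: 'X - c%:P.
have sp : size p = n.+1.
  rewrite /p -addrA size_polyDl size_polyXn // ltnS.
  apply: leq_trans (size_polyD _ _) _; rewrite geq_max size_polyN.
  rewrite (leq_trans (size_scale_leq _ _)) ?size_polyX //=.
  by apply: leq_trans (size_polyC_leq1 _) _; apply: ltnW.
have [|y /rootP] := closed_rootP p _; first by rewrite sp; lia.
rewrite /p !hornerE => /eqP; rewrite subr_eq0 => /eqP.
by exists y.
Qed.

Lemma additive_nonroot (k : closedFieldType) (n : nat) (a : k) : (1 < n)%N ->
  exists y, y ^+ n + a * y != 0.
Proof.
move=> n1; have [y yE] := @additive_root k n a 1 n1.
by exists y; rewrite yE oner_eq0.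
Qed.

(** * Explicit elements in the cells of s0, s1 and s1 s2 s1 *)

Section BaseCells.
Variables (Fq : finFieldType) (k : closedFieldType) (iota : {rmorphism Fq -> k}).
Local Notation L := (laurent k).
Local Notation sigma := (sigma iota).
Local Notation iw := (@iw_lift k).
Local Notation cell := (@double_coset k).
Local Notation q := #|Fq|.

Lemma card_gt1 : (1 < q)%N. Proof. exact: finNzRing_gt1. Qed.

Lemma frobE (x : k) : frobenius iota x = x ^+ q. Proof. by []. Qed.
Lemma frobD (x y : k) : (x + y) ^+ q = x ^+ q + y ^+ q.
Proof. by rewrite -!frobE rmorphD. Qed.
Lemma frobN (x : k) : (- x) ^+ q = - x ^+ q.
Proof. by rewrite -!frobE rmorphN. Qed.

Lemma root_eltD i (c d : k) : root_elt i (c + d) = (root_elt i c * root_elt i d)%g.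
Proof.
have E (a b : 'I_3) (f g : L) : a != b ->
    pgl (elmx a b (f + g)) = (pgl (elmx a b f) * pgl (elmx a b g))%g.
  move=> ab; rewrite -(elmxM f g ab).
  have [fu _] := mulmx1_unit (elmxK f ab); have [gu _] := mulmx1_unit (elmxK g ab).
  exact: pglM.
move: i; apply: ord3P; rewrite /root_elt /= rmorphD ?mulrDr.
- exact: (E 0 2).
- exact: (E 1 0).
exact: (E 2 1).
Qed.

Lemma root_eltV i (c : k) : root_elt i (- c) = ((root_elt i c)^-1)%g.
Proof.
apply: (mulgI (root_elt i c)); rewrite -root_eltD mulgV subrr.
by move: i; apply: ord3P; rewrite /root_elt /= rmorph0 ?mulr0 elmx0 pgl1.
Qed.

Lemma cell_root i (c : k) : c != 0 -> cell (simple_reflection i)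
  (iw (simple_reflection i) * root_elt i c * iw (simple_reflection i))%g.
Proof.
move=> c0; have [/(root_elt_conj c0) []|//] := simple_cellP i (root_elt_iwahori i c).
Qed.

(** The affine root subgroup is sigma-stable with c sent to -c^q, so twisting 1 by it yields the
    parameter c + c^q. Once this is nonzero, conjugation by [s0], which [delta] fixes, moves the
    element into the cell. *)
Lemma nonempty_cell_s0 : nonempty_cell iota s0.
Proof.
have [c c0] := @additive_nonroot k q 1 card_gt1.
have h := trivial_class_conj (root_elt 0 c) (trivial_class1 iota).
have := trivial_class_conj (iw s0) h; rewrite sigma_iw delta_s0 mulg1.
rewrite sigma_root_elt oppr0 -root_eltV opprK -root_eltD -[s0]/(simple_reflection 0).
rewrite iw_simpleV => hc; eexists; last exact: hc.
by apply: cell_root; rewrite addrC -[X in _ + X]mul1r.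
Qed.

Lemma delta_w0 : delta (s1 * s2 * s1)%g = (s1 * s2 * s1)%g.
Proof.
apply: iwP => [|i]; last by rewrite delta_lin !lin_w0E rev_ordK.
by rewrite /delta trans_Ms1 trans_Ms2.
Qed.

Lemma iw_w0_conj (i j : 'I_3) (f : L) : i != j ->
  (iw (s1 * s2 * s1)%g * pgl (elmx i j f) * (iw (s1 * s2 * s1)%g)^-1)%g =
  pgl (elmx (rev_ord i) (rev_ord j) f).
Proof.
move=> ij; rewrite (iw_conj _ (elmxK f ij)); congr pgl.
have -> : elmx i j f = elmx (lin (s1 * s2 * s1)%g (rev_ord i)) (lin (s1 * s2 * s1)%g (rev_ord j)) f.
  by rewrite !lin_w0E !rev_ordK.
have l0 a : coweight_lift (trans (s1 * s2 * s1)%g) a = 0.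
  rewrite trans_Ms1 trans_Ms2; exact: iw_s1_lift.
by rewrite conjM_elmx ?(inj_eq rev_ord_inj) // !l0 subr0 expr0z mul1r.
Qed.

Lemma trivial_class_w0 h : trivial_class iota h ->
  trivial_class iota (iw (s1 * s2 * s1)%g * h * (iw (s1 * s2 * s1)%g)^-1)%g.
Proof.
by move=> /(trivial_class_conj (iw (s1 * s2 * s1)%g)); rewrite sigma_iw delta_w0.
Qed.

Lemma trivial_class_mx (U U' H H' : 'M[L]_3) : U *m U' = 1%:M -> H *m H' = 1%:M ->
  (\matrix_(i, j) laurent_map (frobenius iota) (U' (rev_ord j) (rev_ord i))) = U *m H ->
  trivial_class iota (pgl H).
Proof.
move=> UU HH e; exists (pgl U); rewrite (sigma_pgl iota UU) e.
have [[Uu _] [Hu _]] := (mulmx1_unit UU, mulmx1_unit HH).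
by rewrite pglM // mulKg.
Qed.

(* A point (z, y) of the Hermitian curve y^q + y = (x z)^q, x = - z^q, that is not
   rational over F_{q^2} gives a flag in relative position s_1 with its twist. *)
Lemma nonempty_cell_s1 : nonempty_cell iota s1.
Proof.
have q1 := card_gt1.
have [z z0] : exists z : k, z ^+ (q * q) - z != 0.
  have [|z] := @additive_nonroot k (q * q) (-1); first by lia.
  by rewrite mulN1r; exists z.
pose x : k := - z ^+ q.
have [y yE] := @additive_root k q 1 ((x * z) ^+ q) q1.
pose lc := @lconst k; pose a := z ^+ (q * q) - z.
(* In sigma(U) = U * elmx 2 1 a, the entry (1, 0) demands x = -z^q, the entry (2, 0) is the curve
   equation, and the entry (2, 1) gives a = z^(q^2) - z. *)
pose U := \matrix_(i, j) nth 0 (nth [::] [:: [:: 1; 0; 0]; [:: lc x; 1; 0]; [:: lc y; lc z; 1]] i) j : 'M[L]_3.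
pose U' := \matrix_(i, j) nth 0 (nth [::] [:: [:: 1; 0; 0]; [:: lc (- x); 1; 0]; [:: lc (x * z - y); lc (- z); 1]] i) j : 'M[L]_3.
have UU : U *m U' = 1%:M.
  apply/matrixP => i j; rewrite !mxE sum3 !mxE.
  move: i j; do 2![apply: ord3P]; rewrite /= !(mulr0, mulr1, mul0r, mul1r, addr0, add0r) //.
  - by rewrite -rmorphD addrN rmorph0.
  - by rewrite -rmorphM -!rmorphD mulrN (mulrC z) addrA subrK subrr rmorph0.
  by rewrite -rmorphD addrN rmorph0.
have h : trivial_class iota (pgl (elmx 2 1 (lc a))).
  have ij : (2 : 'I_3) != 1 by [].
  apply: (trivial_class_mx UU (elmxK _ ij)); apply/matrixP => i j.
  rewrite !mxE sum3 !elmxE !mxE.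
  move: i j; do 2![apply: ord3P]; rewrite !rev_ord3E /= ?rmorph1 ?rmorph0
    !(mulr0, mulr1, mul0r, mul1r, addr0, add0r) // !theta_const.
  - by rewrite frobN.
  - by rewrite frobD frobN -yE mul1r addrAC subrr add0r.
  by rewrite -rmorphD; congr lc; rewrite /a frobN /x frobN opprK -exprM subrKC.
have := trivial_class_w0 h; rewrite iw_w0_conj // !rev_ord3E => hc.
by eexists; last exact: hc; apply: cell_elmx01.
Qed.

(** The highest root subgroup is sigma-stable, so twisting 1 by it gives a nontrivial element.
    Conjugation by s1 turns it into a root element of s2, whence conjugation by s1 s2 s1 gives s1
    times an element of the cell of s2 times s1, with lengths adding. *)
Lemma nonempty_cell_w0 : nonempty_cell iota (s1 * s2 * s1)%g.
Proof.
have q1 := card_gt1; have [y y0] := @additive_nonroot k q 1 q1.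
have ij : (2 : 'I_3) != 0 by [].
have h := trivial_class_conj (pgl (elmx 2 0 (lconst y))) (trivial_class1 iota).
have e : (pgl (elmx 2 0 (lconst y)) * 1 * (sigma (pgl (elmx 2 0 (lconst y))))^-1)%g =
    pgl (elmx 2 0 (lconst (y + y ^+ q))).
  rewrite mulg1 (sigma_elmx iota _ ij) !rev_ord3E theta_const -rmorphN.
  have [[u1 _] [u2 _]] := (mulmx1_unit (elmxK (lconst y) ij), mulmx1_unit (elmxK (lconst (- y ^+ q)) ij)).
  have [u3 _] := mulmx1_unit (elmxK (lconst (y + y ^+ q)) ij).
  apply: (mulIg (pgl (elmx 2 0 (lconst (- y ^+ q))))); rewrite mulgVK -(pglM u3 u2).
  by rewrite (elmxM _ _ ij) -rmorphD addrK.
rewrite e in h; have := trivial_class_w0 h => hc; eexists; last exact: hc.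
have sV := iw_simpleV k; have w0E : (iw (s1 * s2 * s1)%g = iw s1 * iw s2 * iw s1)%g.
  by rewrite (iw_liftM k (s1 * s2)%g s1) (iw_liftM k s1 s2).
have w0V : ((iw (s1 * s2 * s1)%g)^-1 = iw s1 * iw s2 * iw s1)%g.
  by rewrite w0E !invMg (sV 1) (sV 2) mulgA.
set b := y + y ^+ q; have r2 : (iw s1 * pgl (elmx 2 0 (lconst b)) * iw s1)%g = root_elt 2 b.
  rewrite -{2}(sV 1) (iw_conj _ (elmxK _ ij)); congr pgl.
  have -> : elmx 2 0 (lconst b) = elmx (lin s1 2) (lin s1 1) (lconst b) by rewrite /= !permE3.
  by rewrite conjM_elmx // !iw_s1_lift subr0 expr0z mul1r.
have b0 : b != 0 by rewrite /b addrC -[X in _ + X]mul1r.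
have -> : (iw (s1 * s2 * s1)%g * pgl (elmx 2 0 (lconst b))%R * (iw (s1 * s2 * s1)%g)^-1 =
    iw s1 * 1 * (iw s2 * root_elt 2 b * iw s2) * 1 * iw s1)%g.
  by rewrite w0V w0E -r2 !mulg1 !mulgA.
have c2 : cell s2 (iw s2 * root_elt 2 b * iw s2)%g by exact: (cell_root 2 b0).
have i1 := @iwahori1 k.
have l12 : (len s2 < len (s1 * s2)%g)%N by rewrite /len ?iwE /= ?permE3.
have l121 : (len (s1 * s2)%g < len (s1 * s2 * s1)%g)%N by rewrite /len ?iwE /= ?permE3.
exact: (@cell_Ms _ 1 _ _ _ l121 i1 (@cell_sM _ 1 _ _ _ l12 i1 c2)).
Qed.

End BaseCells.

(** * Minimal elements of the straight classes *)

Lemma len_mul_le x y : (len (x * y)%g <= len x + len y)%N.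
Proof.
move: {2}(len x) (erefl (len x)) => n; elim: n x => [|n IH] x xn.
  by have [j ->] := len_eq0 xn; rewrite len_tauXM leq_addl.
have [|i xi] := @len_gt0 x; first by rewrite xn.
have x1 : len (simple_reflection i * x)%g = n by move: xi; rewrite xn => -[].
have := IH _ x1; have := len_simpleM i (simple_reflection i * x * y)%g.
rewrite !mulgA simpleK mul1g x1 xn.
by move: (len (x * y)%g) (len (_ * x * y)%g) => p r; lia.
Qed.

Section CellProduct.
Variable k : fieldType.
Local Notation cell := (@double_coset k).
Local Notation iw := (@iw_lift k).

Lemma cell_mul x y g h : len (x * y)%g = (len x + len y)%N ->
  cell x g -> cell y h -> cell (x * y)%g (g * h)%g.
Proof.
move: {2}(len x) (erefl (len x)) => n; elim: n x g => [|n IH] x g xn xy hx hy.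
  case: hx => a [b [ia ib ->]]; case: hy => c [d [ic id ->]].
  have ibc := iwahoriM ib ic.
  exists (a * (iw x * (b * c) * (iw x)^-1))%g, d; split=> //.
    by apply: iwahoriM => //; apply: iwahori_conj.
  by rewrite iw_liftM !mulgA mulgVK.
have [|i xi] := @len_gt0 x; first by rewrite xn.
have x1 : len (simple_reflection i * x)%g = n by move: xi; rewrite xn => -[].
have xE : x = (simple_reflection i * (simple_reflection i * x))%g.
  by rewrite mulgA simpleK mul1g.
case: hx => a [b [ia ib ->]].
have l1 : len (simple_reflection i * x * y)%g = (n + len y)%N.
  have := len_mul_le (simple_reflection i * x)%g y.
  have := len_simpleM i (simple_reflection i * x * y)%g.
  rewrite !mulgA simpleK mul1g xy xn x1.
  by move: (len (_ * x * y)%g) => p; lia.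
have h1 : cell (simple_reflection i * x)%g (iw (simple_reflection i * x)%g * b)%g.
  by apply: cellMr => //; exact: cell_iw.
have := IH _ _ x1 _ h1 hy; rewrite l1 x1 => /(_ erefl) h2.
have i1 := @iwahori1 k.
rewrite {1}xE -(mulgA (simple_reflection i)).
have -> : (a * iw x * b * h = a * (iw (simple_reflection i) * 1 *
    (iw (simple_reflection i * x)%g * b * h)))%g.
  by rewrite {1}xE (iw_liftM k (simple_reflection i) (_ * _)%g) !mulg1 !mulgA.
apply: cellMl => //; apply: cell_sM => //.
by rewrite l1 !mulgA simpleK mul1g xy xn.
Qed.

End CellProduct.

(** The square of a glide reflection is a translation along its axis, so its multiples grow linearly
    in length. *)
Lemma even_values_norm x c : even_values x c -> exists mu : coweight,
  (x * delta x)%g = translation mu /\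
  forall n : nat, len (translation (mu *+ n)) = (4 * `|c| * n)%N.
Proof.
have lt (l : coweight) : len (translation l) = (`|l.1| + `|l.2| + `|(l.1 + l.2)%R|)%N.
  by rewrite /len /= !perm1 /= !subr0.
have mun (l : coweight) n : l *+ n = (l.1 *+ n, l.2 *+ n).
  by elim: n => // n IH; rewrite !mulrS IH.
have aM (z : int) n : `|z *+ n|%N = (`|z| * n)%N.
  by rewrite -mulr_natr natz abszM.
have T : trans (x * delta x)%g = trans x +
  (coweight_lift ((trans x).2, (trans x).1) (lin x 0) - coweight_lift ((trans x).2, (trans x).1) (lin x 1),
   coweight_lift ((trans x).2, (trans x).1) (lin x 1) - coweight_lift ((trans x).2, (trans x).1) (lin x 2)) by [].
have E i : lin (x * delta x)%g i = rev_ord (lin x (rev_ord (lin x i))).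
  by rewrite /= -delta_lin permM.
case=> [] [x0 x1 x2 ->]; exists (trans (x * delta x)%g); split.
1,3,5: by apply: iwP => // i; rewrite perm1 E; move: i; apply: ord3P;
  rewrite ?(x0, x1, x2) !rev_ord3E ?(x0, x1, x2) !rev_ord3E.
all: move: (trans (x * delta x)%g) T => mu T n.
all: rewrite lt mun /= -mulrnDl !aM -!mulnDl; congr (_ * _)%N.
all: by rewrite T x0 x1 x2 /coweight_lift /=; case: (trans x) => a b /=; lia.
Qed.

Section Bounded.
Variables (Fq : finFieldType) (k : fieldType) (iota : {rmorphism Fq -> k}).
Local Notation L := (laurent k).
Local Notation sigma := (sigma iota).
Local Notation iw := (@iw_lift k).
Local Notation cell := (@double_coset k).
Implicit Types (g h : U3 k) (M N : 'M[L]_3).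

(* A bound on the displacement of the base point of the Bruhat-Tits building. *)
Definition bounded (d : nat) g : Prop := exists M N, [/\ M *m N = 1%:M,
  forall i j, vge 0 (M i j), forall i j, vge (- d%:Z) (N i j) & g = pgl M].

Lemma vge_mulmx (m n : int) M N : (forall i j, vge m (M i j)) ->
  (forall i j, vge n (N i j)) -> forall i j, vge (m + n) ((M *m N) i j).
Proof. by move=> hM hN i j; rewrite mxE; apply: vge_sum => l _; apply: vgeM. Qed.

Lemma boundedM d e g h : bounded d g -> bounded e h -> bounded (d + e) (g * h)%g.
Proof.
move=> [M [M' [eM hM hM' ->]]] [N [N' [eN hN hN' ->]]].
have [[Mu _] [Nu _]] := (mulmx1_unit eM, mulmx1_unit eN).
exists (M *m N), (N' *m M'); split.
- by rewrite mulmxA -(mulmxA M) eN mulmx1.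
- by move=> i j; rewrite -[0]addr0; apply: vge_mulmx.
- have -> : - (d + e)%N%:Z = - e%:Z + - d%:Z by lia.
  exact: vge_mulmx.
by rewrite pglM.
Qed.

(** In PGL_3 a common power of ε can be moved between M and its inverse, so only the sum of the two
    valuation bounds matters. *)
Lemma bounded_rescale d M N (z : int) : M *m N = 1%:M ->
  (forall i j, vge z (M i j)) -> (forall i j, vge (- z - d%:Z) (N i j)) ->
  bounded d (pgl M).
Proof.
move=> e hM hN; have z0 (t : int) : eps k ^ t != 0 by rewrite expfz_neq0 // eps_neq0.
exists (eps k ^ (- z) *: M), (eps k ^ z *: N); split.
- by rewrite -scalemxAl -scalemxAr scalerA -expfzDr ?eps_neq0 // addNr expr0z scale1r.
- by move=> i j; rewrite mxE; apply/vge_epsM; rewrite sub0r opprK.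
- move=> i j; rewrite mxE; apply/vge_epsM; apply: vge_le (hN i j); lia.
by rewrite pglZ.
Qed.

Lemma boundedV d g : bounded d g -> bounded d (g^-1)%g.
Proof.
move=> [M [N [e hM hN ->]]].
have -> : ((pgl M)^-1 = pgl N)%g.
  by apply: (mulgI (pgl M)); rewrite mulgV pglM1.
apply: (bounded_rescale (mulmx1C e) hN) => i j.
by apply: vge_le (hM i j); lia.
Qed.

Lemma bounded_sigma d g : bounded d g -> bounded d (sigma g).
Proof.
move=> [M [N [e hM hN ->]]]; rewrite (sigma_pgl iota e).
apply: (bounded_rescale (sigma_mx_mul iota e) (z := - d%:Z)) => i j; rewrite mxE.
  exact: vge_theta.
by apply: vge_theta; apply: vge_le (hM _ _); lia.
Qed.

Lemma bounded_iwahori g : iwahori g -> bounded 0 g.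
Proof.
move=> /iwahoriP[M [N [e hM hN ->]]]; exists M, N; split=> // i j.
  by apply: vge_le (hM i j); lia.
by apply: vge_le (hN i j); lia.
Qed.

Lemma bounded_exists g : exists d, bounded d g.
Proof.
have /choice[F hF] : forall f : L, exists n : nat, vge (- n%:Z) f.
  by move=> f; have [N hN] := lcoef_bounded f; exists `|N|%N => m mN; apply: hN; lia.
have [M Mu ->] := pgl_surj g; pose N := invmx M.
pose B A := \max_(i < 3) \max_(j < 3) F ((A : 'M[L]_3) i j).
have hB A i j : vge (- (B A)%:Z) (A i j).
  apply: vge_le (hF _); rewrite lerN2 lez_nat.
  apply: leq_trans (leq_bigmax i); exact: (leq_bigmax j (F := fun j => F (A i j))).
exists (B M + B N)%N; apply: (bounded_rescale (N := N) (z := - (B M)%:Z)) => //.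
  by rewrite mulmxV.
by move=> i j; apply: vge_le (hB N i j); lia.
Qed.

(** The product of [M i i] and [N j j] is free of the unknown scalar and equals ε to the difference
    of two coordinates. Each of the three positive root pairings is thus at most d in absolute
    value, hence the factor 3. *)
Lemma bounded_translation d (l : coweight) : bounded d (iw (translation l)) ->
  (len (translation l) <= 3 * d)%N.
Proof.
rewrite iw_pgl => -[M [N [e hM hN]]].
have [Mu _] := mulmx1_unit e.
case/(pgl_eq (iwM_unit k _) Mu) => c c0 eM.
have ME i : eps_wt k (translation l) i = c * M i i.
  have -> : c * M i i = (c *: M) i i by rewrite [RHS]mxE.
  by rewrite -eM iwME perm1 eqxx mulr1.
have NE i : eps_wt k (translation l) i * N i i = c.
  have -> : eps_wt k (translation l) i * N i i = (iwM k (translation l) *m N) i i.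
    by rewrite iwM_mul perm1.
  by rewrite eM -scalemxAl e mxE [X in _ * X]mxE eqxx mulr1.
have le i j : - d%:Z <= coweight_lift l i - coweight_lift l j.
  have MN : M i i * N j j = eps k ^ (coweight_lift l i - coweight_lift l j).
    apply: (mulfI (mulf_neq0 c0 (eps_wt_neq0 k (translation l) j))).
    rewrite mulrACA -ME NE mulrC -mulrA /eps_wt /= -expfzDr ?eps_neq0 //.
    by rewrite [coweight_lift l j + _]addrC subrK.
  rewrite leNgt; apply/negP => lt.
  have := vgeM (hM i i) (hN j j); rewrite add0r MN eps_exp => /(_ _ lt) /= /eqP.
  by rewrite eqxx oner_eq0.
have l01 := le 0 1; have l10 := le 1 0; have l12 := le 1 2; have l21 := le 2 1.
have l02 := le 0 2; have l20 := le 2 0; move: l01 l10 l12 l21 l02 l20.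
rewrite /len /= !perm1 /coweight_lift /=; case: l {hM hN eM ME NE le} => a b /=.
by lia.
Qed.

Lemma cell_translation_bounded d l h : cell (translation l) h -> bounded d h ->
  (len (translation l) <= 3 * d)%N.
Proof.
move=> [a [b [ia ib e]]] hd; apply: bounded_translation.
have -> : iw (translation l) = (a^-1 * h * b^-1)%g by rewrite e !mulgA mulVg mul1g mulgK.
rewrite -[d]addn0 -[d]add0n; apply: boundedM.
  by apply: boundedM => //; apply/bounded_iwahori/iwahoriV.
by apply/bounded_iwahori/iwahoriV.
Qed.

Lemma iter_sigmaM n g h : iter n sigma (g * h)%g = (iter n sigma g * iter n sigma h)%g.
Proof. by elim: n => //= n ->; rewrite sigmaM. Qed.

Lemma iter_sigmaV n g : iter n sigma (g^-1)%g = ((iter n sigma g)^-1)%g.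
Proof. by elim: n => //= n ->; rewrite sigmaV. Qed.

Lemma cell_iter_sigma2 n w h : cell w h -> cell w (iter (2 * n) sigma h).
Proof.
move=> hw; elim: n => [|n IH]; first by rewrite muln0.
rewrite mulnS /=; rewrite -(deltaK w); apply/cell_sigma/cell_sigma.
by move: IH.
Qed.

Lemma empty_straight x c : even_values x c -> c != 0 -> len x = (2 * `|c|)%N ->
  ~ nonempty_cell iota x.
Proof.
move=> xc c0 xl [h hx [g hg]]; have [mu [muE mul]] := even_values_norm xc.
have mu1 : len (translation mu) = (4 * `|c|)%N by have := mul 1%N; rewrite mulr1n muln1.
have h1 : cell (translation mu) (h * sigma h)%g.
  rewrite -muE; apply: cell_mul => //; last exact: cell_sigma.
  by rewrite muE mu1 len_delta xl; lia.
have hE : (h * sigma h = g^-1 * iter 2 sigma g)%g.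
  by rewrite hg sigmaM sigmaV !mulgA mulgK.
have hn n : cell (translation (mu *+ n)) (g^-1 * iter (2 * n) sigma g)%g.
  elim: n => [|n IH].
    by rewrite mulr0n muln0 /= mulVg -iw_lift1; exact: cell_iw.
  have -> : (g^-1 * iter (2 * n.+1) sigma g =
      g^-1 * iter (2 * n) sigma g * iter (2 * n) sigma (h * sigma h))%g.
    have -> : (2 * n.+1 = 2 * n + 2)%N by lia.
    by rewrite hE iter_sigmaM iter_sigmaV -iterD mulgA mulgK.
  rewrite mulrSr translationD; apply: cell_mul => //.
    by rewrite -translationD -mulrSr !mul mu1; lia.
  exact: cell_iter_sigma2.
have [d gd] := bounded_exists g.
have gn n : bounded (d + d) (g^-1 * iter n sigma g)%g.
  apply: boundedM; first exact: boundedV.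
  by elim: n => //= n IH; apply: bounded_sigma.
(* The displacement is at most 2d for every n, while the length is 4|c|n; this n exceeds 3 * 2d. *)
have := cell_translation_bounded (hn (3 * (d + d)).+1) (gn _).
by rewrite mul leqNgt leq_pmull //; lia.
Qed.

Lemma empty_min_length m w : (0 < m)%N -> min_length (Odelta m) w ->
  ~ nonempty_cell iota w.
Proof.
move=> m0 /(min_length_OdeltaP _ m0)[j [x [/XsetP[_ [c xc cm]] xl ->]]] h.
have c0 : c != 0 by rewrite -absz_eq0 cm; lia.
rewrite -cm in xl; apply: (empty_straight xc c0 xl).
rewrite -(tauXK j x); elim: (2 * j)%N => [|n IH]; first by rewrite expg0 mul1g mulg1.
set y := (tau ^+ j * x * tau ^+ j)%g in IH *.
have -> : (tau ^+ n.+1 * y * tau ^+ n.+1 = tau * (tau ^+ n * y * tau ^+ n) * tau)%g.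
  by rewrite {1}expgS expgSr !mulgA.
exact: nonempty_cell_tau.
Qed.

End Bounded.

(** * Basic elements are sigma-conjugate to 1 *)

(** Builds a series recursively when each coefficient is constrained by all the earlier ones. *)
Lemma seq_choice (T : Type) (R : seq T -> T -> Prop) :
  (forall s, exists x, R s x) -> exists f : nat -> T, forall n, R (mkseq f n) (f n).
Proof.
move=> /choice[F hF]; pose P := fix P n := if n is m.+1 then rcons (P m) (F (P m)) else [::].
exists (fun n => F (P n)) => n; suff -> : mkseq (fun n => F (P n)) n = P n by [].
by elim: n => // n IH; rewrite mkseqS IH.
Qed.

Section PowerSeries.
Variable k : fieldType.
Implicit Types f g : laurent k.

Lemma series_subproof (v : nat -> k) : exists N : int, forall n : int, n < N ->
  (if n < 0 then 0 else v `|n|%N) = 0.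
Proof. by exists 0 => n ->. Qed.
Definition series v : laurent k := Laurent (series_subproof v).

Lemma lcoefM_nat f g (n : nat) : vge 0 f -> vge 0 g ->
  (f * g) n%:Z = \sum_(i < n.+1) f (i : nat)%:Z * g (n - i)%N%:Z.
Proof.
move=> hf hg; rewrite (_ : lcoef (f * g) n = lconv f g (0 + 0 + n%:Z)); last first.
  by rewrite !add0r.
rewrite (lconvE hf hg (ltnSn n)) coefM; apply: eq_bigr => i _.
by rewrite !coef_poly !add0r ltn_ord ltnS leq_subr.
Qed.

Lemma laurent_eq_nat f g : vge 0 f -> vge 0 g -> (forall n : nat, f n%:Z = g n%:Z) -> f = g.
Proof.
move=> hf hg e; apply: laurentP => n; have [n0|n0] := ltP n 0; first by rewrite hf ?hg.
by have := e `|n|%N; rewrite gez0_abs.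
Qed.

Definition val_is (n : int) f : Prop := vge n f /\ f n != 0.

Lemma val_is_exists f : f != 0 -> exists n, val_is n f.
Proof. exact: vge_exact. Qed.

Lemma val_isM m n f g : val_is m f -> val_is n g -> val_is (m + n) (f * g).
Proof.
move=> [f1 f2] [g1 g2]; split; first exact: vgeM.
by rewrite lcoefM_lead // mulf_neq0.
Qed.

Lemma val_is_uniq m n f : val_is m f -> val_is n f -> m = n.
Proof.
move=> [f1 f2] [g1 g2]; have [mn|nm|//] := ltgtP m n.
  by rewrite g1 ?eqxx in f2.
by rewrite f1 ?eqxx in g2.
Qed.

Lemma val_is_eps z : val_is z (eps k ^ z).
Proof. by split; [exact: vge_eps|rewrite eps_exp /= eqxx oner_eq0]. Qed.

Lemma val_is1 : val_is 0 (1 : laurent k).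
Proof. by have := val_is_eps 0; rewrite expr0z. Qed.

Lemma val_is_neq0 n f : val_is n f -> f != 0.
Proof. by case=> _; apply: contra => /eqP ->. Qed.

Lemma val_isV n f : val_is n f -> val_is (- n) f^-1.
Proof.
move=> hf; have f0 := val_is_neq0 hf.
have [m hm] : exists m, val_is m f^-1 by apply: val_is_exists; rewrite invr_eq0.
have := val_isM hf hm; rewrite mulfV // => h.
by have -> : - n = m by have := val_is_uniq h val_is1; lia.
Qed.

Lemma val_isN n f : val_is n f -> val_is n (- f).
Proof. by move=> [h0 h1]; split; [exact: vgeN|rewrite /= oppr_eq0]. Qed.

End PowerSeries.

(** * Lang's equation and the norm equation, one coefficient at a time *)

Section Lang.
Variables (Fq : finFieldType) (k : closedFieldType) (iota : {rmorphism Fq -> k}).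
Local Notation L := (laurent k).
Local Notation theta := (laurent_map (frobenius iota)).
Local Notation q := #|Fq|.

Lemma lcoef_iter_theta n (f : L) m : (iter n theta f) m = f m ^+ (q ^ n).
Proof.
elim: n => [|n IH]; first by rewrite expr1.
by rewrite iterS (_ : lcoef (theta _) m = (iter n theta f) m ^+ q) // IH -exprM expnSr.
Qed.

Lemma vge_iter_theta n m (f : L) : vge m f -> vge m (iter n theta f).
Proof. by move=> hf; elim: n => //= n IH; apply: vge_theta. Qed.

Lemma val_is_theta n (f : L) : val_is n f -> val_is n (theta f).
Proof.
move=> [h0 h1]; split; first exact: vge_theta.
by rewrite (_ : lcoef (theta f) n = f n ^+ q) // expf_neq0.
Qed.

Lemma nth_root (n : nat) (c : k) : (0 < n)%N -> exists y, y ^+ n = c.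
Proof.
move=> n0; have [|y /rootP] := closed_rootP ('X^n - c%:P) _.
  by rewrite size_XnsubC //; lia.
by rewrite !hornerE => /eqP; rewrite subr_eq0 => /eqP; exists y.
Qed.

(** With Q = q^n, the coefficient x of degree m solves x^Q - f(0) x = known terms. In degree 0 a
    nonzero solution is needed, so a root of x^(Q-1) = f(0) is taken. *)
Lemma lang_unit n (f : L) : (0 < n)%N -> val_is 0 f ->
  exists2 y : L, val_is 0 y & iter n theta y = f * y.
Proof.
move=> n0 [f0 f1]; have q1 := @card_gt1 Fq.
have Q1 : (1 < q ^ n)%N by rewrite -{1}(expn0 q) ltn_exp2l.
have [s|v hv] := @seq_choice k (fun s x => (s = [::] -> x != 0) /\
   x ^+ (q ^ n) + (- f 0) * x = \sum_(i < size s) s`_i * f (size s - i)%N%:Z).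
  case: s => [|a s]; last first.
    have [x xE] := additive_root (- f 0) (\sum_(i < size (a :: s)) (a :: s)`_i * f (size (a :: s) - i)%N%:Z) Q1.
    by exists x.
  have [|x xE] := @nth_root (q ^ n).-1 (f 0).
    by rewrite -ltnS prednK // ltnW.
  exists x; split=> [_|].
    apply: contra f1 => /eqP x0; rewrite -xE x0 expr0n gtn_eqF //.
    by rewrite -ltnS prednK // ltnW.
  by rewrite big_ord0 -xE mulNr -exprSr prednK ?subrr // ltnW.
have hy : vge 0 (series v) by move=> m /= ->.
exists (series v).
  by split=> //=; case: (hv 0%N) => + _; apply.
apply: laurent_eq_nat.
- exact: vge_iter_theta.
- by rewrite -[0]addr0; apply: vgeM.
move=> m; rewrite lcoef_iter_theta mulrC lcoefM_nat //= big_ord_recr /= subnn.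
case: (hv m) => _; rewrite size_mkseq mulNr => /eqP; rewrite subr_eq => /eqP ->.
rewrite [f 0 * _]mulrC; congr (_ + _).
by apply: eq_bigr => i _; rewrite nth_mkseq.
Qed.

(** The leading coefficient is a root of x^(q+1) = u(0). In every later degree the new coefficient
    occurs only in v_0 x^q + x v_0^q, an equation solvable after division by v_0. *)
Lemma norm_unit (u : L) : val_is 0 u -> exists2 x : L, val_is 0 x & x * theta x = u.
Proof.
move=> [u0 u1]; have q1 := @card_gt1 Fq.
(* The guards make the relation satisfiable for every prefix, including prefixes with leading term 0
   that never arise. *)
have [s|v hv] := @seq_choice k (fun s x => (s = [::] -> x ^+ q.+1 = u 0) /\
   (s != [::] -> s`_0 != 0 -> s`_0 * x ^+ q +
     \sum_(i < (size s).-1) s`_i.+1 * s`_(size s - i.+1) ^+ q + x * s`_0 ^+ q = u (size s)%:Z)).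
  case: s => [|a s]; first by have [x xE] := @nth_root q.+1 (u 0) isT; exists x.
  have [a0|a0] := eqVneq a 0; first by exists 0; split=> // _; rewrite /= a0 eqxx.
  set S := \sum_(i < _) _.
  have [x xE] := additive_root (a ^+ q / a) ((u (size (a :: s))%:Z - S) / a) q1.
  exists x; split=> // _ _; rewrite -[(a :: s)`_0]/a.
  apply/eqP; rewrite addrAC eq_sym -subr_eq; apply/eqP.
  rewrite -[LHS](divfK a0) -xE mulrDl mulrC; congr (_ + _).
  by rewrite mulrAC divfK // mulrC.
have v0 : v 0%N != 0.
  case: (hv 0%N) => /(_ erefl) e _; apply: contra u1 => /eqP z.
  by rewrite -e z expr0n.
have hy : vge 0 (series v) by move=> m /= ->.
exists (series v); first by split.
apply: laurent_eq_nat => //.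
  by rewrite -[0]addr0; apply: vgeM => //; apply: vge_theta.
case=> [|m]; rewrite lcoefM_nat //; try exact: vge_theta.
  by rewrite big_ord1 /= -exprS; case: (hv 0%N) => /(_ erefl).
rewrite big_ord_recl big_ord_recr /=; case: (hv m.+1) => _.
rewrite size_mkseq nth_mkseq // => /(_ isT v0) <-.
rewrite /frobenius subnn addrA; congr (_ * _ + _ + _).
apply: eq_bigr => i _; rewrite !nth_mkseq // ?subSS ltnS ?leq_subr //.
Qed.

End Lang.

Section FixedConstants.
Variables (Fq : finFieldType) (k : closedFieldType) (iota : {rmorphism Fq -> k}).
Local Notation q := #|Fq|.

Lemma natr_card_eq0 : q%:R = 0 :> k.
Proof.
have q1 := @card_gt1 Fq; have := frobenius_pchar_subproof iota.
move=> /andP[_ /allP h]; apply/eqP; rewrite -(dvdn_pcharf (p := pdiv q)) ?pdiv_dvd //.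
by apply: h; rewrite mem_primes pdiv_prime // pdiv_dvd ltnW.
Qed.

(** The polynomial X^Q - X, with Q = q^n, splits in k and has derivative -1, so its roots are
    distinct. *)
Lemma frobenius_fixed_seq n : (0 < n)%N ->
  exists s : seq k, [/\ uniq s, size s = (q ^ n)%N & forall a, a \in s -> a ^+ (q ^ n) = a].
Proof.
move=> n0; have q1 := @card_gt1 Fq.
have Q1 : (1 < q ^ n)%N by rewrite -{1}(expn0 q) ltn_exp2l.
have Q0 : (q ^ n)%:R = 0 :> k by rewrite natrX natr_card_eq0 expr0n gtn_eqF.
pose p : {poly k} := 'X^(q ^ n) - 'X.
have sp : size p = (q ^ n).+1.
  by rewrite size_polyDl ?size_polyXn // size_polyN size_polyX ltnS.
have lp : lead_coef p = 1.
  by rewrite lead_coefDl ?lead_coefXn // size_polyXn size_polyN size_polyX ltnS.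
have [s ps] := closed_field_poly_normal p; rewrite lp scale1r in ps.
exists s; split.
- rewrite -separable_prod_XsubC -ps separable_poly.unlock /p derivB derivXn derivX.
  rewrite -mulr_natl -polyC_natr Q0 mul0r sub0r.
  by rewrite -[X in coprimep _ X]scaleN1r coprimepZr ?oppr_eq0 ?oner_eq0 // coprimep1.
- by have := sp; rewrite ps size_prod_XsubC => -[].
move=> a as_; have : root p a by rewrite ps root_prod_XsubC.
by rewrite /p /root !hornerE subr_eq0 => /eqP.
Qed.

End FixedConstants.

(** * Hilbert 90 for matrices by Poincaré series *)

Section Hilbert90.
Variables (k : fieldType) (t : {rmorphism laurent k -> laurent k}) (Q : nat).
Hypothesis Q1 : (1 < Q)%N.
Hypothesis t_const : forall a, t (lconst a) = lconst (a ^+ Q).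
Local Notation L := (laurent k).

Fixpoint cocycle (C : 'M[L]_3) (r : nat) : 'M[L]_3 :=
  if r is r'.+1 then C *m map_mx t (cocycle C r') else 1%:M.

(** Sum of the first r iterates of the semilinear map x -> C t(x); it is invariant as soon as the
    r-th iterate fixes x. *)
Definition poincare (C : 'M[L]_3) r (x : 'cV[L]_3) : 'cV[L]_3 :=
  \sum_(i < r) cocycle C i *m iter i (map_mx t) x.

Lemma poincare_invariant C r x : cocycle C r = 1%:M -> iter r (map_mx t) x = x ->
  C *m map_mx t (poincare C r x) = poincare C r x.
Proof.
move=> Cr xr; rewrite /poincare map_mx_sum mulmx_sumr.
apply: (addrI x); transitivity (\sum_(i < r.+1) cocycle C i *m iter i (map_mx t) x).
  rewrite big_ord_recl /= mul1mx; congr (_ + _); apply: eq_bigr => i _.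
  by rewrite map_mxM mulmxA.
by rewrite big_ord_recr /= Cr mul1mx xr addrC.
Qed.

Lemma iter_map_const i (a : k) (j : 'I_3) :
  iter i (map_mx t) (lconst a *: delta_mx j 0 : 'cV[L]_3) =
  lconst (a ^+ (Q ^ i)) *: delta_mx j 0.
Proof.
elim: i => [|i IH]; first by rewrite expr1.
by rewrite iterS IH map_mxZ map_delta_mx t_const -exprM expnSr.
Qed.

(** Paired with u, the series of a e_j is a polynomial in a of degree at most Q^(r-1). It has Q^r
    distinct roots, hence vanishes, and its linear coefficient is the j-th entry of u. *)
Lemma poincare_span C r (s : seq k) (u : 'rV[L]_3) : (0 < r)%N ->
  uniq s -> size s = (Q ^ r)%N ->
  (forall a j, a \in s -> u *m poincare C r (lconst a *: delta_mx j 0) = 0) -> u = 0.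
Proof.
move=> r0 us ss h; apply/rowP => j; rewrite [RHS]mxE.
pose c i := (u *m cocycle C i) 0 j.
pose p : {poly L} := \sum_(i < r) c i *: 'X^(Q ^ i).
have rp a : a \in s -> root p (lconst a).
  move=> as_; have := congr1 (fun A : 'M_1 => A 0 0) (h a j as_).
  rewrite /poincare mulmx_sumr.
  rewrite summxE [RHS]mxE => e; apply/rootP; rewrite -[RHS]e /p horner_sum.
  apply: eq_bigr => i _; rewrite iter_map_const !hornerE -scalemxAr -scalemxAr mxE mulrC.
  rewrite rmorphXn; congr (_ * _); rewrite mulmxA /c.
  by rewrite -colE [RHS]mxE.
have p0 : p = 0.
  apply: (roots_geq_poly_eq0 (rs := map (@lconst k) s)).
  - by apply/allP => _ /mapP[a as_ ->]; apply: rp.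
  - by rewrite map_inj_uniq //; apply: fmorph_inj.
  rewrite size_map ss; apply: leq_trans (size_sum _ _ _) _.
  apply/bigmax_leqP => i _; apply: leq_trans (size_scale_leq _ _) _.
  by rewrite size_polyXn ltn_exp2l.
have := congr1 (fun A : {poly L} => A`_1) p0; rewrite coef0 coef_sum.
case: r r0 {ss h p rp p0} @c => // r _ c.
rewrite big_ord_recl big1 ?addr0 => [|i _].
  by rewrite coefZ coefXn expn0 eqxx mulr1 /c /= mulmx1.
rewrite coefZ coefXn (_ : (1 == _)%N = false) ?mulr0 // eq_sym; apply/gtn_eqF.
by rewrite -{1}(expn0 Q) ltn_exp2l.
Qed.

Lemma hilbert90 C r (s : seq k) : (0 < r)%N -> uniq s -> size s = (Q ^ r)%N ->
  (forall a, a \in s -> a ^+ (Q ^ r) = a) -> cocycle C r = 1%:M ->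
  exists2 P, P \in unitmx & C *m map_mx t P = P.
Proof.
move=> r0 us ss sQ Cr.
suff H n : (n <= 3)%N -> exists2 P : 'M[L]_(3, n), \rank P = n & C *m map_mx t P = P.
  have [P rP PE] := H 3%N isT; exists P => //.
  by rewrite -row_free_unit /row_free rP.
elim: n => [_|n IH n3].
  by exists 0; [rewrite mxrank0|rewrite [LHS]thinmx0].
have [|P rP PE] := IH; first exact: ltnW.
(* A functional u killing the invariant columns found so far does not kill every Poincaré series;
   one that it does not kill is a further independent column. *)
have /rowV0Pn[u uP u0] : kermx P != 0.
  by rewrite kermx_eq0 /row_free rP; apply/eqP; lia.
have [a [j [as_ ua]]] : exists a j, a \in s /\ u *m poincare C r (lconst a *: delta_mx j 0) != 0.
  apply: contrapT => H; case/eqP: u0; apply: (poincare_span (C := C) r0 us ss) => a j as_.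
  by apply/eqP/negPn/negP => e; apply: H; exists a, j.
set v := poincare _ _ _ in ua.
have vE : C *m map_mx t v = v.
  by apply: poincare_invariant => //; rewrite iter_map_const sQ.
have -> : n.+1 = (n + 1)%N by rewrite addn1.
exists (row_mx P v); last by rewrite map_row_mx mul_mx_row PE vE.
have uP0 : u *m P = 0 by apply/sub_kermxP.
rewrite -mxrank_tr tr_row_mx -addsmxE mxrank_disjoint_sum ?mxrank_tr ?rP.
  congr (_ + _)%N; apply/eqP; rewrite eqn_leq rank_leq_col lt0n mxrank_eq0.
  by apply: contra ua => /eqP ->; rewrite mulmx0.
apply/eqP/rowV0P => w; rewrite sub_capmx => /andP[/submxP[x wx] /submxP[y wy]].
have e : w *m u^T = 0.
  by rewrite wx -mulmxA -trmx_mul uP0 trmx0 mulmx0.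
have : y 0 0 * (u *m v) 0 0 = 0.
  have <- : (w *m u^T) 0 0 = 0 by rewrite e mxE.
  by rewrite wy -mulmxA -trmx_mul [RHS]mxE big_ord1 [in RHS]mxE.
move/eqP; rewrite mulf_eq0 => /orP[/eqP y0|/eqP uv0].
  by rewrite wy (_ : y = 0) ?mul0mx //; apply/matrixP => i l; rewrite !ord1 y0 mxE.
by case/eqP: ua; apply/matrixP => i l; rewrite !ord1 uv0 mxE.
Qed.

End Hilbert90.

(** * Hermitian forms of rank 3 over the field fixed by theta^2 *)

Section HermitianForm.
Variables (Fq : finFieldType) (k : closedFieldType) (iota : {rmorphism Fq -> k}).
Local Notation L := (laurent k).
Local Notation theta := (laurent_map (frobenius iota)).
Local Notation q := #|Fq|.
Variable H : 'M[L]_3.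
Hypothesis H_herm : H^T = map_mx theta H.
Hypothesis H_unit : H \in unitmx.

Lemma thetaM a b : theta (a * b) = theta a * theta b.
Proof. exact: rmorphM. Qed.
Lemma thetaN a : theta (- a) = - theta a.
Proof. exact: rmorphN. Qed.
Lemma thetaB a b : theta (a - b) = theta a - theta b.
Proof. exact: rmorphB. Qed.
Lemma thetaV a : theta a^-1 = (theta a)^-1.
Proof. exact: fmorphV. Qed.
Lemma theta1 : theta 1 = 1.
Proof. exact: rmorph1. Qed.
Lemma theta0 : theta 0 = 0.
Proof. exact: rmorph0. Qed.

Definition hform (x y : 'cV[L]_3) : L := ((map_mx theta x)^T *m H *m y) 0 0.
Local Notation h := hform.

Lemma hformDl x x' y : h (x + x') y = h x y + h x' y.
Proof. by rewrite /h map_mxD linearD /= !mulmxDl mxE. Qed.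
Lemma hformDr x y y' : h x (y + y') = h x y + h x y'.
Proof. by rewrite /h mulmxDr mxE. Qed.
Lemma hformZl a x y : h (a *: x) y = theta a * h x y.
Proof. by rewrite /h map_mxZ linearZ /= -!scalemxAl mxE. Qed.
Lemma hformZr a x y : h x (a *: y) = a * h x y.
Proof. by rewrite /h -scalemxAr mxE. Qed.

(* Rational over F_{q^2}((ε)), the field fixed by theta^2. *)
Definition rational_vec (x : 'cV[L]_3) : Prop := map_mx theta (map_mx theta x) = x.
Definition rational (a : L) : Prop := theta (theta a) = a.

Lemma hform_sym x y : rational_vec x -> h y x = theta (h x y).
Proof.
move=> xx; have -> : theta (h x y) = (map_mx theta ((map_mx theta x)^T *m H *m y)) 0 0.
  by rewrite mxE.
rewrite !map_mxM -map_trmx xx -H_herm /h.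
have -> : x^T *m H^T *m map_mx theta y = ((map_mx theta y)^T *m H *m x)^T.
  by rewrite !trmx_mul trmxK mulmxA.
by rewrite [RHS]mxE.
Qed.

Lemma hform_rational x y : rational_vec x -> rational_vec y -> rational (h x y).
Proof. by move=> xx yy; rewrite /rational -(hform_sym y xx) -(hform_sym x yy). Qed.

Lemma rational_vecD x y : rational_vec x -> rational_vec y -> rational_vec (x + y).
Proof. by move=> ex ey; rewrite /rational_vec !map_mxD ex ey. Qed.
Lemma rational_vecZ a x : rational a -> rational_vec x -> rational_vec (a *: x).
Proof. by move=> ea ex; rewrite /rational_vec map_mxZ /= map_mxZ /= ea ex. Qed.
Lemma rational_vec_delta i : rational_vec (delta_mx i 0).
Proof. by rewrite /rational_vec !map_delta_mx. Qed.

Lemma rationalM a b : rational a -> rational b -> rational (a * b).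
Proof. by move=> ea eb; rewrite /rational rmorphM /= rmorphM /= ea eb. Qed.
Lemma rationalV a : rational a -> rational a^-1.
Proof. by move=> ea; rewrite /rational fmorphV /= fmorphV /= ea. Qed.
Lemma rationalN a : rational a -> rational (- a).
Proof. by move=> ea; rewrite /rational rmorphN /= rmorphN /= ea. Qed.

Lemma hform_fixed x : rational_vec x -> theta (h x x) = h x x.
Proof. by move=> xx; rewrite -(hform_sym x xx). Qed.

(** Rationality of z is automatic: applying theta to z theta(z) = a and cancelling theta(z) leaves
    theta^2(z) = z. *)
Lemma norm_even (a : L) n : val_is (2 * n) a -> theta a = a ->
  exists2 z, rational z & z * theta z = a.
Proof.
move=> an aF.
have : val_is 0 (a * eps k ^ (- (2 * n))).
  by have := val_isM an (val_is_eps k (- (2 * n))); rewrite addrN.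
move=> /(norm_unit iota)[x x0 xE].
have e0 := eps_neq0 k; have te z : theta (eps k ^ z) = eps k ^ z.
  by rewrite eps_exp; apply: laurentP => m /=; rewrite rmorph_nat.
pose z := x * eps k ^ n; have zE : z * theta z = a.
  rewrite /z thetaM te mulrACA xE -!expfzDr // -mulrA -expfzDr //.
  by rewrite (_ : _ + _ = 0) ?expr0z ?mulr1 //; lia.
have a0 := val_is_neq0 an; exists z => //.
have z0 : theta z != 0.
  by apply: contra a0 => /eqP e; rewrite -zE e mulr0.
by apply: (mulfI z0); rewrite -thetaM zE aF mulrC.
Qed.

(** The negated ratio of the two values has even valuation, so it is a norm z theta(z), and v + z w
    is isotropic. *)
Lemma isotropic_pair v w m n : rational_vec v -> rational_vec w -> h v w = 0 ->
  val_is m (h v v) -> val_is (m + 2 * n) (h w w) ->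
  exists x, [/\ rational_vec x, x != 0 & h x x = 0].
Proof.
move=> vv ww vw hv hw; have dv0 := val_is_neq0 hv; have dw0 := val_is_neq0 hw.
have wv : h w v = 0 by rewrite (hform_sym w vv) vw theta0.
have [||z zr zE] := @norm_even (- (h v v / h w w)) (- n).
- have := val_isN (val_isM hv (val_isV hw)).
  by rewrite (_ : m - (m + 2 * n) = 2 * - n) //; lia.
- by rewrite thetaN thetaM thetaV !hform_fixed.
exists (v + z *: w); split.
- by apply: rational_vecD => //; apply: rational_vecZ.
- apply: contra dv0 => /eqP e; have : h v (v + z *: w) = h v v.
    by rewrite hformDr hformZr vw mulr0 addr0.
  by rewrite e => <-; rewrite /h mulmx0 mxE.
rewrite hformDl !hformDr !hformZl !hformZr vw wv !mulr0 addr0 add0r.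
by rewrite mulrA [theta z * z]mulrC zE mulNr divfK // subrr.
Qed.

Lemma orth_proj v x : rational_vec v -> rational_vec x -> h v v != 0 ->
  rational_vec (x - (h v x / h v v) *: v) /\ h v (x - (h v x / h v v) *: v) = 0.
Proof.
move=> vv xx v0; split.
  rewrite -scaleNr; apply: rational_vecD => //; apply: rational_vecZ => //.
  by apply/rationalN/rationalM; [|apply: rationalV]; apply: hform_rational.
by rewrite -scaleNr hformDr hformZr mulNr divfK // subrr.
Qed.

Lemma isotropic_exists : exists x, [/\ rational_vec x, x != 0 & h x x = 0].
Proof.
(* A coordinate equal to 1 certifies that a vector produced by orthogonalisation is nonzero. *)
have done_ x i : rational_vec x -> x i 0 = 1 -> h x x = 0 ->
    exists x, [/\ rational_vec x, x != 0 & h x x = 0].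
  move=> xx x1 x0; exists x; split=> //; apply/eqP => e.
  by move/eqP: x1; rewrite e mxE eq_sym oner_eq0.
pose e i : 'cV[L]_3 := delta_mx i 0; have eE i j : e i j 0 = (j == i)%:R.
  by rewrite mxE eqxx andbT.
have er i : rational_vec (e i) by apply: rational_vec_delta.
have [d0|d0] := eqVneq (h (e 0) (e 0)) 0; first by apply: (done_ (e 0) 0); rewrite ?eE.
have [v1r v01] := orth_proj (er 0) (er 1) d0; move: v1r v01.
set v1 := _ - _ => v1r v01.
have v11 : v1 1 0 = 1 by rewrite !mxE /= mulr0 subr0.
have v12 : v1 2 0 = 0 by rewrite !mxE /= mulr0 subr0.
clearbody v1; have [d1|d1] := eqVneq (h v1 v1) 0.
  exact: (done_ v1 1).
have [v2r v02] := orth_proj (er 0) (er 2) d0; move: v2r v02.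
set v2 := _ - _ => v2r v02.
have v22 : v2 2 0 = 1 by rewrite !mxE /= mulr0 subr0.
clearbody v2; have [v3r v13] := orth_proj v1r v2r d1; move: v3r v13.
set c := h _ _ / _; set v3 := _ - _ => v3r v13.
have v03 : h (e 0) v3 = 0 by rewrite /v3 -scaleNr hformDr hformZr v02 v01 mulr0 addr0.
have v32 : v3 2 0 = 1 by rewrite !mxE v22 v12 mulr0 subr0.
clearbody v3.
have [d3|d3] := eqVneq (h v3 v3) 0.
  exact: (done_ v3 2).
have [m0 h0] := val_is_exists d0; have [m1 h1] := val_is_exists d1.
have [m3 h3] := val_is_exists d3.
have [[n nE]|[[n nE]|[n nE]]] : (exists n : int, m1 = m0 + 2 * n) \/
  (exists n : int, m3 = m0 + 2 * n) \/ (exists n : int, m3 = m1 + 2 * n).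
- have [e1|[e1|e1]] : ((2%Z %| m1 - m0) \/ (2%Z %| m3 - m0) \/ (2%Z %| m3 - m1))%Z by lia.
  + by left; case/dvdzP: e1 => n nE; exists n; lia.
  + by right; left; case/dvdzP: e1 => n nE; exists n; lia.
  by right; right; case/dvdzP: e1 => n nE; exists n; lia.
- by rewrite nE in h1; apply: isotropic_pair h0 h1.
- by rewrite nE in h3; apply: isotropic_pair h0 h3.
by rewrite nE in h3; apply: isotropic_pair h1 h3.
Qed.

Lemma hyperbolic_pair : exists v w, [/\ rational_vec v, rational_vec w,
  h v v = 0, h w w = 0 & h v w = 1].
Proof.
have [v [vv v0 hv]] := isotropic_exists.
have [j hj] : exists j, h v (delta_mx j 0) != 0.
  apply: contrapT => N; case/eqP: v0; rewrite -vv.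
  suff -> : map_mx theta v = 0 by rewrite map_mx0.
  suff e : (map_mx theta v)^T *m H = 0.
    by apply: (can_inj trmxK); rewrite trmx0 -(mulmxK H_unit (map_mx theta v)^T) e mul0mx.
  apply/rowP => j; rewrite [RHS]mxE; apply/eqP/negPn/negP => hj; apply: N; exists j.
  by rewrite /h -colE mxE.
pose w0 := (h v (delta_mx j 0))^-1 *: delta_mx j (0 : 'I_1).
have w0r : rational_vec w0.
  apply: rational_vecZ; last exact: rational_vec_delta.
  by apply/rationalV/hform_rational => //; apply: rational_vec_delta.
have vw0 : h v w0 = 1 by rewrite hformZr mulVf.
clearbody w0.
have w0v : h w0 v = 1 by rewrite (hform_sym _ vv) vw0 theta1.
(* A constant of trace one, t + t^q = 1, takes the place of 1/2 in making the second vector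
   isotropic. *)
have [t tE] := @additive_root k q 1 1 (@card_gt1 Fq).
have tE' : theta (lconst t) = 1 - lconst t.
  by rewrite theta_const -(rmorph1 (@lconst k)) -rmorphB -tE mul1r addrK.
have tr : rational (lconst t) by rewrite /rational tE' thetaB theta1 tE' subKr.
pose a := - h w0 w0 * lconst t.
have ar : rational a by apply: rationalM => //; apply/rationalN/hform_rational.
have aE : a + theta a = - h w0 w0.
  by rewrite thetaM thetaN hform_fixed // tE' -mulrDr subrKC mulr1.
clearbody a; exists v, (w0 + a *: v); split=> //.
- by apply: rational_vecD => //; apply: rational_vecZ.
- rewrite hformDl !hformDr !hformZl !hformZr hv vw0 w0v !mulr0 !mulr1 addr0.
  by rewrite -addrA aE subrr.
by rewrite hformDr hformZr hv mulr0 addr0 vw0.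
Qed.

Lemma hermitian_standard : exists (P : 'M[L]_3) (d : L), [/\ P \in unitmx, d != 0 &
  (map_mx theta P)^T *m H *m P = d *: antidiag L].
Proof.
have [v [w [vv ww hvv hww hvw]]] := hyperbolic_pair.
have hwv : h w v = 1 by rewrite (hform_sym _ vv) hvw theta1.
(* Projection onto the orthogonal complement of the hyperbolic plane; the two coefficients are
   crossed because v pairs with w and not with itself. *)
pose u j := delta_mx j 0 - h w (delta_mx j 0) *: v - h v (delta_mx j 0) *: w.
have hvu j : h v (u j) = 0.
  by rewrite /u -!scaleNr !hformDr !hformZr hvv hvw mulr0 addr0 mulr1 subrr.
have hwu j : h w (u j) = 0.
  by rewrite /u -!scaleNr !hformDr !hformZr hww hwv mulr0 addr0 mulr1 subrr.
have ur j : rational_vec (u j).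
  have dr := rational_vec_delta j; rewrite /u -!scaleNr.
  by apply: rational_vecD; [apply: rational_vecD => //|];
     apply: rational_vecZ => //; apply/rationalN/hform_rational.
have [j u0] : exists j, u j != 0.
  apply: contrapT => N; have uz j : u j = 0 by apply/eqP/negPn/negP => e; apply: N; exists j.
  (* If every projection vanished, v and w would span the whole space of dimension 3. *)
  have : (\rank (1%:M : 'M[L]_3) <= 1 + 1)%N.
    pose A := \row_j h w (delta_mx j 0); pose B := \row_j h v (delta_mx j 0).
    have -> : 1%:M = v *m A + w *m B.
      apply/matrixP => i j; have /eqP := congr1 (fun x : 'cV_3 => x i 0) (uz j).
      rewrite !mxE !big_ord1 !mxE eqxx andbT subr_eq0 subr_eq => /eqP ->.
      by rewrite addrC mulrC; congr (_ + _); rewrite mulrC.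
    apply: leq_trans (mxrank_add _ _) _; apply: leq_add;
      exact: leq_trans (mxrankM_maxl _ _) (rank_leq_col _).
  by rewrite mxrank1.
have huv : h (u j) v = 0 by rewrite (hform_sym _ vv) hvu theta0.
have huw : h (u j) w = 0 by rewrite (hform_sym _ ww) hwu theta0.
pose mk (x y z : 'cV[L]_3) : 'M[L]_3 := \matrix_(i, l) (nth x [:: x; y; z] l) i 0.
have col_mk x y z l : col l (mk x y z) = nth x [:: x; y; z] l.
  by apply/colP => i; rewrite !mxE.
have gram P a b : ((map_mx theta P)^T *m H *m P) a b = h (col a P) (col b P).
  rewrite /h !mxE; apply: eq_bigr => l _; rewrite !mxE; congr (_ * _).
  by apply: eq_bigr => r _; rewrite !mxE.
pose P := mk v (u j) w; set d := h (u j) (u j).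
have Pu : P \in unitmx.
  rewrite -unitmx_tr -row_free_unit -kermx_eq0; apply/rowV0P => c /sub_kermxP cP.
  have Pc : c 0 0 *: v + c 0 1 *: u j + c 0 2 *: w = 0.
    transitivity ((c *m P^T)^T); last by rewrite cP trmx0.
    rewrite trmx_mul trmxK; apply/colP => i; rewrite !mxE sum3 !mxE /=.
    by rewrite ![c _ _ * _]mulrC.
  have c2 : c 0 2 = 0.
    have := congr1 (h v) Pc; rewrite !hformDr !hformZr hvv hvu hvw !mulr0 !add0r mulr1 => ->.
    by rewrite /h mulmx0 mxE.
  have c0 : c 0 0 = 0.
    have := congr1 (h w) Pc; rewrite !hformDr !hformZr hwv hwu hww !mulr0 !addr0 mulr1 => ->.
    by rewrite /h mulmx0 mxE.
  have c1 : c 0 1 = 0.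
    move/eqP: Pc; rewrite c0 c2 !scale0r add0r addr0 scaler_eq0 (negbTE u0) orbF.
    by move/eqP.
  by apply/rowP; apply: ord3P; rewrite !mxE.
have Gu (R : 'M[L]_3) : R \in unitmx -> (map_mx theta R)^T *m H *m R \in unitmx.
  by move=> Ru; rewrite !unitmx_mul unitmx_tr map_unitmx Ru H_unit.
have d0 : d != 0.
  apply/eqP => d0; have := Gu P Pu; set G := _ *m _ *m _ => hG.
  have : G *m delta_mx 1 0 = 0 :> 'cV_3.
    apply/colP => i; rewrite -colE [LHS]mxE [RHS]mxE /G gram !col_mk.
    move: i; apply: ord3P => /=.
    - exact: hvu.
    - exact: d0.
    exact: hwu.
  move=> /(congr1 (mulmx (invmx G))); rewrite mulKmx // mulmx0 => /(congr1 (fun x : 'cV_3 => x 1 0)).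
  by move/eqP; rewrite !mxE /= oner_eq0.
have dF : theta d = d by apply: hform_fixed.
(* Scaling w by d, which theta fixes, makes all three antidiagonal values equal to d. *)
have E : (map_mx theta (mk v (u j) (d *: w)))^T *m H *m mk v (u j) (d *: w) = d *: antidiag L.
  apply/matrixP => a b; rewrite gram !col_mk !mxE.
  move: a b; do 2![apply: ord3P]; rewrite /= ?hformZl ?hformZr
    ?(hvv, hvu, hvw, huv, huw, hwv, hwu, hww) ?(mulr0, mulr1) //.
exists (mk v (u j) (d *: w)), d; split=> //.
have : d *: antidiag L \in unitmx by rewrite unitmxZ ?unitfE // antidiag_unit.
by rewrite -E unitmx_mul => /andP[].
Qed.

End HermitianForm.

(** * The Frobenius of the unitary group on matrices *)

Section UnitaryMatrix.
Variables (K : fieldType) (theta : {rmorphism K -> K}).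
Local Notation J := (antidiag K).
Implicit Types (A B : 'M[K]_3).

(** A lift of [unitary] to GL_3; the scalars that PGL_3 forgets are needed to solve the cocycle
    equation. *)
Definition sigma_mx B : 'M[K]_3 := J *m (map_mx theta (invmx B))^T *m J.
Local Notation S := sigma_mx.

Lemma sigma_mx_unit B : B \in unitmx -> S B \in unitmx.
Proof.
by move=> Bu; rewrite !unitmx_mul antidiag_unit unitmx_tr map_unitmx unitmx_inv Bu.
Qed.

Lemma map_antidiag : map_mx theta J = J.
Proof. by apply/matrixP => i j; rewrite !mxE rmorph_nat. Qed.

Lemma tr_antidiag : J^T = J.
Proof.
apply/matrixP => i j; rewrite !mxE.
by rewrite eq_sym (can2_eq (@rev_ordK 3) (@rev_ordK 3)).
Qed.

Lemma invmxM A B : A \in unitmx -> B \in unitmx -> invmx (A *m B) = invmx B *m invmx A.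
Proof.
by move=> Au Bu; apply: invmx_uniq; rewrite mulmxA mulmxK // mulmxV.
Qed.

Lemma sigma_mxM A B : A \in unitmx -> B \in unitmx -> S (A *m B) = S A *m S B.
Proof.
move=> Au Bu; rewrite /S invmxM // map_mxM trmx_mul !mulmxA; congr (_ *m _ *m _).
by rewrite -[RHS]mulmxA antidiagK mulmx1.
Qed.

Lemma invmx_sigma B : B \in unitmx -> invmx (S B) = J *m (map_mx theta B)^T *m J.
Proof.
move=> Bu; apply: invmx_uniq; rewrite /S.
rewrite !mulmxA -(mulmxA _ J J) antidiagK mulmx1.
rewrite -[in X in X *m J](mulmxA J) -trmx_mul -map_mxM mulmxV //.
by rewrite map_mx1 trmx1 mulmx1 antidiagK.
Qed.

Lemma sigma_mxK B : B \in unitmx -> S (S B) = map_mx theta (map_mx theta B).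
Proof.
move=> Bu; rewrite {1}/S invmx_sigma // !map_mxM map_antidiag -map_trmx.
rewrite !trmx_mul tr_antidiag trmxK !mulmxA antidiagK mul1mx.
by rewrite -mulmxA antidiagK mulmx1.
Qed.

Lemma sigma_mxZ f B : f != 0 -> B \in unitmx -> S (f *: B) = (theta f)^-1 *: S B.
Proof.
move=> f0 Bu; rewrite /S invmxZ // ?unitmxZ ?unitfE // map_mxZ fmorphV linearZ /=.
by rewrite -scalemxAr -scalemxAl.
Qed.

Lemma sigma_mx1 : S 1%:M = 1%:M.
Proof. by rewrite /S invmx1 map_mx1 trmx1 mulmx1 antidiagK. Qed.

Lemma sigma_mxVK A : A \in unitmx -> S A *m S (invmx A) = 1%:M.
Proof. by move=> Au; rewrite -sigma_mxM ?unitmx_inv // mulmxV // sigma_mx1. Qed.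

(** Applying S twice is theta^2 on entries. In the product, S(P) cancels against the S of the
    inverse of P, leaving P^-1 B S(B) theta^2(P). *)
Lemma sigma_mx_twist P B : P \in unitmx -> B \in unitmx ->
  B *m S B *m map_mx theta (map_mx theta P) = P ->
  (invmx P *m B *m S P) *m S (invmx P *m B *m S P) = 1%:M.
Proof.
move=> Pu Bu e; have iPu : invmx P \in unitmx by rewrite unitmx_inv.
have PBu : invmx P *m B \in unitmx by rewrite unitmx_mul iPu.
rewrite (sigma_mxM PBu (sigma_mx_unit Pu)) (sigma_mxM iPu Bu) (sigma_mxK Pu).
have cancel (A X C D E F : 'M[K]_3) :
    C *m D = 1%:M -> (A *m X *m C) *m (D *m E *m F) = A *m (X *m E *m F).
  by move=> CD; rewrite !mulmxA -(mulmxA _ C D) CD mulmx1.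
by rewrite (cancel _ _ _ _ _ _ (sigma_mxVK Pu)) e mulVmx.
Qed.

(** B S(B) = 1 says that B^-1 = J theta(B^-1)^T J, and multiplying by J on the left turns this into
    the hermitian condition. *)
Lemma sigma_mx_hermitian B : B *m S B = 1%:M ->
  (J *m invmx B)^T = map_mx theta (J *m invmx B).
Proof.
move=> e; have := invmx_uniq e; rewrite {1}/S => iB.
by rewrite map_mxM map_antidiag {1}iB !mulmxA antidiagK mul1mx trmx_mul trmxK tr_antidiag.
Qed.

Lemma sigma_mx_scalar B g d : B \in unitmx -> g \in unitmx -> d != 0 ->
  (map_mx theta g)^T *m (J *m invmx B) *m g = d *: J ->
  invmx g *m B *m S g = (d^-1)%:M.
Proof.
move=> Bu gu d0 e; have igu : invmx g \in unitmx by rewrite unitmx_inv.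
have gBu : invmx g *m B \in unitmx by rewrite unitmx_mul igu.
have Sgu := sigma_mx_unit gu.
have E : invmx (invmx g *m B *m S g) = d%:M.
  rewrite (invmxM gBu Sgu) (invmxM igu Bu) invmxK (invmx_sigma gu).
  have assoc (X Y Z : 'M[K]_3) : J *m X *m J *m (Y *m Z) = J *m (X *m (J *m Y) *m Z).
    by rewrite !mulmxA.
  by rewrite assoc e -scalemxAr antidiagK scale_scalar_mx mulr1.
rewrite -[LHS]invmxK E; apply: invmx_uniq.
by rewrite -scalar_mxM mulfV.
Qed.

End UnitaryMatrix.

(** * Trivialising a basic element *)

Section BasicTrivial.
Variables (Fq : finFieldType) (k : closedFieldType) (iota : {rmorphism Fq -> k}).
Local Notation L := (laurent k).
Local Notation theta := (laurent_map (frobenius iota)).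
Local Notation sigma := (sigma iota).
Local Notation q := #|Fq|.
Local Notation J := (antidiag L).
Implicit Types (A B : 'M[L]_3).

Local Notation S := (sigma_mx theta).

Lemma pgl_sigma B : B \in unitmx -> sigma (pgl B) = pgl (S B).
Proof. exact: unitary_pgl. Qed.

Definition theta2 : {rmorphism L -> L} := theta \o theta.

Lemma map_theta2 m n (A : 'M[L]_(m, n)) :
  map_mx theta2 A = map_mx theta (map_mx theta A).
Proof. by apply/matrixP => i j; rewrite !mxE. Qed.

Lemma theta2_const a : theta2 (lconst a) = lconst (a ^+ (q ^ 2)).
Proof. by rewrite /theta2 /= !theta_const -exprM mulnn. Qed.

Lemma iter_theta2 n (f : L) : iter n theta2 f = iter (2 * n) theta f.
Proof. by elim: n => [|n IH]; rewrite ?muln0 // mulnS /= IH. Qed.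

Definition sigma_conj (b b' : U3 k) : Prop := exists g, b' = (g^-1 * b * sigma g)%g.

Lemma sigma_conj_trans b b' b'' : sigma_conj b b' -> sigma_conj b' b'' -> sigma_conj b b''.
Proof.
move=> [g ->] [h ->]; exists (g * h)%g.
by rewrite sigmaM invMg !mulgA.
Qed.

Lemma sigma_normS n b : sigma_norm iota n.+1 b = (b * sigma (sigma_norm iota n b))%g.
Proof.
rewrite /sigma_norm big_ord_recl; congr (_ * _)%g.
by rewrite (big_morph sigma (@sigmaM _ _ iota) (@sigma1 _ _ iota)); apply: eq_bigr.
Qed.

Lemma sigma_normD m n b :
  sigma_norm iota (m + n) b = (sigma_norm iota m b * iter m sigma (sigma_norm iota n b))%g.
Proof.
elim: m => [|m IH]; first by rewrite /sigma_norm big_ord0 mul1g.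
by rewrite addSn !sigma_normS IH sigmaM mulgA.
Qed.

Lemma sigma_norm_conj n g b : sigma_norm iota n (g^-1 * b * sigma g)%g =
  (g^-1 * sigma_norm iota n b * iter n sigma g)%g.
Proof.
elim: n => [|n IH]; first by rewrite /sigma_norm !big_ord0 mulg1 mulVg.
by rewrite !sigma_normS IH !sigmaM sigmaV !mulgA mulgK.
Qed.

(** Doubling the exponent makes it even, so that the corresponding power of sigma acts on matrices
    through powers of theta^2, without inverse transpose. *)
Lemma basic_norm_trivial b : basic iota b -> exists2 r, (0 < r)%N &
  exists2 b', sigma_conj b b' & sigma_norm iota (2 * r) b' = 1%g.
Proof.
move=> [[nu1 nu2] [_ _ [n [l [g [n0 l1 l2 _ e]]]]] [/= z1 z2]].
have l0 : l = 0.
  move: l1 l2; rewrite /= z1 z2 mulr0 => /eqP; rewrite intr_eq0 => /eqP l1 /eqP.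
  by rewrite intr_eq0 => /eqP l2; rewrite [l]surjective_pairing l1 l2.
have N1 : sigma_norm iota n (g^-1 * b * sigma g)%g = 1%g.
  by rewrite sigma_norm_conj e l0 -(@iw_lift1 k).
exists n => //; exists (g^-1 * b * sigma g)%g; first by exists g.
rewrite mul2n -addnn sigma_normD N1 mul1g.
by elim: n {n0 l1 l2 e N1} => //= n ->; rewrite sigma1.
Qed.

Lemma cocycle_unit C r : C \in unitmx -> cocycle theta2 C r \in unitmx.
Proof.
by move=> Cu; elim: r => [|r IH] /=; rewrite ?unitmx1 // unitmx_mul Cu map_unitmx.
Qed.

Lemma pgl_cocycle B r : B \in unitmx ->
  pgl (cocycle theta2 (B *m S B) r) = sigma_norm iota (2 * r) (pgl B).
Proof.
move=> Bu; have Su := sigma_mx_unit theta Bu.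
have Cu : B *m S B \in unitmx by rewrite unitmx_mul Bu.
elim: r => [|r IH]; first by rewrite /sigma_norm big_ord0 -pgl1.
have Au := cocycle_unit r Cu; have SAu := sigma_mx_unit theta Au.
have SSu := sigma_mx_unit theta SAu.
have SSSu : S B *m S (S (cocycle theta2 (B *m S B) r)) \in unitmx.
  by rewrite unitmx_mul Su.
have -> : sigma_norm iota (2 * r.+1) (pgl B) =
    (pgl B * sigma (pgl B * sigma (sigma_norm iota (2 * r) (pgl B))))%g.
  by rewrite -2!sigma_normS mulnS.
rewrite -IH (pgl_sigma Au) sigmaM (pgl_sigma Bu) (pgl_sigma SAu).
rewrite -(pglM Su SSu) -(pglM Bu SSSu); congr pgl.
by rewrite [LHS]/= map_theta2 -(sigma_mxK theta Au) mulmxA.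
Qed.

Lemma val_is_det_sigma B m : B \in unitmx -> val_is m (\det B) -> val_is (- m) (\det (S B)).
Proof.
move=> Bu hm; rewrite !det_mulmx mulrAC -det_mulmx antidiagK det1 mul1r.
rewrite det_tr det_map_mx det_inv /= thetaV.
by apply/val_isV/val_is_theta.
Qed.

Lemma val_is_cocycle C r : val_is 0 (\det C) -> val_is 0 (\det (cocycle theta2 C r)).
Proof.
move=> hC; elim: r => [|r IH]; first by rewrite det1; exact: val_is1.
rewrite /= det_mulmx det_map_mx -[0]addr0; apply: val_isM => //=.
by do 2!apply: val_is_theta.
Qed.

Lemma cocycle_scale C (y : L) r : y != 0 ->
  cocycle theta2 ((y / theta2 y) *: C) r = (y / iter r theta2 y) *: cocycle theta2 C r.
Proof.
move=> y0; have i0 n : iter n theta2 y != 0 by elim: n => [//|n IH]; rewrite iterS fmorph_eq0.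
elim: r => [|r IH]; first by rewrite /= divff // scale1r.
rewrite [LHS]/= IH map_mxZ -scalemxAl -scalemxAr scalerA; congr (_ *: _).
have ty0 : theta2 y != 0 := i0 1%N.
by rewrite (fmorph_div theta2) mulrA (divfK ty0).
Qed.

(** The norm is a scalar c. Since S inverts the valuation of determinants, B S(B) has determinant of
    valuation 0, so c^3 and hence c are units, and Lang's equation applies to c. *)
Lemma norm_trivial_mx b r : (0 < r)%N -> sigma_norm iota (2 * r) b = 1%g ->
  exists2 B, B \in unitmx /\ b = pgl B & cocycle theta2 (B *m S B) r = 1%:M.
Proof.
move=> r0; have [B Bu ->] := pgl_surj b; have Su := sigma_mx_unit theta Bu.
have Cu : B *m S B \in unitmx by rewrite unitmx_mul Bu.
rewrite -pgl_cocycle // -pgl1 => /(pgl_eq (cocycle_unit r Cu) (unitmx1 _ _))[c c0 cE].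
have hc : val_is 0 c.
  have db : \det B != 0 by rewrite -unitfE -unitmxE.
  have [m hm] := val_is_exists db; have [n hn] := val_is_exists c0.
  have : val_is 0 (\det (cocycle theta2 (B *m S B) r)).
    apply: val_is_cocycle; rewrite det_mulmx -(addrN m).
    exact: val_isM (val_is_det_sigma Bu hm).
  rewrite cE detZ det1 mulr1 => h3.
  have := val_is_uniq (val_isM hn (val_isM hn hn)) h3 => n3.
  have n0 : n = 0 by lia.
  by rewrite n0 in hn.
have [|y hy yE] := @lang_unit _ _ iota (2 * r) c _ hc; first by lia.
(* Scaling B by y theta(y) multiplies B S(B) by y / theta^2(y), and the cocycle then telescopes to y
   / theta^(2r)(y) = 1/c. *)
have y0 := val_is_neq0 hy; pose f := y * theta y.
have ty0 : theta y != 0 by rewrite fmorph_eq0.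
have f0 : f != 0 by rewrite mulf_neq0.
exists (f *: B); first by split; rewrite ?unitmxZ ?unitfE // pglZ.
have -> : (f *: B) *m S (f *: B) = (y / theta2 y) *: (B *m S B).
  have <- : f * (theta f)^-1 = y / theta2 y by rewrite /f thetaM invfM mulrA mulfK.
  by rewrite (sigma_mxZ theta f0 Bu) -scalemxAl -scalemxAr scalerA.
rewrite cocycle_scale // iter_theta2 yE cE scalerA invfM.
by rewrite [c^-1 * _]mulrC mulrA (mulfV y0) mul1r (mulVf c0) scale1r.
Qed.

Lemma basic_trivial b : basic iota b -> exists h, b = (h * (sigma h)^-1)%g.
Proof.
move=> /basic_norm_trivial[r r0 [b1 bb1 /(norm_trivial_mx r0)[B [Bu b1E] CE]]].
have q1 := @card_gt1 Fq; have Q1 : (1 < q ^ 2)%N by rewrite -{1}(expn0 q) ltn_exp2l.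
have [|s [us ss sQ]] := @frobenius_fixed_seq Fq k iota (2 * r); first by lia.
rewrite expnM in ss sQ.
have [P Pu PE] := hilbert90 Q1 theta2_const r0 us ss sQ CE.
set B1 := invmx P *m B *m S P.
have SPu := sigma_mx_unit theta Pu.
have iPu : invmx P \in unitmx by rewrite unitmx_inv.
have PBu : invmx P *m B \in unitmx by rewrite unitmx_mul iPu.
have B1u : B1 \in unitmx by rewrite unitmx_mul PBu.
have b1P : sigma_conj (pgl B) (pgl B1).
  by exists (pgl P); rewrite (pgl_sigma Pu) -(pglV Pu) -(pglM iPu Bu) -(pglM PBu SPu).
have B1E : B1 *m S B1 = 1%:M.
  by apply: sigma_mx_twist => //; rewrite -map_theta2.
have Hu : J *m invmx B1 \in unitmx by rewrite unitmx_mul antidiag_unit unitmx_inv.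
have [g [d [gu d0 gE]]] := hermitian_standard (sigma_mx_hermitian B1E) Hu.
have E := sigma_mx_scalar B1u gu d0 gE.
have igu : invmx g \in unitmx by rewrite unitmx_inv.
have gBu : invmx g *m B1 \in unitmx by rewrite unitmx_mul igu.
have b1g : sigma_conj (pgl B1) 1%g.
  exists (pgl g); rewrite (pgl_sigma gu) -(pglV gu) -(pglM igu B1u).
  rewrite -(pglM gBu (sigma_mx_unit theta gu)) E.
  by rewrite -[X in pgl X]scalemx1 pglZ ?invr_eq0 // pgl1.
rewrite -b1E in b1P; have [h hE] := sigma_conj_trans bb1 (sigma_conj_trans b1P b1g).
exists h; apply: (mulIg (sigma h)); apply: (mulgI (h^-1)%g).
by rewrite mulgVK mulVg hE mulgA.
Qed.

End BasicTrivial.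

Theorem theorem3p4 (Fq : finFieldType) (k : closedFieldType)
  (iota : {rmorphism Fq -> k}) (kalg : forall x : k, algebraicOver iota x)
  (b : U3 k) (hb : basic iota b) (w : iwahori_weyl) :
  ADLV iota w b !=set0 <->
  ~ (\bigcup_(m in [set m : nat | (0 < m)%N]) min_length (Odelta m)) w.
Proof.
have [h bE] := basic_trivial hb.
(* Translating g by the inverse of h turns the quotient twisted by b into an untwisted one. *)
have ADLVE : ADLV iota w b !=set0 <-> nonempty_cell iota w.
  split=> [[_ [g /= hg _]]|[x xw [g xE]]].
    exists (g^-1 * b * sigma iota g)%g => //; exists (h^-1 * g)%g.
    by rewrite bE sigmaM sigmaV invMg invgK !mulgA.
  exists (iwahori_coset (h * g)%g), (h * g)%g => //=.
  by rewrite bE sigmaM invMg !mulgA !mulgVK -xE.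
rewrite ADLVE; split=> [hw [m m0 /(empty_min_length m0)/(_ hw)]//|hw].
have [//|[m m0 wm]] := reduction (nonempty_cell1 iota) (nonempty_cell_s0 iota)
  (nonempty_cell_s1 iota) (nonempty_cell_w0 iota) (@nonempty_cell_delta _ _ iota)
  (@nonempty_cell_tau _ _ iota) (@nonempty_cell_shift _ _ iota)
  (@nonempty_cell_up _ _ iota) (@nonempty_cell_down _ _ iota) w.
by case: hw; exists m.
Qed.
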